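(* Let $(a_{nk})_{n,k\ge0}$ be complex scalars with $\sum_k|a_{nk}|<\infty$ for each $n$. Then the following are equivalent: (i) $\sum_{k\ge0}a_{nk}\hat g(k)z^k\to g$ weakly in $A^1$, for all $g\in A^1$; (ii) $\sum_{k\ge0}a_{nk}\hat g(k)z^k\to g$ in $A^1$-norm, for all $g\in A^1$; (iii) $\sum_{k\ge0}a_{nk}\hat h(k)z^k\to h$ weak* in $\mathcal B$, for all $h\in\mathcal B$; (iv) $\sum_{k\ge0}a_{nk}\hat f(k)z^k\to f$ weakly in $\mathcal B_0$, for all $f\in\mathcal B_0$; (v) $\sum_{k\ge0}a_{nk}\hat f(k)z^k\to f$ in $\mathcal B$-norm, for all $f\in\mathcal B_0$.
   Context: $\mathbb D$ is the unit disk, $dA$ area measure, $\hat g(k)$ Taylor coefficients. The Bergman space $A^1$ consists of holomorphic $f$ on $\mathbb D$ with $\|f\|_{A^1}=\frac1\pi\int_{\mathbb D}|f|\,dA<\infty$. The Bloch space $\mathcal B$ consists of holomorphic $f$ with $\|f\|_{\mathcal B}:=|f(0)|+\sup_{\mathbb D}(1-|z|^2)|f'(z)|<\infty$, and the little Bloch space $\mathcal B_0$ is the closed subspace where $(1-|z|^2)|f'(z)|\to0$ as $|z|\to1$. Up to isomorphism $\mathcal B_0^*\cong A^1$ and $(A^1)^*\cong\mathcal B$ via $\langle g,h\rangle=\lim_{r\to1^-}\frac1\pi\int_{|z|<r}g(z)h(\overline z)\,dA(z)$; weak* in $\mathcal B$ refers to this duality with $A^1$. *)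

(* Defs.v *)
From HB Require Import structures.
From mathcomp Require Import all_boot all_order all_algebra.
From mathcomp Require Import all_classical all_reals all_analysis.
From mathcomp Require Import complex.
Set Implicit Arguments. Unset Strict Implicit. Unset Printing Implicit Defensive.
Import Order.TTheory GRing.Theory Num.Theory.
Import numFieldNormedType.Exports.
Local Open Scope classical_set_scope.
Local Open Scope ring_scope.

(* A holomorphic function on the unit disk D is represented by its sequence
   of Taylor coefficients c : nat -> C (c k = \hat f(k)); the function itself
   is z |-> sum_k c k z^k, which must converge on all of D. *)

Section BergmanBloch.
Variable R : realType.
Local Notation C := (R[i])^o.

Definition cabs (z : C) : R := Normc.normc z.
Definition cpt (x y : R) : C := (x +i* y)%C.

Definition psum (c : nat -> C) (z : C) : C :=
  lim (series (fun k => c k * z ^+ k) @ \oo).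

Definition hol_disk (c : nat -> C) : Prop :=
  forall z : C, cabs z < 1 -> cvg (series (fun k => c k * z ^+ k) @ \oo).

Definition deriv_coef (c : nat -> C) : nat -> C :=
  fun k => k.+1%:R * c k.+1.

Definition disk (r : R) : set (R * R) :=
  [set p | p.1 ^+ 2 + p.2 ^+ 2 < r ^+ 2].

Definition area := (@lebesgue_measure R \x @lebesgue_measure R)%E.

Definition A1_int (c : nat -> C) : \bar R :=
  (\int[area]_(p in disk 1) (cabs (psum c (cpt p.1 p.2)))%:E)%E.

Definition A1 (c : nat -> C) : Prop := hol_disk c /\ (A1_int c < +oo)%E.
Definition A1norm (c : nat -> C) : R := fine (A1_int c) / pi.

Definition bloch_sup (c : nat -> C) : \bar R :=
  ereal_sup [set ((1 - cabs z ^+ 2) * cabs (psum (deriv_coef c) z))%:E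
            | z in [set z : C | cabs z < 1]].

Definition Bloch (c : nat -> C) : Prop := hol_disk c /\ (bloch_sup c < +oo)%E.
Definition Blochnorm (c : nat -> C) : R := cabs (psum c 0) + fine (bloch_sup c).

Definition Bloch0 (c : nat -> C) : Prop :=
  Bloch c /\
  forall eps : R, 0 < eps -> exists r : R, r < 1 /\
    forall z : C, r < cabs z -> cabs z < 1 ->
      (1 - cabs z ^+ 2) * cabs (psum (deriv_coef c) z) < eps.

Definition bdd_lin_functional (S : (nat -> C) -> Prop) (N : (nat -> C) -> R)
    (L : (nat -> C) -> C) : Prop :=
  (forall (u v : nat -> C) (al be : C), S u -> S v ->
     L (fun k => al * u k + be * v k) = al * L u + be * L v) /\
  (exists M : R, forall u, S u -> cabs (L u) <= M * N u).

Definition weakly_to (S : (nat -> C) -> Prop) (N : (nat -> C) -> R)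
    (u : nat -> nat -> C) (f : nat -> C) : Prop :=
  forall L, bdd_lin_functional S N L -> L (u n) @[n --> \oo] --> L f.

Definition norm_to (N : (nat -> C) -> R) (u : nat -> nat -> C) (f : nat -> C)
  : Prop := N (fun k => u n k - f k) @[n --> \oo] --> 0.

Definition cint (D : set (R * R)) (F : R * R -> C) : C :=
  cpt (Rintegral area D (fun p => complex.Re (F p))) (Rintegral area D (fun p => complex.Im (F p))).

Definition pairing (g h : nat -> C) : C :=
  lim ((fun r : R => ((pi^-1)%:C%C *
          cint (disk r) (fun p => psum g (cpt p.1 p.2) *
                                  psum h (conjc (cpt p.1 p.2))) : C)) @ at_left 1).

(* weak* convergence in B = (A^1)^* *)
Definition weakstar_to_Bloch (u : nat -> nat -> C) (h : nat -> C) : Prop :=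
  forall g, A1 g -> pairing g (u n) @[n --> \oo] --> pairing g h.

Definition mult_op (a : nat -> nat -> C) (n : nat) (c : nat -> C) : nat -> C :=
  fun k => a n k * c k.

End BergmanBloch.

(* Main.v *)
(* All five conditions are equivalent to the convergence
   <T_n g, f> -> <g, f> for all g in A^1 and f in B_0, where T_n is the n-th
   multiplier.  Uniform boundedness, applied first in f and then in g, turns it
   into |<T_n g, f>| <= M |g| |f|.  Each of the two norms is controlled by the
   pairing: A^1 is normed by B_0 (test g against the projection of the
   unimodular function conj g / |g| restricted to a smaller disk), and B by A^1
   (test f against the kernels 2z / (1 - uz)^3, whose A^1-norm is
   O(1 / (1 - |u|^2)) and whose pairing with f is a multiple of f'(u)).  Hence
   the T_n are uniformly bounded in norm on A^1 and on B_0, and they converge in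
   norm on monomials because a_nk -> 1; polynomials being dense, T_n converges
   strongly. *)
Require Import Defs.
From HB Require Import structures.
From mathcomp Require Import all_boot all_order all_algebra.
From mathcomp Require Import all_classical all_reals all_analysis.
From mathcomp Require Import complex measurable_realfun.
From mathcomp Require Import ring lra zify.
Set Implicit Arguments. Unset Strict Implicit. Unset Printing Implicit Defensive.
Import Order.TTheory GRing.Theory Num.Theory.
Import numFieldNormedType.Exports.
Local Open Scope classical_set_scope.
Local Open Scope ring_scope.
(** * Complex numbers and power series *)

(** No representation theorem for the dual spaces is proved. An arbitrary bounded functional occurs
    only in conclusions, where norm convergence settles it; weak convergence as a hypothesis is
    tested only on functionals given by the pairing. The price is a two-sided control of the pairing
    by hand. Its upper bound is not immediate: a Bloch function may grow logarithmically, so g(z)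
    h(conj z) need not be integrable on the disk and the limit over smaller disks must be shown to
    exist. It is rewritten as the integral of g against (1 - |z|^2) (z h' + 2 h) at conj z, a
    bounded function. The summability of (a_nk)_k enters through one fact: in both spaces |u_k|
    times the norm of z^k is at most a constant times the norm of u. So T_n u is an absolutely
    convergent series of monomials, and T_n even maps B into B_0, which makes T_n its own transpose
    under the pairing. Area integrals are reduced to moments of z^j conj(z)^k, found by symmetry
    without polar coordinates; the area of the unit disk stays an unspecified constant [A0], and the
    norm constants are generous. *)

Section ComplexBasics.
Variable R : realType.
Local Notation C := (R[i])^o.
Implicit Types (z w : C) (c d : nat -> C) (p : R * R).

Lemma cabs0 : cabs (0 : C) = 0. Proof. exact: Normc.normc0. Qed.
Lemma cabs1 : cabs (1 : C) = 1. Proof. exact: Normc.normc1. Qed.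
Lemma cabsM z w : cabs (z * w) = cabs z * cabs w.
Proof. exact: Normc.normcM. Qed.
Lemma cabsD z w : cabs (z + w) <= cabs z + cabs w.
Proof. exact: le_normcD. Qed.
Lemma cabsN z : cabs (- z) = cabs z. Proof. exact: normcN. Qed.
Lemma cabsV z : cabs (z^-1) = (cabs z)^-1. Proof. exact: Normc.normcV. Qed.
Lemma cabs_ge0 z : 0 <= cabs z. Proof. by case: z => x y; exact: sqrtr_ge0. Qed.
Lemma cabs0_eq0 z : cabs z = 0 -> z = 0. Proof. exact: Normc.eq0_normc. Qed.
Lemma cabsX z n : cabs (z ^+ n) = cabs z ^+ n.
Proof. by elim: n => [|n IH]; rewrite ?expr0 ?cabs1// !exprS cabsM IH. Qed.
Lemma cabsB z w : cabs (z - w) <= cabs z + cabs w.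
Proof. by rewrite -(cabsN w); exact: cabsD. Qed.
Lemma cabsC z w : cabs (z - w) = cabs (w - z).
Proof. by rewrite -cabsN opprB. Qed.
Lemma cabs_real (x : R) : cabs (x%:C%C : C) = `|x|.
Proof. by rewrite /cabs /= expr0n addr0 sqrtr_sqr. Qed.
Lemma cabs_nat n : cabs (n%:R : C) = n%:R.
Proof.
have -> : (n%:R : C) = (n%:R : R)%:C%C by rewrite rmorph_nat.
by rewrite cabs_real ger0_norm.
Qed.
Lemma normC_cabs z : `|(z : R[i])| = ((cabs z)%:C)%C.
Proof. by []. Qed.
Lemma cabs_conj z : cabs (conjc z : C) = cabs z.
Proof. by case: z => x y; rewrite /cabs /= sqrrN. Qed.
Lemma cabs_sqr z : cabs z ^+ 2 = complex.Re z ^+ 2 + complex.Im z ^+ 2.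
Proof. by case: z => x y /=; rewrite sqr_sqrtr// addr_ge0// sqr_ge0. Qed.
Lemma Re_le_cabs z : `|complex.Re z| <= cabs z.
Proof.
rewrite -(@ler_pXn2r _ 2)// ?nnegrE ?cabs_ge0//.
by rewrite cabs_sqr real_normK ?num_real// lerDl sqr_ge0.
Qed.
Lemma Im_le_cabs z : `|complex.Im z| <= cabs z.
Proof.
rewrite -(@ler_pXn2r _ 2)// ?nnegrE ?cabs_ge0//.
by rewrite cabs_sqr real_normK ?num_real// lerDr sqr_ge0.
Qed.
Lemma cabs_le_ReIm z : cabs z <= `|complex.Re z| + `|complex.Im z|.
Proof.
rewrite -(@ler_pXn2r _ 2)// ?nnegrE ?cabs_ge0 ?addr_ge0//.
rewrite cabs_sqr sqrrD !real_normK ?num_real// -addrA lerD2l lerDr.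
by rewrite mulrn_wge0// mulr_ge0.
Qed.
Lemma cabs_cpt (x y : R) : cabs (cpt x y) ^+ 2 = x ^+ 2 + y ^+ 2.
Proof. by rewrite cabs_sqr. Qed.
Lemma cabs_sum (I : Type) (r : seq I) (P : pred I) (F : I -> C) :
  cabs (\sum_(i <- r | P i) F i) <= \sum_(i <- r | P i) cabs (F i).
Proof.
elim/big_rec2: _ => [|i x y _ h]; first by rewrite cabs0.
by apply: le_trans (cabsD _ _) _; rewrite lerD2l.
Qed.
Lemma ReD z w : complex.Re (z + w) = complex.Re z + complex.Re w.
Proof. by case: z w => ? ? []. Qed.
Lemma ImD z w : complex.Im (z + w) = complex.Im z + complex.Im w.
Proof. by case: z w => ? ? []. Qed.
Lemma ReM z w : complex.Re (z * w) =
  complex.Re z * complex.Re w - complex.Im z * complex.Im w.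
Proof. by case: z w => ? ? []. Qed.
Lemma ImM z w : complex.Im (z * w) =
  complex.Re z * complex.Im w + complex.Im z * complex.Re w.
Proof. by case: z w => ? ? []. Qed.

(** The norm on [R[i]] is itself complex-valued, so the radii in its topology are complex numbers
    positive for the partial order. Such numbers are real, and this lemma passes to real radii once
    and for all. *)
Lemma cvgC0P (T : Type) (F : set_system T) {FF : Filter F} (f : T -> C) (l : C) :
  (f @ F --> l) <-> (cabs (f x - l) @[x --> F] --> (0 : R)).
Proof.
split.
- move=> /cvgrPdist_lt h; apply/cvgrPdist_lt => e e0.
  have := h (e%:C)%C; rewrite ltcR => /(_ e0).
  apply: filterS => x.
  have e1 : `|l - f x| = ((cabs (l - f x))%:C)%C :> R[i] by [].
  by rewrite e1 ltcR sub0r normrN ger0_norm ?cabs_ge0// cabsC.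
- move=> /cvgrPdist_lt h; apply/cvgrPdist_lt => e e0.
  have := e0; rewrite ltcE /= => /andP[/eqP ie re].
  have := h _ re; apply: filterS => x.
  rewrite sub0r normrN ger0_norm ?cabs_ge0// cabsC => hx.
  by rewrite (normC_cabs (l - f x)) ltcE /= ie eqxx.
Qed.

Lemma cvgC_lt (T : Type) (F : set_system T) {FF : Filter F} (f : T -> C) (l : C) :
  (f @ F --> l) <-> (forall e : R, 0 < e -> \forall x \near F, cabs (f x - l) < e).
Proof.
split.
- move=> /cvgC0P /cvgrPdist_lt h e e0; have := h e e0; apply: filterS => x.
  by rewrite sub0r normrN ger0_norm ?cabs_ge0.
- move=> h; apply/cvgC0P/cvgrPdist_lt => e e0; have := h e e0.
  by apply: filterS => x; rewrite sub0r normrN ger0_norm ?cabs_ge0.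
Qed.

Lemma squeezeC (T : Type) (F : set_system T) {FF : Filter F} (f : T -> C)
    (g : T -> R) l :
  (\forall x \near F, cabs (f x - l) <= g x) -> g @ F --> 0 -> f @ F --> l.
Proof.
move=> h g0; apply/cvgC0P.
apply: (@squeeze_cvgr _ _ _ _ (fun _ => 0) g) => //; last exact: cvg_cst.
by apply: filterS h => x ->; rewrite cabs_ge0.
Qed.

Lemma squeezeR (T : Type) (F : set_system T) {FF : Filter F} (f : T -> R)
    (g : T -> R) l :
  (\forall x \near F, `|f x - l| <= g x) -> g @ F --> 0 -> f @ F --> l.
Proof.
move=> h g0; apply/cvgrPdist_lt => e e0.
have /cvgrPdist_lt/(_ e e0) := g0; apply: filterS2 h => x h1.
rewrite sub0r normrN distrC => h2.
by apply: le_lt_trans h1 (le_lt_trans (ler_norm _) h2).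
Qed.

Lemma cvg_Re (T : Type) (F : set_system T) {FF : Filter F} (f : T -> C) (l : C) :
  f @ F --> l -> complex.Re (f x) @[x --> F] --> complex.Re l.
Proof.
move=> /cvgC0P; apply: squeezeR; apply: nearW => x.
have -> : complex.Re (f x) - complex.Re l = complex.Re (f x - l).
  by case: (f x) l => ? ? [].
exact: Re_le_cabs.
Qed.

Lemma cvg_Im (T : Type) (F : set_system T) {FF : Filter F} (f : T -> C) (l : C) :
  f @ F --> l -> complex.Im (f x) @[x --> F] --> complex.Im l.
Proof.
move=> /cvgC0P; apply: squeezeR; apply: nearW => x.
have -> : complex.Im (f x) - complex.Im l = complex.Im (f x - l).
  by case: (f x) l => ? ? [].
exact: Im_le_cabs.
Qed.

Lemma cvg_cpt (T : Type) (F : set_system T) {FF : Filter F} (f g : T -> R) (l m : R) :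
  f @ F --> l -> g @ F --> m -> cpt (f x) (g x) @[x --> F] --> cpt l m.
Proof.
move=> fl gm; apply: (@squeezeC _ _ _ _ (fun x => `|f x - l| + `|g x - m|)).
  by apply: nearW => x; exact: cabs_le_ReIm.
rewrite -[X in _ --> X]addr0; apply: cvgD.
  by rewrite -(normr0 R); apply: cvg_norm; rewrite -(subrr l); apply: cvgB => //; exact: cvg_cst.
by rewrite -(normr0 R); apply: cvg_norm; rewrite -(subrr m); apply: cvgB => //; exact: cvg_cst.
Qed.

Lemma cvg_cabs (T : Type) (F : set_system T) {FF : Filter F} (f : T -> C) (l : C) :
  f @ F --> l -> cabs (f x) @[x --> F] --> cabs l.
Proof.
move=> /cvgC0P; apply: squeezeR; apply: nearW => x.
rewrite ler_norml; apply/andP; split.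
  rewrite -lerN2 opprK opprB lerBlDr.
  have {1}-> : l = (l - f x) + f x by rewrite subrK.
  by rewrite (cabsC (f x)); exact: cabsD.
rewrite lerBlDr; have {1}-> : f x = (f x - l) + l by rewrite subrK.
exact: cabsD.
Qed.

Lemma cvgCM (T : Type) (F : set_system T) {FF : Filter F} (f g : T -> C) (l m : C) :
  f @ F --> l -> g @ F --> m -> (f x * g x) @[x --> F] --> l * m.
Proof.
move=> fl gm.
have fr : complex.Re (f x) @[x --> F] --> complex.Re l by exact: cvg_Re.
have fi : complex.Im (f x) @[x --> F] --> complex.Im l by exact: cvg_Im.
have gr : complex.Re (g x) @[x --> F] --> complex.Re m by exact: cvg_Re.
have gi : complex.Im (g x) @[x --> F] --> complex.Im m by exact: cvg_Im.
have -> : (fun x => f x * g x) = (fun x =>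
    cpt (complex.Re (f x) * complex.Re (g x) - complex.Im (f x) * complex.Im (g x))
        (complex.Re (f x) * complex.Im (g x) + complex.Im (f x) * complex.Re (g x))).
  by apply/funext => x; case: (f x) (g x) => ? ? [].
have -> : l * m = cpt (complex.Re l * complex.Re m - complex.Im l * complex.Im m)
    (complex.Re l * complex.Im m + complex.Im l * complex.Re m).
  by case: (l) (m) => ? ? [].
apply: cvg_cpt; first by apply: cvgB; exact: cvgM.
by apply: cvgD; exact: cvgM.
Qed.

Lemma cvgCD (T : Type) (F : set_system T) {FF : Filter F} (f g : T -> C) (l m : C) :
  f @ F --> l -> g @ F --> m -> (f x + g x) @[x --> F] --> l + m.
Proof.
move=> /cvgC0P fl /cvgC0P gm.
apply: (@squeezeC _ _ _ _ (fun x => cabs (f x - l) + cabs (g x - m))).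
  by apply: nearW => x; rewrite opprD addrACA; exact: cabsD.
by rewrite -[X in _ --> X]addr0; exact: cvgD.
Qed.

Lemma limC_unique (T : Type) (F : set_system T) {FF : ProperFilter F} (f : T -> C) (l m : C) :
  f @ F --> l -> f @ F --> m -> l = m.
Proof. by move=> fl fm; exact: (cvg_unique (@norm_hausdorff _ C) fl fm). Qed.

Lemma limC (T : Type) (F : set_system T) {FF : ProperFilter F} (f : T -> C) l :
  f @ F --> l -> lim (f @ F) = l.
Proof. by move=> fl; apply: (cvg_lim (@norm_hausdorff _ C) fl). Qed.

Lemma cvgR_bounded (u : nat -> R) (l : R) : u @ \oo --> l -> exists M, forall n, `|u n| <= M.
Proof.
move=> ul; have /cvg_seq_bounded [M [_ h]] : cvgn u by apply/cvg_ex; exists l.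
by exists (M + 1) => n; apply: h => //; rewrite ltrDl.
Qed.

Lemma cvgC_bounded (u : nat -> C) (l : C) : u @ \oo --> l -> exists M, forall n, cabs (u n) <= M.
Proof.
move=> /cvg_cabs /cvgR_bounded [M h]; exists M => n.
exact: le_trans (ler_norm _) (h n).
Qed.

Lemma cvg_le_cabs (T : Type) (F : set_system T) {FF : ProperFilter F} (f : T -> C) (l : C) M :
  f @ F --> l -> (\forall x \near F, cabs (f x) <= M) -> cabs l <= M.
Proof.
move=> /cvgC_lt h b; rewrite leNgt; apply/negP => lM.
have := h (cabs l - M); rewrite subr_gt0 => /(_ lM) h1.
have [x [xM]] := filter_ex (filterI b h1).
rewrite ltNge => /negP; apply; rewrite lerBlDr.
apply: (@le_trans _ _ (cabs (f x - l) + cabs (f x))); last by rewrite lerD2l.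
rewrite cabsC; have {1}-> : l = (l - f x) + f x by rewrite subrK.
exact: cabsD.
Qed.

End ComplexBasics.

(** * Power series on the unit disk, through the growth of their coefficients *)

Section PowerSeries.
Variable R : realType.
Local Notation C := (R[i])^o.
Implicit Types (z w : C) (c d : nat -> C).

Lemma geometric_tail (t : R) m n : 0 <= t -> t < 1 ->
  \sum_(m <= k < n) t ^+ k <= t ^+ m / (1 - t).
Proof.
move=> t0 t1; rewrite ler_pdivlMr ?subr_gt0//.
have [mn|nm] := leqP m n; last first.
  by rewrite big_geq 1?ltnW// mul0r exprn_ge0.
have -> : (\sum_(m <= k < n) t ^+ k) * (1 - t) = t ^+ m - t ^+ n.
  rewrite -[RHS]opprB -(telescope_sumr (fun k => t ^+ k))// mulr_suml -sumrN.
  apply: eq_bigr => k _.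
  by rewrite exprSr; ring.
by rewrite lerBlDr lerDl exprn_ge0.
Qed.

(** Completeness is taken from the reals: the real and imaginary parts converge absolutely. The
    bound on finite blocks survives in the limit as a bound on the remainder, which later yields
    uniform convergence. *)
Lemma seriesC_abs (u : nat -> C) (e : nat -> R) :
  (forall n m, (n <= m)%N -> \sum_(n <= k < m) cabs (u k) <= e n) ->
  exists l, series u @ \oo --> l /\ forall n, cabs (l - series u n) <= e n.
Proof.
move=> h.
have cv (f : nat -> R) : (forall k, `|f k| <= cabs (u k)) -> cvgn (series f).
  move=> hf; apply: normed_cvg; apply: nondecreasing_is_cvgn.
    apply/nondecreasing_seqP => n.
    change (\sum_(0 <= k < n) `|f k| <= \sum_(0 <= k < n.+1) `|f k|).
    by rewrite big_nat_recr//= lerDl.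
  exists (e 0) => _ [n _ <-].
  change (\sum_(0 <= k < n) `|f k| <= e 0).
  by apply: le_trans (h 0%N n (leq0n _)); exact: ler_sum.
have cr := cv (fun k => complex.Re (u k)) (fun k => Re_le_cabs _).
have ci := cv (fun k => complex.Im (u k)) (fun k => Im_le_cabs _).
move/cvg_ex: cr => [l1 h1]; move/cvg_ex: ci => [l2 h2].
exists (cpt l1 l2).
have ul : series u @ \oo --> cpt l1 l2.
  have -> : series u = fun n => cpt (series (fun k => complex.Re (u k)) n)
      (series (fun k => complex.Im (u k)) n).
    apply/funext => n; rewrite !seriesEnat /=; elim: n => [|n IH].
      by rewrite !big_geq.
    by rewrite !big_nat_recr//= IH; case: (u n).
  exact: cvg_cpt.
split => // n.
apply: (@cvg_le_cabs _ _ \oo _ (fun m => series u m - series u n)).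
  by apply: cvgCD; [exact: ul|exact: cvg_cst].
near=> m.
have nm : (n <= m)%N by near: m; exact: nbhs_infty_ge.
rewrite !seriesEnat /= (big_cat_nat (leq0n n) nm)/= addrAC subrr add0r.
by apply: le_trans (cabs_sum _ _ _) _; exact: h.
Unshelve. all: by end_near. Qed.

(** Cauchy estimates in place of convergence: by [hol_growth] this is equivalent to [hol_disk], and
    it is visibly stable under the coefficient inequalities used below. *)
Definition growth c := forall rho : R, 0 < rho -> rho < 1 ->
  exists B, forall k, cabs (c k) * rho ^+ k <= B.

Lemma between (r : R) : r < 1 -> exists2 s, r < s & 0 < s < 1.
Proof.
move=> r1; have [r0|r0] := ltP 0 r.
  by exists ((r + 1) / 2); lra.
by exists (1 / 2); lra.
Qed.

Lemma growth_geom c r : growth c -> 0 <= r -> r < 1 ->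
  exists B t, [/\ 0 <= t, t < 1 & forall k, cabs (c k) * r ^+ k <= B * t ^+ k].
Proof.
move=> gc r0 r1; have [s rs /andP[s0 s1]] := between r1.
have [B hB] := gc s s0 s1; exists B, (r / s); split.
- by rewrite divr_ge0// ltW.
- by rewrite ltr_pdivrMr// mul1r.
- move=> k.
  have -> : r ^+ k = s ^+ k * (r / s) ^+ k.
    by rewrite -exprMn mulrCA divff ?mulr1// gt_eqF.
  by rewrite mulrA ler_wpM2r// exprn_ge0// divr_ge0// ltW.
Qed.

(** A single geometric rate serves all |z| <= r; this uniformity is what permits integration term by
    term. *)
Lemma psum_series c r : growth c -> 0 <= r -> r < 1 ->
  exists B t, [/\ 0 <= B, 0 <= t, t < 1 & forall z, cabs z <= r ->
   series (fun k => c k * z ^+ k) @ \oo --> psum c z /\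
   forall n, cabs (psum c z - series (fun k => c k * z ^+ k) n) <= B * t ^+ n].
Proof.
move=> gc r0 r1; have [B [t [t0 t1 h]]] := growth_geom gc r0 r1.
have B0 : 0 <= B.
  by apply: le_trans (_ : cabs (c 0%N) <= _); rewrite ?cabs_ge0//; have := h 0%N; rewrite !expr0 !mulr1.
exists (B / (1 - t)), t; split => //; first by rewrite divr_ge0// subr_ge0 ltW.
move=> z zr.
have [l [sl hl]] : exists l, series (fun k => c k * z ^+ k) @ \oo --> l /\
   forall n, cabs (l - series (fun k => c k * z ^+ k) n) <= B / (1 - t) * t ^+ n.
  apply: seriesC_abs => n m nm; rewrite mulrAC -mulrA.
  apply: le_trans (_ : B * \sum_(n <= k < m) t ^+ k <= _); last first.
    by rewrite ler_wpM2l// geometric_tail.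
  rewrite mulr_sumr; apply: ler_sum => k _; rewrite cabsM cabsX.
  by apply: le_trans (h k); rewrite ler_wpM2l ?cabs_ge0// lerXn2r// nnegrE cabs_ge0.
by have -> : psum c z = l by exact: limC.
Qed.

Lemma psum_cvg c z : growth c -> cabs z < 1 ->
  series (fun k => c k * z ^+ k) @ \oo --> psum c z.
Proof.
move=> gc z1; have [B [t [_ _ _ h]]] := psum_series gc (cabs_ge0 z) z1.
by have [] := h z (lexx _).
Qed.

Lemma hol_growth c : hol_disk c <-> growth c.
Proof.
split => [hc rho r0 r1|gc z z1]; last first.
  by apply/cvg_ex; exists (psum c z); exact: psum_cvg.
have c1 : cabs ((rho%:C)%C : C) < 1 by rewrite cabs_real gtr0_norm.
have /cvg_ex[l /cvgC_bounded [M hM]] := hc _ c1.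
(* One term of the series is a difference of two partial sums, each bounded by [M]. *)
exists (M + M) => k.
have -> : cabs (c k) * rho ^+ k = cabs (c k * ((rho%:C)%C : C) ^+ k).
  by rewrite cabsM cabsX cabs_real gtr0_norm.
have -> : c k * ((rho%:C)%C : C) ^+ k =
   series (fun k => c k * ((rho%:C)%C : C) ^+ k) k.+1 -
   series (fun k => c k * ((rho%:C)%C : C) ^+ k) k.
  by rewrite !seriesEnat/= big_nat_recr//= [RHS]addrAC subrr add0r.
by apply: le_trans (cabsB _ _) _; apply: lerD.
Qed.

Lemma psum_eq c z l : series (fun k => c k * z ^+ k) @ \oo --> l -> psum c z = l.
Proof. exact: limC. Qed.

Lemma psum0 c : psum c 0 = c 0%N.
Proof.
apply: psum_eq; apply/cvgC_lt => e e0; near=> n.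
have n0 : (0 < n)%N by near: n; exact: nbhs_infty_gt.
rewrite seriesEnat/= big_ltn// expr0 mulr1 big_nat big1 ?addr0 ?subrr ?cabs0//.
by move=> i /andP[i0 _]; rewrite expr0n; case: i i0 => // i _; rewrite mulr0.
Unshelve. all: by end_near. Qed.

Lemma growth_lin c d (al be : C) : growth c -> growth d ->
  growth (fun k => al * c k + be * d k).
Proof.
move=> gc gd rho r0 r1.
have [B hB] := gc _ r0 r1; have [B' hB'] := gd _ r0 r1.
exists (cabs al * B + cabs be * B') => k.
apply: le_trans (_ : (cabs al * cabs (c k) + cabs be * cabs (d k)) * rho ^+ k <= _).
  by rewrite ler_wpM2r ?exprn_ge0 ?(ltW r0)// -!cabsM cabsD.
by rewrite mulrDl -!mulrA; apply: lerD; rewrite ler_wpM2l// cabs_ge0.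
Qed.

Lemma psum_lin c d (al be : C) z : growth c -> growth d -> cabs z < 1 ->
  psum (fun k => al * c k + be * d k) z = al * psum c z + be * psum d z.
Proof.
move=> gc gd z1; apply: psum_eq.
have -> : series (fun k => (al * c k + be * d k) * z ^+ k) =
  fun n => al * series (fun k => c k * z ^+ k) n + be * series (fun k => d k * z ^+ k) n.
  apply/funext => n; rewrite !seriesEnat/= !mulr_sumr -big_split/=.
  by apply: eq_bigr => k _; rewrite mulrDl !mulrA.
by apply: cvgCD; apply: cvgCM; (try exact: cvg_cst); exact: psum_cvg.
Qed.

Lemma growth_shift c : growth c -> growth (fun k => c k.+1).
Proof.
move=> gc rho r0 r1; have [B hB] := gc _ r0 r1; exists (B / rho) => k.
by rewrite ler_pdivlMr// -mulrA -exprSr.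
Qed.

Lemma psum_shift c z : growth c -> cabs z < 1 ->
  psum c z = c 0%N + z * psum (fun k => c k.+1) z.
Proof.
move=> gc z1.
have h1 := psum_cvg (growth_shift gc) z1.
have h2 : series (fun k => c k * z ^+ k) n.+1 @[n --> \oo] --> psum c z.
  by rewrite (cvg_shiftS (series (fun k => c k * z ^+ k))); exact: psum_cvg.
apply: (limC_unique h2).
have -> : (fun n => series (fun k => c k * z ^+ k) n.+1) =
  fun n => c 0%N + z * series (fun k => c k.+1 * z ^+ k) n.
  apply/funext => n; rewrite !seriesEnat/= big_nat_recl//= expr0 mulr1 mulr_sumr.
  by congr (_ + _); apply: eq_bigr => k _; rewrite exprS mulrCA.
apply: cvgCD; first exact: cvg_cst.
by apply: cvgCM; [exact: cvg_cst|exact: h1].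
Qed.

(** Since t^k is the smallest of 1, t, ..., t^k, the product (k + 1) t^k is at most their sum, hence
    at most 1 / (1 - t). *)
Lemma nat_geom_bounded (t : R) : 0 < t -> t < 1 ->
  exists K, forall k, k.+1%:R * t ^+ k <= K.
Proof.
move=> t0 t1; exists (1 / (1 - t)) => k.
rewrite ler_pdivlMr ?subr_gt0//.
have -> : k.+1%:R = \sum_(0 <= j < k.+1) (1 : R) by rewrite sumr_const_nat subn0.
apply: le_trans (_ : (\sum_(0 <= j < k.+1) t ^+ j) * (1 - t) <= _).
  rewrite ler_wpM2r ?subr_ge0 ?(ltW t1)// mulr_suml big_nat [leRHS]big_nat.
  apply: ler_sum => j /andP[_ jk]; rewrite mul1r.
  by rewrite ler_wiXn2l// ltW.
by rewrite -ler_pdivlMr ?subr_gt0//; have := geometric_tail 0 k.+1 (ltW t0) t1; rewrite expr0.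
Qed.

(** Enlarging the radius from rho to s < 1 leaves a factor (rho / s)^k, which absorbs k + 1. *)
Lemma growth_poly c d K : growth c ->
  (forall k, cabs (d k) <= K * k.+1%:R * cabs (c k)) -> growth d.
Proof.
move=> gc h rho r0 r1; have [s rs /andP[s0 s1]] := between r1.
have [B hB] := gc _ s0 s1.
have [||M hM] := @nat_geom_bounded (rho / s); first by rewrite divr_gt0.
  by rewrite ltr_pdivrMr// mul1r.
exists (`|K| * M * B) => k.
have -> : rho ^+ k = (rho / s) ^+ k * s ^+ k.
  by rewrite -exprMn mulfVK// gt_eqF.
apply: le_trans (_ : (`|K| * k.+1%:R * cabs (c k)) * ((rho / s) ^+ k * s ^+ k) <= _).
  rewrite ler_wpM2r// ?mulr_ge0 ?exprn_ge0 ?divr_ge0 ?(ltW r0) ?(ltW s0)//.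
  by apply: le_trans (h k) _; rewrite !ler_wpM2r ?cabs_ge0// ler_norm.
have -> : `|K| * k.+1%:R * cabs (c k) * ((rho / s) ^+ k * s ^+ k) =
  (`|K| * (k.+1%:R * (rho / s) ^+ k)) * (cabs (c k) * s ^+ k) by ring.
apply: ler_pM => //; rewrite ?mulr_ge0 ?exprn_ge0 ?divr_ge0 ?cabs_ge0 ?(ltW r0) ?(ltW s0)//.
by rewrite ler_wpM2l.
Qed.

Lemma growth_bounded c B : (forall k, cabs (c k) <= B) -> growth c.
Proof.
move=> h rho r0 r1; exists B => k; apply: le_trans (h k).
by rewrite ler_piMr ?cabs_ge0// exprn_ile1// ltW.
Qed.

Lemma growth_le c d K : growth c -> (forall k, cabs (d k) <= K * cabs (c k)) -> growth d.
Proof.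
move=> gc h; apply: (growth_poly (K := `|K|) gc) => k; apply: le_trans (h k) _.
rewrite ler_wpM2r ?cabs_ge0//; apply: le_trans (ler_norm K) _.
by rewrite ler_peMr// ler1n.
Qed.

Lemma psum_bounded c B z : (forall k, cabs (c k) <= B) -> cabs z < 1 ->
  cabs (psum c z) <= B / (1 - cabs z).
Proof.
move=> h z1.
apply: (cvg_le_cabs (psum_cvg (growth_bounded h) z1)); apply: nearW => n.
rewrite seriesEnat/=; apply: le_trans (cabs_sum _ _ _) _.
have B0 : 0 <= B by apply: le_trans (h 0%N); exact: cabs_ge0.
apply: le_trans (_ : B * \sum_(0 <= k < n) cabs z ^+ k <= _).
  rewrite mulr_sumr; apply: ler_sum => k _; rewrite cabsM cabsX.
  by rewrite ler_wpM2r// exprn_ge0// cabs_ge0.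
rewrite ler_wpM2l//; have := geometric_tail 0 n (cabs_ge0 z) z1.
by rewrite expr0 mul1r.
Qed.

Lemma psum_deriv c z : growth c -> cabs z < 1 ->
  psum (fun k => k%:R * c k) z = z * psum (deriv_coef c) z.
Proof.
move=> gc z1; rewrite psum_shift ?mul0r ?add0r//.
apply: (growth_poly (K := 1) gc) => k; rewrite cabsM cabs_nat mul1r.
by rewrite ler_wpM2r ?cabs_ge0// ler_nat.
Qed.

Lemma growth_deriv c : growth c -> growth (deriv_coef c).
Proof.
move=> gc; apply: (growth_shift (c := fun k => k%:R * c k)).
apply: (growth_poly (K := 1) gc) => k; rewrite cabsM cabs_nat mul1r.
by rewrite ler_wpM2r ?cabs_ge0// ler_nat.
Qed.

End PowerSeries.
(** * Area measure and integration *)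

Section Area.
Variable R : realType.
HB.instance Definition _ := Measure.on (@area R).

Local Notation mu := (@lebesgue_measure R).
Local Notation TR := (measurableTypeR R).
Local Notation T := (TR * TR)%type.

(** The image of Lebesgue measure under a translation agrees with it on half-open intervals, and
    these determine it. *)
Lemma lebesgue_translate (t : R) (A : set TR) : measurable A ->
  mu ((fun x => x + t) @^-1` A) = mu A.
Proof.
move=> mA; have mf : measurable_fun [set: TR] (fun x : TR => x + t : TR) by exact: measurable_funD.
pose f : {mfun TR >-> TR} := HB.pack (fun x : TR => x + t) (isMeasurableFun.Build _ _ _ _ _ mf).
have -> : mu ((fun x => x + t) @^-1` A) = pushforward mu f A by [].
apply/esym; apply: (@lebesgue_measure_unique R (pushforward mu f)) => // X /ocitvP[->|[[a b] /= ab ->]].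
  by rewrite !measure0.
rewrite /pushforward /=.
have -> : (fun x => x + t) @^-1` `]a, b]%classic = `]a - t, b - t]%classic.
  by apply/seteqP; split => x /=; rewrite !in_itv /= ltrBlDr lerBrDr.
rewrite !lebesgue_measure_itv /= !lte_fin ltrD2r ab -!EFinB; congr (_%:E); ring.
Qed.

Lemma lebesgue_scale (r : R) (A : set TR) : 0 < r -> measurable A ->
  mu A = (r%:E * mu ((fun x => r * x)%R @^-1` A))%E.
Proof.
move=> r0 mA; have mf : measurable_fun [set: TR] (fun x : TR => r * x : TR) by exact: measurable_funM.
pose f : {mfun TR >-> TR} := HB.pack (fun x : TR => r * x) (isMeasurableFun.Build _ _ _ _ _ mf).
pose rr : {nonneg R} := NngNum (ltW r0).
have -> : (r%:E * mu ((fun x => r * x)%R @^-1` A))%E = mscale rr (pushforward mu f) A by [].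
apply: (@lebesgue_measure_unique R (mscale rr (pushforward mu f))) => // X /ocitvP[->|[[a b] /= ab ->]].
  by rewrite !measure0.
rewrite /mscale/= /pushforward /=.
have -> : (fun x => r * x) @^-1` `]a, b]%classic = `]a / r, b / r]%classic.
  by apply/seteqP; split => x /=; rewrite !in_itv /= ltr_pdivrMr// ler_pdivlMr// (mulrC x).
rewrite !lebesgue_measure_itv /= !lte_fin ltr_pM2r ?invr_gt0// ab -!EFinB -EFinM.
by congr (_%:E); field; rewrite gt_eqF.
Qed.

(** A change of variables with constant Jacobian, phrased on preimages: for the linear maps used
    here, c is 1 / |det phi|. *)
Definition mpres (phi : T -> T) (c : R) :=
  measurable_fun setT phi /\
  forall E : set T, measurable E -> area (phi @^-1` E) = (c%:E * area E)%E.

Lemma mpres_comp phi psi c d : mpres phi c -> mpres psi d ->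
  mpres (phi \o psi) (d * c).
Proof.
move=> [m1 h1] [m2 h2]; split; first exact: measurableT_comp.
move=> E mE; rewrite comp_preimage h2; last first.
  by rewrite -[X in measurable X]setTI; exact: m1.
by rewrite h1// muleA EFinM.
Qed.

(** On each vertical line the shear is a translation, so slicing reduces the claim to
    [lebesgue_translate]. *)
Lemma mpres_sheary t : mpres (fun p : T => (p.1, p.2 + t * p.1) : T) 1.
Proof.
split.
  apply/measurable_fun_pair => //=.
  by apply: measurable_funD => //; apply: measurable_funM.
move=> E mE; rewrite mul1e /area /product_measure1 /=.
apply: eq_integral => x _.
rewrite -(lebesgue_translate (t * x) (A := xsection E x)); last exact: measurable_xsection.
by congr (mu _); apply/seteqP; split => y /=; rewrite /xsection /= !inE.
Qed.

(** Here the slices that get translated are horizontal, so the area is first identified with the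
    iterated measure taken in the other order. *)
Lemma mpres_shearx t : mpres (fun p : T => (p.1 + t * p.2, p.2) : T) 1.
Proof.
have m : measurable_fun [set: T] (fun p : T => (p.1 + t * p.2, p.2) : T).
  apply/measurable_fun_pair => //=.
  by apply: measurable_funD => //; apply: measurable_funM.
split => // E mE; rewrite mul1e.
have mE' : measurable ((fun p : T => (p.1 + t * p.2, p.2)) @^-1` E).
  by rewrite -[X in measurable X]setTI; exact: m.
have h (X : set T) : measurable X -> area X = (mu \x^ mu)%E X.
  move=> mX; rewrite /area; apply: product_measure_unique => // A B mA mB.
  exact: product_measure2E.
rewrite !h// /product_measure2 /=.
apply: eq_integral => y _.
rewrite -(lebesgue_translate (t * y) (A := ysection E y)); last exact: measurable_ysection.
by congr (mu _); apply/seteqP; split => x /=; rewrite /ysection /= !inE.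
Qed.

(* Rotation by the angle of cosine 3/5, which is a product of three shears.  It
   has infinite order, so invariance of the area under this single rotation
   already annihilates every off-diagonal moment. *)
Definition rot (p : T) : T :=
  (3 / 5 * p.1 - 4 / 5 * p.2, 4 / 5 * p.1 + 3 / 5 * p.2).

Lemma mpres_rot : mpres rot 1.
Proof.
(* A rotation by theta is the product of shears with parameters -tan(theta/2), sin(theta),
   -tan(theta/2). For cos = 3/5 and sin = 4/5 one has tan(theta/2) = 1/2. *)
have := mpres_comp (mpres_comp (mpres_shearx (- (1 / 2))) (mpres_sheary (4 / 5)))
  (mpres_shearx (- (1 / 2))).
rewrite !mulr1; congr mpres; apply/funext => -[x y] /=; rewrite /rot /=.
by congr pair; field; rewrite ?pnatr_eq0.
Qed.

Lemma mpres_scale r : 0 < r -> mpres (fun p : T => (r * p.1, r * p.2) : T) (r^-1 ^+ 2).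
Proof.
move=> r0.
have mm : measurable_fun [set: TR] (fun x : TR => r * x : TR) by exact: measurable_funM.
have m : measurable_fun [set: T] (fun p : T => (r * p.1, r * p.2) : T).
  by apply/measurable_fun_pair => /=; apply: measurable_funM.
split => // E mE.
pose f : {mfun T >-> T} := HB.pack (fun p : T => (r * p.1, r * p.2))
  (isMeasurableFun.Build _ _ _ _ _ m).
(* The measure r^2 times the image of the area under the scaling has the right value on rectangles,
   so it is the area. *)
pose rr : {nonneg R} := NngNum (ltW (exprn_gt0 2 r0)).
have : area E = mscale rr (pushforward (@area R) f) E.
  move=> m0; rewrite {1}/area; apply: product_measure_unique => // A B mA mB.
  rewrite /mscale /= /pushforward /=.
  transitivity ((r ^+ 2)%:E * area (((fun x : TR => r * x : TR)%R @^-1` A) `*`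
    ((fun x : TR => r * x : TR)%R @^-1` B)))%E; first by [].
  rewrite /area product_measure1E.
  - by rewrite (lebesgue_scale r0 mA) (lebesgue_scale r0 mB) muleACA -EFinM.
  - by rewrite -[X in measurable X]setTI; exact: mm.
  - by rewrite -[X in measurable X]setTI; exact: mm.
move=> /(_ m) ->; rewrite /mscale /= /pushforward /= muleA -EFinM -exprMn mulVf ?gt_eqF//.
by rewrite expr1n mul1e.
Qed.

Lemma mpres_integral phi c (D : set T) (F : T -> R) : 0 <= c -> mpres phi c ->
  measurable D -> measurable_fun D F -> (forall p, D p -> 0 <= F p) ->
  (\int[@area R]_(p in phi @^-1` D) (F (phi p))%:E = c%:E * \int[@area R]_(p in D) (F p)%:E)%E.
Proof.
move=> c0 [mphi h] mD mF F0.
have mF' : measurable_fun D (EFin \o F) by exact/measurable_EFinP.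
have F0' : {in D, forall y, (0 <= (EFin \o F) y)%E}.
  by move=> y; rewrite inE => Dy; rewrite lee_fin F0.
have := ge0_integral_pushforward mphi (@area R) mD mF' F0'.
rewrite /= => <-.
pose rr : {nonneg R} := NngNum c0.
rewrite -(ge0_integral_mscale (@area R) mD rr)//.
apply: (eq_measure_integral (mscale rr (@area R))) => // A mA _.
by rewrite /mscale /= /pushforward /= h.
Qed.

Lemma measurable_norm2 : measurable_fun [set: T] (fun p : T => p.1 ^+ 2 + p.2 ^+ 2).
Proof. by apply: measurable_funD; apply: measurable_funX. Qed.

Lemma measurable_disk (r : R) : measurable (disk r : set T).
Proof.
have -> : disk r = setT `&` ((fun p : T => p.1 ^+ 2 + p.2 ^+ 2) @^-1` `]-oo, r ^+ 2[%classic).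
  by apply/seteqP; split => p /=; rewrite /disk /= ?in_itv /=; [|move=> []].
exact: measurable_norm2.
Qed.

Lemma area_square (r : R) : 0 < r ->
  area (`[- r, r]%classic `*` `[- r, r]%classic) = ((2 * r) ^+ 2)%:E.
Proof.
move=> r0; rewrite /area product_measure1E//.
rewrite [X in (X * X)%E = _]lebesgue_measure_itv /= !lte_fin gtrN// -EFinB -EFinM; congr (_%:E); ring.
Qed.

Lemma area_disk_lty (r : R) : (area (disk r) < +oo)%E.
Proof.
apply: (@le_lt_trans _ _ (area (`[- (`|r| + 1), `|r| + 1]%classic `*` `[- (`|r| + 1), `|r| + 1]%classic))).
  apply: le_measure; rewrite ?inE; [exact: measurable_disk|exact: measurableX|].
  move=> [x y]; rewrite /disk /= => h.
  have hh u v : u ^+ 2 + v ^+ 2 < r ^+ 2 -> - (`|r| + 1) <= u <= `|r| + 1.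
    move=> {}h; rewrite -ler_norml; apply: le_trans (_ : `|r| <= _); last by rewrite lerDl.
    rewrite -(@ler_pXn2r _ 2)// ?nnegrE// !real_normK ?num_real//.
    by apply: le_trans (ltW h); rewrite lerDl sqr_ge0.
  split; rewrite /= in_itv /=; first exact: (hh x y).
  by apply: (hh y x); rewrite addrC.
by rewrite area_square ?ltry// ltr_wpDl.
Qed.

(* The area of the unit disk: only its positivity matters. *)
Definition A0 : R := fine (area (disk (1 : R))).

Lemma A0E : area (disk (1 : R)) = A0%:E.
Proof. by rewrite /A0 fineK// ge0_fin_numE ?measure_ge0// area_disk_lty. Qed.

Lemma A0_gt0 : 0 < A0.
Proof.
(* A square of side 1 fits in the disk: its corners satisfy x^2 + y^2 = 1/2 < 1. *)
rewrite -lte_fin -A0E; apply: (@lt_le_trans _ _ (area (`[- (1 / 2), 1 / 2]%classic `*` `[- (1 / 2), 1 / 2]%classic))).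
  by rewrite area_square ?lte_fin; lra.
apply: le_measure; rewrite ?inE; [exact: measurableX|exact: measurable_disk|].
move=> [x y] [] /=; rewrite /disk /= !in_itv /= => hx hy; nra.
Qed.

Lemma preimage_rot r : rot @^-1` (disk r) = disk r.
Proof.
apply/seteqP; split => -[x y]; rewrite /disk /rot /= => h.
  have -> : x ^+ 2 + y ^+ 2 = (3 / 5 * x - 4 / 5 * y) ^+ 2 + (4 / 5 * x + 3 / 5 * y) ^+ 2.
    by field.
  by [].
have -> : (3 / 5 * x - 4 / 5 * y) ^+ 2 + (4 / 5 * x + 3 / 5 * y) ^+ 2 = x ^+ 2 + y ^+ 2.
  by field.
by [].
Qed.

Lemma preimage_scale r s : 0 < r ->
  (fun p : T => (r * p.1, r * p.2) : T) @^-1` (disk s) = disk (s / r).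
Proof.
move=> r0; apply/seteqP; split => -[x y]; rewrite /disk /= => h.
  by rewrite expr_div_n ltr_pdivlMr ?exprn_gt0//; move: h; rewrite !exprMn -mulrDr mulrC.
by move: h; rewrite expr_div_n ltr_pdivlMr ?exprn_gt0// !exprMn -mulrDr mulrC.
Qed.

End Area.

(** * Integration of complex-valued functions over planar sets *)

Section ComplexIntegral.
Variable R : realType.
Local Notation C := (R[i])^o.
Local Notation TR := (measurableTypeR R).
Local Notation T := (TR * TR)%type.
Implicit Types (D : set T) (F G : T -> C).

Definition Cmeas D F := measurable_fun D (fun p => complex.Re (F p)) /\
  measurable_fun D (fun p => complex.Im (F p)).

Lemma Cmeas_cst D (c : C) : Cmeas D (fun=> c).
Proof. by split; exact: measurable_cst. Qed.

Lemma CmeasD D F G : Cmeas D F -> Cmeas D G -> Cmeas D (fun p => F p + G p).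
Proof.
move=> [a b] [c d]; split.
  by under eq_fun do rewrite ReD; exact: measurable_funD.
by under eq_fun do rewrite ImD; exact: measurable_funD.
Qed.

Lemma CmeasM D F G : Cmeas D F -> Cmeas D G -> Cmeas D (fun p => F p * G p).
Proof.
move=> [a b] [c d]; split.
  by under eq_fun do rewrite ReM; apply: measurable_funB; exact: measurable_funM.
by under eq_fun do rewrite ImM; apply: measurable_funD; exact: measurable_funM.
Qed.

Lemma CmeasX D F n : Cmeas D F -> Cmeas D (fun p => F p ^+ n).
Proof.
move=> h; elim: n => [|n IH]; first exact: (Cmeas_cst D 1).
have -> : (fun p => F p ^+ n.+1) = (fun p => F p * F p ^+ n).
  by apply/funext => p; rewrite exprS.
exact: CmeasM.
Qed.

Lemma Cmeas_sum D (I : Type) (s : seq I) (F : I -> T -> C) :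
  (forall i, Cmeas D (F i)) -> Cmeas D (fun p => \sum_(i <- s) F i p).
Proof.
move=> h; elim: s => [|i s IH].
  have -> : (fun p => \sum_(i <- [::]) F i p) = fun=> 0.
    by apply/funext => p; rewrite big_nil.
  exact: Cmeas_cst.
have -> : (fun p => \sum_(i <- i :: s) F i p) = fun p => F i p + \sum_(i <- s) F i p.
  by apply/funext => p; rewrite big_cons.
exact: CmeasD.
Qed.

Lemma CmeasC D F : Cmeas D F -> Cmeas D (fun p => conjc (F p) : C).
Proof.
move=> [a b]; split.
  by have -> : (fun p => complex.Re (conjc (F p))) = (fun p => complex.Re (F p))
    by apply/funext => p; case: (F p).
have -> : (fun p => complex.Im (conjc (F p))) = (fun p => - complex.Im (F p)).
  by apply/funext => p; case: (F p).
exact: measurable_funN.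
Qed.

Lemma Cmeas_real D (f : T -> R) : measurable_fun D f -> Cmeas D (fun p => ((f p)%:C)%C : C).
Proof. by move=> mf; split => //=; exact: measurable_cst. Qed.

Lemma Cmeas_cvg D (H : nat -> T -> C) F : (forall n, Cmeas D (H n)) ->
  (forall p, D p -> H n p @[n --> \oo] --> F p) -> Cmeas D F.
Proof.
move=> mH HF; split.
  apply: (measurable_fun_cvg (h := fun n p => complex.Re (H n p))) => [n|p Dp].
    by have [] := mH n.
  by apply: cvg_Re; exact: HF.
apply: (measurable_fun_cvg (h := fun n p => complex.Im (H n p))) => [n|p Dp].
  by have [] := mH n.
by apply: cvg_Im; exact: HF.
Qed.

Lemma Cmeas_S D E F : measurable E -> D `<=` E -> Cmeas E F -> Cmeas D F.
Proof. by move=> mE DE [a b]; split; [exact: measurable_funS a|exact: measurable_funS b]. Qed.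

Lemma Cmeas_cabs D F : Cmeas D F -> measurable_fun D (fun p => cabs (F p)).
Proof.
move=> [a b].
have -> : (fun p => cabs (F p)) = Num.sqrt \o
   (fun p => complex.Re (F p) ^+ 2 + complex.Im (F p) ^+ 2).
  by apply/funext => p /=; case: (F p).
apply: measurableT_comp; first by apply: continuous_measurable_fun; exact: sqrt_continuous.
by apply: measurable_funD; exact: measurable_funX.
Qed.

Definition zz (p : T) : C := cpt p.1 p.2.

Lemma Cmeas_zz D : Cmeas D zz.
Proof. by split; [exact: (measurable_funTS measurable_fst)|exact: (measurable_funTS measurable_snd)]. Qed.

Lemma zz_disk (r : R) p : 0 <= r -> disk r p <-> cabs (zz p) < r.
Proof.
move=> r0; have -> : disk r p = is_true (cabs (zz p) ^+ 2 < r ^+ 2) by rewrite /zz cabs_cpt.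
by rewrite ltr_pXn2r ?nnegrE ?cabs_ge0.
Qed.

Lemma Cmeas_psum D (c : nat -> C) F : growth c -> Cmeas D F ->
  (forall p, D p -> cabs (F p) < 1) -> Cmeas D (fun p => psum c (F p)).
Proof.
move=> gc mF F1.
apply: (Cmeas_cvg (H := fun n p => series (fun k => c k * F p ^+ k) n)) => [n|p Dp].
  have -> : (fun p => series (fun k => c k * F p ^+ k) n) =
    fun p => \sum_(k <- index_iota 0 n) c k * F p ^+ k.
    by apply/funext => p; rewrite seriesEnat.
  apply: Cmeas_sum => k; apply: CmeasM; first exact: Cmeas_cst.
  exact: CmeasX.
by apply: psum_cvg => //; exact: F1.
Qed.

Definition Iabs D F : \bar R := (\int[@area R]_(p in D) (cabs (F p))%:E)%E.

Definition cintble D F :=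
  (@area R).-integrable D (fun p => (complex.Re (F p))%:E) /\
  (@area R).-integrable D (fun p => (complex.Im (F p))%:E).

Lemma Iabs_ge0 D F : (0 <= Iabs D F)%E.
Proof. by apply: integral_ge0 => p _; rewrite lee_fin cabs_ge0. Qed.

Lemma cintbleP D F : measurable D -> Cmeas D F -> (Iabs D F < +oo)%E -> cintble D F.
Proof.
move=> mD mF hF.
have ig : (@area R).-integrable D (fun p => (cabs (F p))%:E).
  apply/integrableP; split; first by apply/measurable_EFinP; exact: Cmeas_cabs.
  rewrite (eq_integral (fun p => (cabs (F p))%:E))// => p _.
  by rewrite gee0_abs// lee_fin cabs_ge0.
case: mF => a b; split.
  apply: (le_integrable mD _ _ ig); first exact/measurable_EFinP.
  by move=> p _ /=; rewrite lee_fin (ger0_norm (cabs_ge0 _)); exact: Re_le_cabs.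
apply: (le_integrable mD _ _ ig); first exact/measurable_EFinP.
by move=> p _ /=; rewrite lee_fin (ger0_norm (cabs_ge0 _)); exact: Im_le_cabs.
Qed.

(** Real and imaginary parts are bounded separately, which costs a factor 2 against the sharp
    inequality; this 2 recurs in many constants below. *)
Lemma cint_le D F (K : R) : measurable D -> Cmeas D F -> (Iabs D F <= K%:E)%E ->
  cabs (cint D F) <= 2 * K.
Proof.
move=> mD mF hF.
have K0 : 0 <= K by rewrite -lee_fin; apply: le_trans hF; exact: Iabs_ge0.
have [i1 i2] := cintbleP mD mF (le_lt_trans hF (ltry _)).
apply: le_trans (cabs_le_ReIm _) _ => /=.
rewrite mulr_natl mulr2n; apply: lerD.
  rewrite -lee_fin EFin_normr_Rintegral//; apply: le_trans (le_abse_integral _ mD _) _.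
    by apply/measurable_EFinP; case: mF.
  apply: le_trans hF; apply: ge0_le_integral => //.
  - by apply: measurableT_comp => //; apply/measurable_EFinP; case: mF.
  - by apply/measurable_EFinP; exact: Cmeas_cabs.
  - by move=> p _; rewrite lee_fin; exact: Re_le_cabs.
rewrite -lee_fin EFin_normr_Rintegral//; apply: le_trans (le_abse_integral _ mD _) _.
  by apply/measurable_EFinP; case: mF.
apply: le_trans hF; apply: ge0_le_integral => //.
- by apply: measurableT_comp => //; apply/measurable_EFinP; case: mF.
- by apply/measurable_EFinP; exact: Cmeas_cabs.
- by move=> p _; rewrite lee_fin; exact: Im_le_cabs.
Qed.

Lemma Iabs_le D F (f : T -> R) : measurable D -> Cmeas D F -> measurable_fun D f ->
  (forall p, D p -> cabs (F p) <= f p) ->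
  (Iabs D F <= \int[@area R]_(p in D) (f p)%:E)%E.
Proof.
move=> mD mF mf h; apply: ge0_le_integral => //.
- by move=> p _; rewrite lee_fin cabs_ge0.
- by apply/measurable_EFinP; exact: Cmeas_cabs.
- exact/measurable_EFinP.
Qed.

Lemma Iabs_bounded D F (M : R) : measurable D -> (area D < +oo)%E -> Cmeas D F ->
  (forall p, D p -> cabs (F p) <= M) -> (Iabs D F <= (M * fine (area D))%:E)%E.
Proof.
move=> mD fD mF h.
apply: le_trans (Iabs_le (f := cst M) mD mF (measurable_cst _) h) _.
have fin : area D \is a fin_num by rewrite ge0_fin_numE ?measure_ge0.
by rewrite /cst integral_cst// EFinM fineK.
Qed.

Lemma cintble_bounded D F (M : R) : measurable D -> (area D < +oo)%E -> Cmeas D F ->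
  (forall p, D p -> cabs (F p) <= M) -> cintble D F.
Proof.
move=> mD fD mF h; apply: cintbleP => //.
by apply: le_lt_trans (Iabs_bounded mD fD mF h) _; exact: ltry.
Qed.

Lemma eq_cint D F G : (forall p, D p -> F p = G p) -> cint D F = cint D G.
Proof.
by move=> h; congr cpt; apply: eq_Rintegral => p; rewrite inE => /h ->.
Qed.

Lemma cintbleD D F G : measurable D -> cintble D F -> cintble D G ->
  cintble D (fun p => F p + G p).
Proof.
move=> mD [a b] [c d]; split.
  by under eq_fun do rewrite ReD EFinD; exact: integrableD.
by under eq_fun do rewrite ImD EFinD; exact: integrableD.
Qed.

Lemma cintD D F G : measurable D -> cintble D F -> cintble D G ->
  cint D (fun p => F p + G p) = cint D F + cint D G.
Proof.
move=> mD [a b] [c d]; rewrite /cint -[RHS]/(cpt _ _); congr cpt.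
  by under eq_Rintegral do rewrite ReD; exact: RintegralD.
by under eq_Rintegral do rewrite ImD; exact: RintegralD.
Qed.

Lemma integrableZlR D (f : T -> R) k : measurable D ->
  (@area R).-integrable D (fun p => (f p)%:E) ->
  (@area R).-integrable D (fun p => (k * f p)%:E).
Proof. by move=> mD h; under eq_fun do rewrite EFinM; exact: integrableZl. Qed.

Lemma cintbleZ D (c : C) F : measurable D -> cintble D F ->
  cintble D (fun p => c * F p).
Proof.
move=> mD [a b]; split.
  by under eq_fun do rewrite ReM EFinB; apply: integrableB => //; exact: integrableZlR.
by under eq_fun do rewrite ImM EFinD; apply: integrableD => //; exact: integrableZlR.
Qed.

Lemma cintZ D (c : C) F : measurable D -> cintble D F ->
  cint D (fun p => c * F p) = c * cint D F.
Proof.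
move=> mD [a b]; rewrite /cint.
have -> : forall x y, c * cpt x y = cpt (complex.Re c * x - complex.Im c * y)
    (complex.Re c * y + complex.Im c * x) by case: (c).
congr cpt.
  under eq_Rintegral do rewrite ReM.
  by rewrite RintegralB//; [rewrite !RintegralZl|exact: integrableZlR|exact: integrableZlR].
under eq_Rintegral do rewrite ImM.
by rewrite RintegralD//; [rewrite !RintegralZl|exact: integrableZlR|exact: integrableZlR].
Qed.

Lemma cintble0 D : measurable D -> cintble D (fun=> 0).
Proof. by move=> mD; split => /=; exact: integrable0. Qed.

Lemma cint0 D : cint D (fun=> 0) = 0.
Proof. by rewrite /cint /= /Rintegral !integral0. Qed.

Lemma cint_sum D (I : Type) (s : seq I) (c : I -> C) (F : I -> T -> C) : measurable D ->
  (forall i, cintble D (F i)) ->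
  cint D (fun p => \sum_(i <- s) c i * F i p) = \sum_(i <- s) c i * cint D (F i) /\
  cintble D (fun p => \sum_(i <- s) c i * F i p).
Proof.
move=> mD h; elim: s => [|i s [IH IH']].
  have -> : (fun p => \sum_(i <- [::]) c i * F i p) = fun=> 0.
    by apply/funext => p; rewrite big_nil.
  by rewrite big_nil cint0; split => //; exact: cintble0.
have -> : (fun p => \sum_(i <- i :: s) c i * F i p) =
   fun p => c i * F i p + \sum_(i <- s) c i * F i p.
  by apply/funext => p; rewrite big_cons.
rewrite big_cons -IH -(cintZ _ mD (h i)) -cintD//; last exact: cintbleZ.
by split => //; apply: cintbleD => //; exact: cintbleZ.
Qed.

Lemma cint_sub_le D F G (K : R) : measurable D -> cintble D F -> cintble D G ->
  Cmeas D F -> Cmeas D G ->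
  (Iabs D (fun p => F p - G p)%R <= K%:E)%E -> cabs (cint D F - cint D G) <= 2 * K.
Proof.
move=> mD iF iG mF mG.
have e p : F p - G p = F p + (-1) * G p by rewrite mulN1r.
have -> : (fun p => F p - G p) = (fun p => F p + (-1) * G p) by apply/funext => p.
have -> : cint D F - cint D G = cint D (fun p => F p + (-1) * G p).
  by rewrite cintD// ?cintZ// ?mulN1r//; exact: cintbleZ.
by apply: cint_le => //; apply: CmeasD => //; apply: CmeasM => //; exact: Cmeas_cst.
Qed.

(** On D the remainders of phi times the series are at most M B t^n, uniformly, and D has finite
    area. *)
Lemma cint_series D (phi zeta : T -> C) (c : nat -> C) M r :
  measurable D -> (area D < +oo)%E -> Cmeas D phi -> Cmeas D zeta ->
  (forall p, D p -> cabs (phi p) <= M) -> (forall p, D p -> cabs (zeta p) <= r) ->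
  0 <= r -> r < 1 -> growth c ->
  (fun n => \sum_(0 <= k < n) c k * cint D (fun p => phi p * zeta p ^+ k)) @ \oo -->
  cint D (fun p => phi p * psum c (zeta p)).
Proof.
move=> mD fD mphi mz hphi hz r0 r1 gc.
have [B [t [B0 t0 t1 h]]] := psum_series gc r0 r1.
have mps : Cmeas D (fun p => psum c (zeta p)).
  by apply: Cmeas_psum => // p Dp; apply: le_lt_trans (hz p Dp) r1.
have M0 p : D p -> 0 <= M by move=> Dp; apply: le_trans (hphi p Dp); exact: cabs_ge0.
have mk k : Cmeas D (fun p => phi p * zeta p ^+ k) by apply: CmeasM => //; exact: CmeasX.
have ik k : cintble D (fun p => phi p * zeta p ^+ k).
  apply: (cintble_bounded (M := M)) => // p Dp; rewrite cabsM cabsX.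
  apply: le_trans (hphi p Dp); rewrite ler_piMr ?cabs_ge0// exprn_ile1 ?cabs_ge0//.
  by apply: le_trans (hz p Dp) (ltW r1).
have mn n : Cmeas D (fun p => \sum_(0 <= k < n) c k * (phi p * zeta p ^+ k)).
  by apply: Cmeas_sum => k; apply: CmeasM => //; exact: Cmeas_cst.
have mL : Cmeas D (fun p => phi p * psum c (zeta p)) by exact: CmeasM.
have key n p : D p -> cabs ((\sum_(0 <= k < n) c k * (phi p * zeta p ^+ k)) -
    phi p * psum c (zeta p)) <= M * (B * t ^+ n).
  move=> Dp; have [_ /(_ n)] := h _ (hz p Dp).
  have -> : \sum_(0 <= k < n) c k * (phi p * zeta p ^+ k) =
      phi p * series (fun k => c k * zeta p ^+ k) n.
    by rewrite seriesEnat/= mulr_sumr; apply: eq_bigr => k _; rewrite mulrCA.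
  rewrite -mulrBr cabsM cabsC => hn.
  by apply: ler_pM => //; rewrite ?cabs_ge0// hphi.
have iL : cintble D (fun p => phi p * psum c (zeta p)).
  apply: (cintble_bounded (M := M * (B * t ^+ 0))) => // p Dp.
  by have := key 0%N p Dp; rewrite big_geq// sub0r cabsN.
apply: (squeezeC (g := fun n => 2 * (M * (B * t ^+ n) * fine (area D)))).
  apply: nearW => n; have [<- isum] := cint_sum (index_iota 0 n) c mD ik.
  apply: cint_sub_le => //; apply: Iabs_bounded => //; last exact: key.
  apply: (CmeasD (mn n)).
  have -> : (fun p => - (phi p * psum c (zeta p))) = (fun p => (-1) * (phi p * psum c (zeta p))).
    by apply/funext => p; rewrite mulN1r.
  by apply: CmeasM => //; exact: Cmeas_cst.
have -> : (fun n => 2 * (M * (B * t ^+ n) * fine (area D))) =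
  (fun n => (2 * M * B * fine (area D)) * t ^+ n) by apply/funext => n; ring.
rewrite -[X in _ --> X](mulr0 (2 * M * B * fine (area D))).
by apply: cvgM; [exact: cvg_cst|apply: cvg_expr; rewrite ger0_norm].
Qed.

Lemma cint_dominated D (H : nat -> T -> C) F (g : T -> R) : measurable D ->
  (forall n, Cmeas D (H n)) -> (forall p, D p -> H n p @[n --> \oo] --> F p) ->
  (forall n p, D p -> cabs (H n p) <= g p) -> measurable_fun D g ->
  (\int[@area R]_(p in D) (g p)%:E < +oo)%E ->
  cint D (H n) @[n --> \oo] --> cint D F.
Proof.
move=> mD mH HF Hg mg ig.
have mF := Cmeas_cvg mH HF.
have g0 p : D p -> 0 <= g p.
  by move=> Dp; apply: le_trans (Hg 0%N p Dp); exact: cabs_ge0.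
have Ig : (@area R).-integrable D (fun p => (g p)%:E).
  apply/integrableP; split; first exact/measurable_EFinP.
  rewrite (eq_integral (fun p => (g p)%:E))// => p; rewrite inE => Dp.
  by rewrite gee0_abs// lee_fin g0.
have dc (h : nat -> T -> R) (f : T -> R) : (forall n, measurable_fun D (h n)) ->
    measurable_fun D f -> (forall p, D p -> h n p @[n --> \oo] --> f p) ->
    (forall n p, D p -> `|h n p| <= g p) ->
    Rintegral (@area R) D (h n) @[n --> \oo] --> Rintegral (@area R) D f.
  move=> mh mf hf hg.
  have [] := @dominated_convergence _ _ _ (@area R) D mD (fun n p => (h n p)%:E)
    (fun p => (f p)%:E) (fun p => (g p)%:E).
  - by move=> n; exact/measurable_EFinP.
  - exact/measurable_EFinP.
  - by apply: aeW => p Dp; apply: cvg_EFin; [exact: nearW|exact: hf].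
  - exact: Ig.
  - by apply: aeW => p n Dp; rewrite /= lee_fin; exact: hg.
  move=> If _ hcv; apply: fine_cvg; rewrite fineK; first exact: hcv.
  exact: integrable_fin_num.
apply: cvg_cpt; apply: dc.
- by move=> n; case: (mH n).
- by case: mF.
- by move=> p Dp; apply: cvg_Re; exact: HF.
- by move=> n p Dp; apply: le_trans (Hg n p Dp); exact: Re_le_cabs.
- by move=> n; case: (mH n).
- by case: mF.
- by move=> p Dp; apply: cvg_Im; exact: HF.
- by move=> n p Dp; apply: le_trans (Hg n p Dp); exact: Im_le_cabs.
Qed.

(** A uniform bound on integrals passes to the pointwise limit without any dominating function. It
    serves for completeness of A^1 and for exhausting the disk by smaller ones. *)
Lemma fatou_le D (h : nat -> T -> R) (f : T -> R) (K : R) : measurable D ->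
  (forall n, measurable_fun D (h n)) -> (forall n p, D p -> 0 <= h n p) ->
  (forall p, D p -> h n p @[n --> \oo] --> f p) ->
  (forall n, (\int[@area R]_(p in D) (h n p)%:E <= K%:E)%E) ->
  (\int[@area R]_(p in D) (f p)%:E <= K%:E)%E.
Proof.
move=> mD mh h0 hf hK.
have fE p : D p -> limn_einf (fun n => (h n p)%:E) = (f p)%:E.
  move=> Dp; have hc : (h n p)%:E @[n --> \oo] --> (f p)%:E.
    by apply: cvg_EFin; [exact: nearW|exact: hf].
  rewrite is_cvg_limn_einfE; first by apply/cvg_lim => //.
  by apply/cvg_ex; exists (f p)%:E.
have := @fatou _ _ _ (@area R) D mD (fun n p => (h n p)%:E) _ _.
rewrite (eq_integral (fun p => (f p)%:E)); last first.
  by move=> p; rewrite inE => Dp; rewrite fE.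
move=> H; apply: le_trans (H _ _) _.
- by move=> n; exact/measurable_EFinP.
- by move=> n p Dp; rewrite lee_fin h0.
rewrite limn_einf_lim; apply: lime_le; first exact: is_cvg_einfs.
by apply: nearW => n; apply: le_trans (hK n); apply: ereal_inf_lbound; exists n => /=.
Qed.

End ComplexIntegral.

(** * Moments of z^j conj(z)^k on disks *)

Section Moments.
Variable R : realType.
Local Notation C := (R[i])^o.
Local Notation TR := (measurableTypeR R).
Local Notation T := (TR * TR)%type.
Local Notation zz := (@zz R).

(** Estimates are first made with a radius t < 1, at the cost of a power of t; letting t tend to 1
    removes that power. *)
Lemma le_lim1 k (X Y : R) : (forall t, 0 < t -> t < 1 -> t ^+ k * X <= Y) -> X <= Y.
Proof.
move=> h.
have c1 : (fun t : R => t ^+ k) @ (1 : R)^'- --> (1 : R) ^+ k.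
  by apply: cvg_at_left_filter; exact: exprn_continuous.
have c : (fun t : R => t ^+ k * X) @ (1 : R)^'- --> (1 : R) ^+ k * X.
  by apply: cvgM => //; exact: cvg_cst.
rewrite expr1n mul1r in c; rewrite -(cvg_lim _ c)//.
apply: limr_le; first by apply/cvg_ex; exists X.
near=> t; apply: h; near: t; [exact: nbhs_left_gt|exact: nbhs_left_lt].
Unshelve. all: by end_near. Qed.

Lemma Rint_rot (r : R) (f : T -> R) M : measurable_fun [set: T] f ->
  (forall p, disk r p -> `|f p| <= M) ->
  Rintegral (@area R) (disk r) (fun p => f (rot p)) = Rintegral (@area R) (disk r) f.
Proof.
move=> mf hM.
have rotD p : disk r p -> disk r (rot p) by move=> h; rewrite -[disk r (rot p)]/(((@rot R) @^-1` disk r) p) preimage_rot.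
have mrot : measurable_fun [set: T] (fun p => f (rot p)).
  by apply: measurableT_comp => //; case: (mpres_rot R).
have mD := measurable_disk r.
have fD := area_disk_lty r.
have ib (g : T -> R) : measurable_fun [set: T] g -> (forall p, disk r p -> `|g p| <= M) ->
    (@area R).-integrable (disk r) (EFin \o g).
  move=> mg hg; apply: measurable_bounded_integrable => //; first exact: measurable_funTS.
  exists M; split; first exact: num_real.
  by move=> x Mx p Dp /=; apply: le_trans (hg p Dp) (ltW Mx).
have ic : (@area R).-integrable (disk r) (EFin \o cst M).
  apply: measurable_bounded_integrable => //.
  exists `|M|; split; first exact: num_real.
  by move=> x Mx p Dp /=; exact: ltW.
(* The change of variables is available for nonnegative functions only. Adding the constant [M]
   makes f nonnegative on the disk, and its integral then cancels. *)
have e : Rintegral (@area R) (disk r) (fun p => f (rot p) + cst M p) =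
  Rintegral (@area R) (disk r) (fun p => f p + cst M p).
  have := mpres_integral ler01 (mpres_rot R) mD (F := fun p => f p + cst M p) _ _.
  rewrite preimage_rot mul1e => H; congr fine; apply: H.
    by apply: measurable_funTS; exact: measurable_funD.
  by move=> p Dp /=; rewrite -lerBlDr sub0r lerNl; have := hM p Dp; rewrite ler_norml => /andP[+ _]; rewrite lerNl.
move: e; rewrite !RintegralD//; first by move/addIr.
- exact: ib.
- by apply: ib => // p Dp; apply: hM; exact: rotD.
Qed.

Definition rotu : C := cpt (3 / 5) (4 / 5).

Lemma zz_rot p : zz (rot p) = rotu * zz p.
Proof. by rewrite /zz /rot /rotu /cpt /=; congr Complex; rewrite // addrC. Qed.

(** Modulo 5 the Gaussian integer 3 + 4i is idempotent, since its square is -7 + 24i; hence all its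
    positive powers are congruent to it. *)
Lemma rotu_pow m : exists a b : int, (cpt 3 4 : C) ^+ m.+1 = cpt (5 * a%:~R + 3) (5 * b%:~R + 4).
Proof.
elim: m => [|m [a [b IH]]].
  by exists 0, 0; rewrite expr1 !mulr0z !mulr0 !add0r.
exists (3 * a - 4 * b - 2), (4 * a + 3 * b + 4); rewrite exprSr IH /cpt.
rewrite !(intrD, intrM, intrB); congr Complex; ring.
Qed.

(** If the power were 1, then (3 + 4i)^(m+1) would be the real number 5^(m+1), whereas its imaginary
    part is 4 modulo 5. *)
Lemma rotu_neq1 m : rotu ^+ m.+1 != 1.
Proof.
apply/negP => /eqP h.
have [a [b e]] := rotu_pow m.
have e5 : (cpt 3 4 : C) = ((5 : R)%:C)%C * rotu.
  by rewrite /cpt /rotu /cpt; congr Complex; rewrite /=; field.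
move: e; rewrite e5 exprMn h mulr1 -rmorphXn /= => -[_ /eqP].
rewrite eq_sym -[5]/(5%:~R) -[4]/(4%:~R) -intrM -intrD intr_eq0 => /eqP; lia.
Qed.

Lemma rotu_norm : rotu * conjc rotu = 1.
Proof. by rewrite /rotu /=; congr Complex; field. Qed.

Lemma rotu_mom_lt j k : (k < j)%N -> rotu ^+ j * (conjc rotu) ^+ k != 1.
Proof.
move=> jk; rewrite -(subnK (ltnW jk)) exprD -mulrA -exprMn rotu_norm expr1n mulr1.
by case: (j - k)%N (subn_gt0 k j) => [|m _]; [rewrite jk|exact: rotu_neq1].
Qed.

Lemma rotu_mom j k : j != k -> rotu ^+ j * (conjc rotu) ^+ k != 1.
Proof.
rewrite neq_ltn => /orP[jk|kj]; last exact: rotu_mom_lt.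
rewrite -(subnK (ltnW jk)) exprD (mulrC (_ ^+ (k - j))) mulrA -exprMn rotu_norm expr1n mul1r.
apply/negP => /eqP e; have := @exprMn _ (k - j) rotu (conjc rotu : C).
rewrite rotu_norm expr1n e mulr1 => /esym/eqP.
by case: (k - j)%N (subn_gt0 j k) => [|m _]; [rewrite jk|rewrite (negbTE (rotu_neq1 m))].
Qed.

Definition mono j k (p : T) : C := zz p ^+ j * (conjc (zz p) : C) ^+ k.

Lemma Cmeas_mono D j k : Cmeas D (mono j k).
Proof. by apply: CmeasM; apply: CmeasX; [|apply: CmeasC]; exact: Cmeas_zz. Qed.

Lemma cabs_mono j k p : cabs (mono j k p) = cabs (zz p) ^+ (j + k).
Proof. by rewrite cabsM !cabsX cabs_conj exprD. Qed.

Lemma mono_le j k r p : 0 <= r -> disk r p -> cabs (mono j k p) <= r ^+ (j + k).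
Proof.
move=> r0 /(zz_disk _ r0) h; rewrite cabs_mono.
by rewrite lerXn2r ?nnegrE ?cabs_ge0// ltW.
Qed.

Lemma cintble_mono j k r : 0 <= r -> cintble (disk r) (mono j k).
Proof.
move=> r0; apply: (cintble_bounded (M := r ^+ (j + k))).
- exact: measurable_disk.
- exact: area_disk_lty.
- exact: Cmeas_mono.
- by move=> p; exact: mono_le.
Qed.

Lemma mom0 j k r : 0 <= r -> j != k -> cint (disk r) (mono j k) = 0.
Proof.
move=> r0 jk.
have e : cint (disk r) (fun p => mono j k (rot p)) = cint (disk r) (mono j k).
  have [m1 m2] := Cmeas_mono setT j k.
  have r1 : Rintegral (@area R) (disk r) (fun p => complex.Re (mono j k (rot p))) =
      Rintegral (@area R) (disk r) (fun p => complex.Re (mono j k p)).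
    apply: (@Rint_rot r (fun p => complex.Re (mono j k p)) (r ^+ (j + k)) m1) => p Dp.
    by apply: le_trans (Re_le_cabs _) _; exact: mono_le.
  have r2 : Rintegral (@area R) (disk r) (fun p => complex.Im (mono j k (rot p))) =
      Rintegral (@area R) (disk r) (fun p => complex.Im (mono j k p)).
    apply: (@Rint_rot r (fun p => complex.Im (mono j k p)) (r ^+ (j + k)) m2) => p Dp.
    by apply: le_trans (Im_le_cabs _) _; exact: mono_le.
  exact: (f_equal2 (@cpt R) r1 r2).
have e2 : cint (disk r) (fun p => mono j k (rot p)) =
    (rotu ^+ j * (conjc rotu : C) ^+ k) * cint (disk r) (mono j k).
  rewrite -(cintZ _ (measurable_disk r) (cintble_mono j k r0)).
  by apply: eq_cint => p _; rewrite /mono zz_rot rmorphM /= !exprMn mulrACA.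
have e3 := etrans (esym e2) e.
move: e3; move: (cint (disk r) (mono j k)) => I /eqP.
rewrite -subr_eq0 -{2}(mul1r I) -mulrBl mulf_eq0 => /orP[|/eqP//].
by rewrite subr_eq0 (negbTE (rotu_mom jk)).
Qed.

Lemma mono_diag k p : mono k k p = (((p.1 ^+ 2 + p.2 ^+ 2) ^+ k)%:C)%C.
Proof.
rewrite /mono -exprMn rmorphXn; congr (_ ^+ _); rewrite /zz /cpt /=; congr Complex; ring.
Qed.

Definition J k r : R := Rintegral (@area R) (disk r) (fun p => (p.1 ^+ 2 + p.2 ^+ 2) ^+ k).

Lemma cint_diag k r : cint (disk r) (mono k k) = ((J k r)%:C)%C.
Proof.
rewrite (eq_cint (G := fun p : T => (((p.1 ^+ 2 + p.2 ^+ 2) ^+ k)%:C)%C))//; last first.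
  by move=> p _; exact: mono_diag.
by rewrite /cint /= /Rintegral integral0.
Qed.

Lemma measurable_norm2X D k : measurable_fun D (fun p : T => (p.1 ^+ 2 + p.2 ^+ 2) ^+ k).
Proof. by apply: measurable_funTS; apply: measurable_funX; exact: measurable_norm2. Qed.

Lemma integrable_norm2X (D : set T) k r : measurable D -> D `<=` disk r ->
  (@area R).-integrable D (EFin \o (fun p => (p.1 ^+ 2 + p.2 ^+ 2) ^+ k)).
Proof.
move=> mD Dr; apply: measurable_bounded_integrable => //.
- apply: le_lt_trans (area_disk_lty r); apply: le_measure; rewrite ?inE//; exact: measurable_disk.
- exact: measurable_norm2X.
exists ((r ^+ 2) ^+ k); split; first exact: num_real.
move=> x x1 p /Dr; rewrite /disk /= => h; apply: le_trans (ltW x1).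
rewrite ger0_norm ?exprn_ge0 ?addr_ge0 ?sqr_ge0//.
by rewrite lerXn2r ?nnegrE ?addr_ge0 ?sqr_ge0// ltW.
Qed.

Lemma JE k r : ((J k r)%:E = \int[@area R]_(p in disk r) ((p.1 ^+ 2 + p.2 ^+ 2) ^+ k)%:E)%E.
Proof.
rewrite /J /Rintegral fineK//; apply: integrable_fin_num; first exact: measurable_disk.
by apply: (@integrable_norm2X _ _ r) => //; exact: measurable_disk.
Qed.

Lemma disk_sub r s : 0 <= r -> r <= s -> disk r `<=` @disk R s.
Proof.
move=> r0 rs p; rewrite /disk /= => h; apply: lt_le_trans h _.
by rewrite lerXn2r// nnegrE// (le_trans r0).
Qed.

Lemma scale_int r s (f : T -> R) : 0 < r ->
  measurable_fun (disk s) f -> (forall p, disk s p -> 0 <= f p) ->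
  (\int[@area R]_(p in disk (s / r)) (f (r * p.1, r * p.2)%R)%:E =
   (r^-1 ^+ 2)%:E * \int[@area R]_(p in disk s) (f p)%:E)%E.
Proof.
move=> r0 mf f0; rewrite -(preimage_scale s r0).
have := mpres_integral _ (mpres_scale r0) (measurable_disk s) mf f0.
by apply; rewrite sqr_ge0.
Qed.

(** The exponent is 2k from the homogeneity of the integrand plus 2 from the area. *)
Lemma J_scale k r : 0 < r -> J k r = r ^+ (k.*2.+2) * J k 1.
Proof.
move=> r0; have := @scale_int r r (fun p => (p.1 ^+ 2 + p.2 ^+ 2) ^+ k) r0 (@measurable_norm2X _ k).
rewrite divff ?gt_eqF// -JE => /(_ (fun p _ => exprn_ge0 k (addr_ge0 (sqr_ge0 _) (sqr_ge0 _)))) e.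
have E : Rintegral (@area R) (disk 1) (fun p => r ^+ k.*2 * (p.1 ^+ 2 + p.2 ^+ 2) ^+ k) =
   r^-1 ^+ 2 * J k r.
  rewrite /Rintegral -[RHS]/(fine (r^-1 ^+ 2 * J k r)%:E) EFinM -e.
  congr fine; apply: eq_integral => p _ /=; congr (_%:E).
  by rewrite -mul2n exprM -exprMn; congr (_ ^+ _); ring.
move: E; rewrite RintegralZl; last 2 first.
- exact: measurable_disk.
- by apply: (@integrable_norm2X _ _ 1) => //; exact: measurable_disk.
rewrite -/(J k 1) => E; rewrite -addn2 exprD (mulrC (r ^+ _)) -mulrA E mulrA -exprMn divff ?gt_eqF//.
by rewrite expr1n mul1r.
Qed.

Lemma J0_1 : J 0 1 = A0 R.
Proof.
apply: (@EFin_inj R); rewrite JE -A0E.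
rewrite (eq_integral (cst 1%E)); last by move=> p _; rewrite expr0.
by rewrite integral_cst ?mul1e//; exact: measurable_disk.
Qed.

(** On the annulus s <= |z| < 1 the integrand |z|^(2k) lies between s^(2k) and 1. Together with
    scaling, this crude bound replaces polar coordinates in [J1]. *)
Lemma J_annulus k s : 0 < s -> s < 1 ->
  s ^+ k.*2 * (J 0 1 - J 0 s) <= J k 1 - J k s <= J 0 1 - J 0 s.
Proof.
move=> s0 s1; pose E : set T := disk 1 `\` disk s.
have mE : measurable E by apply: measurableD; exact: measurable_disk.
have E1 : E `<=` disk 1 by move=> p [].
have D1 : disk 1 = disk s `|` E.
  apply/seteqP; split => p /=; last first.
    by move=> [|[]//]; apply: disk_sub; exact: ltW.
  by move=> h; have [?|?] := pselect (disk s p); [left|right].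
have JD j : J j 1 - J j s = Rintegral (@area R) E (fun p => (p.1 ^+ 2 + p.2 ^+ 2) ^+ j).
  have i1 : (@area R).-integrable (disk s `|` E) (EFin \o (fun p => (p.1 ^+ 2 + p.2 ^+ 2) ^+ j)).
    by rewrite -D1; apply: (@integrable_norm2X _ _ 1) => //; exact: measurable_disk.
  have dj : [disjoint disk s & E].
    by rewrite disj_set2E; apply/eqP/seteqP; split => p //= [? []].
  have h := Rintegral_setU (measurable_disk s) mE i1 dj.
  by rewrite -D1 in h; apply/eqP; rewrite subr_eq addrC; apply/eqP; exact: h.
have iE j := @integrable_norm2X _ j _ mE E1.
rewrite !JD; apply/andP; split.
  rewrite -RintegralZl//; apply: le_Rintegral => //; first exact: (integrableZlR (s ^+ k.*2) mE (iE 0%N)).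
  move=> p [_ /negP]; rewrite -leNgt expr0 mulr1 -mul2n exprM => h.
  by rewrite lerXn2r ?nnegrE ?addr_ge0 ?sqr_ge0.
apply: le_Rintegral => // p [+ _]; rewrite /disk /= expr1n => h.
by rewrite expr0 exprn_ile1 ?addr_ge0 ?sqr_ge0// ltW.
Qed.

(** By scaling, [J_annulus] reads t^(2k) A0 (1 - t^2) <= J_k (1 - t^(2k+2)) <= A0 (1 - t^2), where
    J_k is the moment on the unit disk. Dividing by 1 - t^2 turns the middle factor into a geometric
    sum, which tends to k + 1 as t tends to 1. *)
Lemma J1 k : J k 1 * k.+1%:R = A0 R.
Proof.
have key t : 0 < t -> t < 1 -> t ^+ k.*2 * A0 R <= J k 1 * \sum_(0 <= i < k.+1) (t ^+ 2) ^+ i <= A0 R.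
  move=> t0 t1; have := J_annulus k t0 t1.
  rewrite !(J_scale _ t0) J0_1 double0.
  have t2 : 0 < 1 - t ^+ 2 by rewrite subr_gt0 expr_lt1// ltW.
  have e1 : A0 R - t ^+ 2 * A0 R = A0 R * (1 - t ^+ 2) by ring.
  have e2 : J k 1 - t ^+ k.*2.+2 * J k 1 = J k 1 * (\sum_(0 <= i < k.+1) (t ^+ 2) ^+ i) * (1 - t ^+ 2).
    have -> : t ^+ k.*2.+2 = (t ^+ 2) ^+ k.+1 by rewrite -exprM mul2n doubleS.
    have := subrX1 (t ^+ 2) k.+1; rewrite -(big_mkord xpredT (fun i => (t ^+ 2) ^+ i)) => h.
    have hS : (\sum_(0 <= i < k.+1) (t ^+ 2) ^+ i) * (1 - t ^+ 2) = 1 - (t ^+ 2) ^+ k.+1.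
      by rewrite mulrC -[1 - t ^+ 2]opprB mulNr -h opprB.
    by rewrite -mulrA hS mulrBr mulr1 (mulrC _ (J k 1)).
  by rewrite e1 e2 mulrA !ler_pM2r.
have J0 : 0 <= J k 1 by apply: Rintegral_ge0 => p _; rewrite exprn_ge0// addr_ge0 ?sqr_ge0.
apply/eqP; rewrite eq_le; apply/andP; split.
  apply: (@le_lim1 k.*2) => t t0 t1; have /andP[_] := key t t0 t1; apply: le_trans.
  rewrite mulrCA ler_wpM2l//.
  rewrite mulr_natr -[X in _ *+ X]subn0 -sumr_const_nat big_nat [leRHS]big_nat; apply: ler_sum => i /andP[_ ik].
  by rewrite -exprM; apply: ler_wiXn2l; rewrite ?ltW// -mul2n leq_mul2l.
apply: (@le_lim1 k.*2) => t t0 t1; have /andP[+ _] := key t t0 t1 => /le_trans; apply.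
rewrite ler_wpM2l// -[X in _ <= X%:R]subn0 -sumr_const_nat big_nat [leRHS]big_nat; apply: ler_sum => i /andP[_ ik].
by rewrite exprn_ile1 ?sqr_ge0// expr_le1// ltW.
Qed.

Lemma JkE k r : 0 < r -> J k r = A0 R * r ^+ k.*2.+2 / k.+1%:R.
Proof.
move=> r0; rewrite (J_scale k r0) -(J1 k); apply: (canRL (mulfK _)); first by rewrite pnatr_eq0.
exact: etrans (esym (mulrA _ _ _)) (mulrC _ _).
Qed.

Lemma cint_mono j k r : 0 < r -> cint (disk r) (mono j k) =
  (j == k)%:R * ((A0 R * r ^+ k.*2.+2 / k.+1%:R)%:C)%C.
Proof.
move=> r0; have [->|jk] := eqVneq; first by rewrite mul1r cint_diag JkE.
by rewrite mul0r mom0// ltW.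
Qed.

End Moments.
(** * Bergman-type kernels *)

Section Kernel.
Variable R : realType.
Local Notation C := (R[i])^o.
Local Notation TR := (measurableTypeR R).
Local Notation T := (TR * TR)%type.
Local Notation zz := (@zz R).
Local Notation D := (@disk R 1).

Lemma psum_dil (c : nat -> C) u z : psum (fun k => c k * u ^+ k) z = psum c (u * z).
Proof.
rewrite /psum; congr (lim (series _ @ \oo)); apply/funext => k.
by rewrite exprMn mulrA.
Qed.

Lemma growth_nat n : growth (fun k => (k + n)%:R : C).
Proof.
apply: (growth_poly (c := fun=> 1) (K := n.+1%:R)); first by apply: (growth_bounded (B := 1)) => k; rewrite cabs1.
by move=> k; rewrite cabs_nat cabs1 mulr1 -natrM ler_nat; nia.
Qed.

Lemma growth_nat2 : growth (fun k => (k.+1 * k.+2)%:R : C).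
Proof.
apply: (growth_poly (c := fun k => (k + 2)%:R) (K := 1)); first exact: growth_nat.
by move=> k; rewrite !cabs_nat mul1r -natrM ler_nat addn2.
Qed.

Lemma growth_geo (u : C) (c : nat -> C) : cabs u <= 1 -> growth c -> growth (fun k => c k * u ^+ k).
Proof.
move=> u1 gc; apply: (growth_le (K := 1) gc) => k.
by rewrite mul1r cabsM cabsX ler_piMr ?cabs_ge0// exprn_ile1// cabs_ge0.
Qed.

Lemma sub1_neq0 (v : C) : cabs v < 1 -> 1 - v != 0.
Proof.
by move=> v1; apply/eqP => /eqP; rewrite subr_eq0 => /eqP e; rewrite -e cabs1 ltxx in v1.
Qed.

Lemma growth_one : growth (fun=> 1 : C).
Proof. by apply: (growth_bounded (B := 1)) => k; rewrite cabs1. Qed.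

(** Multiplication by 1 - v replaces coefficients by their successive differences. Applied to 1,
    then k + 1, then (k + 1)(k + 2), this sums the kernel in closed form without products of
    series. *)
Lemma psum_geo (v : C) : cabs v < 1 -> (1 - v) * psum (fun=> 1) v = 1.
Proof.
by move=> v1; rewrite mulrBl mul1r {1}(psum_shift growth_one v1) addrK.
Qed.

Lemma psum_geo1 (v : C) : cabs v < 1 -> (1 - v) * psum (fun k => (k + 1)%:R) v = psum (fun=> 1) v.
Proof.
move=> v1; have h := psum_lin 1 1 (growth_nat 1) growth_one v1.
rewrite mulrBl mul1r {1}(psum_shift (growth_nat 1) v1).
have -> : (fun k => (k.+1 + 1)%:R : C) = fun k => 1 * (k + 1)%:R + 1 * 1.
  by apply/funext => k; rewrite !mul1r natr1 addSn.
rewrite h !mul1r mulrDr [RHS](psum_shift growth_one v1) /=; ring.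
Qed.

Lemma psum_geo2 (v : C) : cabs v < 1 ->
  (1 - v) * psum (fun k => (k.+1 * k.+2)%:R) v = 2 * psum (fun k => (k + 1)%:R) v.
Proof.
move=> v1; have h := psum_lin 1 2 growth_nat2 (growth_shift (growth_nat 1)) v1.
rewrite mulrBl mul1r {1}(psum_shift growth_nat2 v1).
have -> : (fun k => (k.+2 * k.+3)%:R : C) = fun k => 1 * (k.+1 * k.+2)%:R + 2 * (k.+1 + 1)%:R.
  by apply/funext => k; rewrite mul1r -!natrM -natrD; congr (_%:R); lia.
rewrite h [psum (fun k => (k + 1)%:R) v](psum_shift (growth_nat 1) v1) /=; ring.
Qed.

(* Taylor coefficients of z |-> 2 z / (1 - u z)^3. *)
Definition kc (u : C) k : C := (k * k.+1)%:R * u ^+ k.-1.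

Lemma growth_kc u : cabs u <= 1 -> growth (kc u).
Proof.
move=> u1; apply: (growth_poly (c := fun k => (k + 1)%:R) (K := 1)); first exact: growth_nat.
move=> k; rewrite cabsM cabsX !cabs_nat mul1r -natrM.
apply: le_trans (_ : (k * k.+1)%:R <= _); first by rewrite ler_piMr// exprn_ile1// cabs_ge0.
by rewrite ler_nat; nia.
Qed.

Lemma psum_kc u z : cabs u < 1 -> cabs z < 1 ->
  psum (kc u) z * (1 - u * z) ^+ 3 = 2 * z.
Proof.
move=> u1 z1.
have v1 : cabs (u * z) < 1 by rewrite cabsM mulr_ilt1 ?cabs_ge0.
rewrite (psum_shift (growth_kc (ltW u1)) z1) /kc mul0n mul0r add0r /=.
rewrite (psum_dil (fun k => (k.+1 * k.+2)%:R)).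
have h2 := psum_geo2 v1; have h1 := psum_geo1 v1; have h0 := psum_geo v1.
set v := u * z in h0 h1 h2 *.
have -> : z * psum (fun k => (k.+1 * k.+2)%:R) v * (1 - v) ^+ 3 =
  z * ((1 - v) * ((1 - v) * ((1 - v) * psum (fun k => (k.+1 * k.+2)%:R) v))).
  by rewrite !exprS expr0; ring.
by rewrite h2 (mulrCA (1 - v) 2) h1 (mulrCA (1 - v) 2) h0 mulr1 mulrC.
Qed.

Lemma coef_limit (F : nat -> C) (c : nat -> C) m :
  (forall k, k != m -> F k = 0) ->
  (fun n => \sum_(0 <= k < n) c k * F k) @ \oo --> c m * F m.
Proof.
move=> h; apply/cvgC_lt => e e0; near=> n.
have mn : (m < n)%N by near: n; exact: nbhs_infty_gt.
rewrite (eq_bigr (fun k => if k == m then c k * F k else 0)); last first.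
  by move=> k _; case: eqVneq => // km; rewrite h// mulr0.
by rewrite -big_mkcond big_nat1_eq mn /= subrr cabs0.
Unshelve. all: by end_near. Qed.

(** This is (1 - t |z|^2)^-2, kept as a series so that its moments can be found term by term. The
    value t = |u|^2 gives the weight (1 - |u z|^2)^-2. *)
Definition omega (t : R) (p : T) : C := psum (fun k => (k + 1)%:R) ((t * (p.1 ^+ 2 + p.2 ^+ 2))%:C)%C.

Lemma omega_arg t p : 0 <= t -> D p -> cabs ((t * (p.1 ^+ 2 + p.2 ^+ 2))%:C : C)%C <= t.
Proof.
move=> t0 h; have {}h : p.1 ^+ 2 + p.2 ^+ 2 < 1 by move: h; rewrite /disk /= expr1n.
by rewrite cabs_real ger0_norm ?mulr_ge0 ?addr_ge0 ?sqr_ge0// ler_piMr// ltW.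
Qed.

Lemma Cmeas_omega_arg t : Cmeas D (fun p : T => ((t * (p.1 ^+ 2 + p.2 ^+ 2))%:C : C)%C).
Proof.
apply: Cmeas_real; apply: measurable_funM; first exact: measurable_cst.
by apply: measurable_funTS; exact: measurable_norm2.
Qed.

Lemma Cmeas_omega t : 0 <= t -> t < 1 -> Cmeas D (omega t).
Proof.
move=> t0 t1; apply: (Cmeas_psum (growth_nat 1)); first exact: Cmeas_omega_arg.
by move=> p Dp; apply: le_lt_trans (omega_arg t0 Dp) t1.
Qed.

Lemma omega_bounded t : 0 <= t -> t < 1 -> exists M, forall p, D p -> cabs (omega t p) <= M.
Proof.
move=> t0 t1; have [B [s [B0 s0 s1 h]]] := psum_series (growth_nat 1) t0 t1.
exists B => p Dp; have [_ /(_ 0%N)] := h _ (omega_arg t0 Dp).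
by rewrite seriesEnat/= big_geq// subr0 expr0 mulr1.
Qed.

(** The weight is radial, so only k = 0 survives. There the m-th term contributes (m + 1) t^m A0 /
    (m + 1), and the sum is geometric. *)
Lemma omega_mom t k : 0 <= t -> t < 1 ->
  cint D (fun p => omega t p * zz p ^+ k) = (k == 0)%:R * ((A0 R / (1 - t))%:C)%C.
Proof.
move=> t0 t1.
have mD := measurable_disk (1 : R); have fD := area_disk_lty (1 : R).
have := cint_series (phi := fun p => zz p ^+ k) (M := 1) mD fD (CmeasX k (Cmeas_zz D))
  (Cmeas_omega_arg t) _ (fun p => @omega_arg t p t0) t0 t1 (growth_nat 1).
have h1 p : D p -> cabs (zz p ^+ k) <= 1.
  by move=> /(zz_disk _ ler01) h; rewrite cabsX exprn_ile1 ?cabs_ge0// ltW.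
move=> /(_ h1).
have e m : cint D (fun p => zz p ^+ k * ((t * (p.1 ^+ 2 + p.2 ^+ 2))%:C : C)%C ^+ m) =
   (k == 0)%:R * ((A0 R * t ^+ m / m.+1%:R)%:C)%C.
  transitivity (cint D (fun p => ((t ^+ m)%:C : C)%C * mono (m + k) m p)).
    apply: eq_cint => p _; rewrite -rmorphXn /= exprMn rmorphM /= -mono_diag /mono exprD.
    by rewrite mulrCA; congr (_ * _); rewrite mulrA (mulrC (_ ^+ k)).
  rewrite (cintZ _ mD (cintble_mono _ _ ler01)) (cint_mono _ _ ltr01) expr1n mulr1.
  have -> : (m + k == m)%N = (k == 0) by rewrite -[X in _ == X]addn0 eqn_add2l.
  rewrite mulrCA -rmorphM; congr (_ * _); congr (_%:C)%C.
  by rewrite mulrA (mulrC (t ^+ m)).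
have -> : (fun n => \sum_(0 <= m < n) (m + 1)%:R *
    cint D (fun p => zz p ^+ k * ((t * (p.1 ^+ 2 + p.2 ^+ 2))%:C : C)%C ^+ m)) =
  fun n => (k == 0)%:R * (((A0 R)%:C)%C * series (fun m => 1 * ((t%:C)%C : C) ^+ m) n).
  apply/funext => n; rewrite seriesEnat/= !mulr_sumr; apply: eq_bigr => m _.
  rewrite e mulrCA; congr (_ * _).
  have -> : ((m + 1)%:R : C) = ((m.+1%:R : R)%:C)%C by rewrite addn1 rmorph_nat.
  rewrite mul1r -rmorphXn -!rmorphM; congr (_%:C)%C.
  by rewrite mulrC divfK// pnatr_eq0.
move=> h.
have tC : cabs (t%:C%C : C) < 1 by rewrite cabs_real ger0_norm.
have h2 : (fun n => (k == 0)%:R * (((A0 R)%:C)%C * series (fun m => 1 * ((t%:C)%C : C) ^+ m) n)) @ \oo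
   --> ((k == 0)%:R : C) * (((A0 R)%:C)%C * psum (fun=> 1) ((t%:C)%C : C)).
  apply: cvgCM; first exact: cvg_cst.
  apply: cvgCM; first exact: cvg_cst.
  exact: (psum_cvg growth_one tC).
have -> : cint D (fun p => omega t p * zz p ^+ k) =
   cint D (fun p => zz p ^+ k * psum (fun m => (m + 1)%:R) ((t * (p.1 ^+ 2 + p.2 ^+ 2))%:C)%C).
  by apply: eq_cint => p _; rewrite mulrC.
have -> := limC_unique h h2; congr (_ * _).
have n0 := sub1_neq0 tC; have := psum_geo tC.
move: (psum _ _) => X hX; rewrite -[X](mulKf n0) hX mulr1 -(rmorph1 (@real_complex R)) -rmorphB.
by rewrite -fmorphV -rmorphM.
Qed.

(* Taylor coefficients of (1 + v) / (1 - v).  With v = u z, the real part of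
   (1 - |v|^2)^-2 (1 + v) / (1 - v) is 1 / ((1 - |v|^2) |1 - v|^2), which
   dominates |1 - v|^-3 / 2, while its integral is explicit. *)
Definition pc (k : nat) : C := if k == 0 then 1 else 2.

Lemma growth_pc : growth pc.
Proof.
apply: (growth_bounded (B := 2)) => k; rewrite /pc.
by case: eqP => _; rewrite ?cabs1 ?ler1n// (cabs_nat _ 2).
Qed.

Lemma psum_pc v : cabs v < 1 -> psum pc v * (1 - v) = 1 + v.
Proof.
move=> v1; rewrite (psum_shift growth_pc v1) /pc /=.
have -> : psum (fun=> 2) v = 2 * psum (fun=> 1) v.
  have h := psum_lin 2 0 growth_one growth_one v1.
  have -> : (fun=> 2 : C) = fun k : nat => 2 * 1 + 0 * 1 :> C.
    by apply/funext => k; rewrite mul0r addr0 mulr1.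
  by rewrite h mul0r addr0.
have := psum_geo v1; move: (psum _ _) => X h.
have -> : (1 + v * (2 * X)) * (1 - v) = 1 - v + 2 * v * ((1 - v) * X) by ring.
by rewrite h; ring.
Qed.

Lemma cabs_uz u p r : 0 <= r -> disk r p -> cabs (u * zz p) <= cabs u * r.
Proof. by move=> r0 /(zz_disk _ r0) h; rewrite cabsM ler_wpM2l ?cabs_ge0// ltW. Qed.

(** A mean value property: against a radial weight, only the constant coefficient 1 of (1 + v) / (1
    - v) contributes. *)
Lemma kernel_mom u : cabs u < 1 ->
  cint D (fun p => omega (cabs u ^+ 2) p * psum pc (u * zz p)) = ((A0 R / (1 - cabs u ^+ 2))%:C)%C.
Proof.
move=> u1; have t0 : 0 <= cabs u ^+ 2 by rewrite sqr_ge0.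
have t1 : cabs u ^+ 2 < 1 by rewrite expr_lt1 ?cabs_ge0.
have [M hM] := omega_bounded t0 t1.
have mD := measurable_disk (1 : R); have fD := area_disk_lty (1 : R).
have mu : Cmeas D (fun p => u * zz p).
  by apply: CmeasM; [exact: Cmeas_cst|exact: Cmeas_zz].
have hu p : D p -> cabs (u * zz p) <= cabs u.
  by move=> /(cabs_uz u ler01); rewrite mulr1.
have h := cint_series mD fD (Cmeas_omega t0 t1) mu hM hu (cabs_ge0 u) u1 growth_pc.
have e k : cint D (fun p => omega (cabs u ^+ 2) p * (u * zz p) ^+ k) =
    u ^+ k * ((k == 0)%:R * ((A0 R / (1 - cabs u ^+ 2))%:C)%C).
  rewrite -(omega_mom k t0 t1).
  have ic : cintble D (fun p => omega (cabs u ^+ 2) p * zz p ^+ k).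
    apply: (cintble_bounded (M := M)) => //.
      by apply: CmeasM; [exact: Cmeas_omega|exact: CmeasX (Cmeas_zz D)].
    move=> p Dp; rewrite cabsM cabsX; apply: le_trans (hM p Dp).
    rewrite ler_piMr ?cabs_ge0// exprn_ile1 ?cabs_ge0//.
    by move/(zz_disk _ ler01): Dp => /ltW.
  rewrite -(cintZ _ mD ic).
  by apply: eq_cint => p _; rewrite exprMn mulrCA.
have z0 k : k != 0 -> cint D (fun p => omega (cabs u ^+ 2) p * (u * zz p) ^+ k) = 0.
  by move=> k0; rewrite e (negbTE k0) mul0r mulr0.
have h2 := @coef_limit _ pc 0 z0.
by apply: etrans (limC_unique h h2) _; rewrite (e 0%N) eqxx expr0 !mul1r.
Qed.

(** With v = u z, the real part of (1 + v) / (1 - v) is (1 - |v|^2) / |1 - v|^2, and one of the two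
    factors 1 - |v|^2 in the weight cancels. *)
Lemma kernel_re u p : cabs u < 1 -> D p ->
  complex.Re (omega (cabs u ^+ 2) p * psum pc (u * zz p)) =
  ((1 - cabs (u * zz p) ^+ 2) * cabs (1 - u * zz p) ^+ 2)^-1.
Proof.
move=> u1 Dp.
have v1 : cabs (u * zz p) < 1.
  by have := cabs_uz u ler01 Dp; rewrite mulr1 => /le_lt_trans; apply.
have eq : cabs u ^+ 2 * (p.1 ^+ 2 + p.2 ^+ 2) = cabs (u * zz p) ^+ 2.
  by rewrite cabsM exprMn -(cabs_cpt p.1 p.2).
rewrite /omega eq; move: (u * zz p) v1 => v v1 {eq}.
have s1 : cabs v ^+ 2 < 1 by rewrite expr_lt1 ?cabs_ge0.
have sC : cabs ((cabs v ^+ 2)%:C%C : C) < 1 by rewrite cabs_real ger0_norm ?sqr_ge0.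
have h0 := psum_geo sC; have h1 := psum_geo1 sC; have h2 := psum_pc v1.
have n1 := sub1_neq0 sC; have n2 := sub1_neq0 v1.
have -> : psum (fun k => (k + 1)%:R) ((cabs v ^+ 2)%:C%C : C) = (((1 - cabs v ^+ 2) ^- 2)%:C)%C.
  have -> : (((1 - cabs v ^+ 2) ^- 2)%:C)%C = (1 - ((cabs v ^+ 2)%:C)%C : C) ^- 2.
    by rewrite fmorphV rmorphXn rmorphB rmorph1.
  by rewrite -[LHS](mulKf n1) h1 -[psum _ _](mulKf n1) h0 mulr1 -invfM -expr2.
have -> : psum pc v = (1 + v) * conjc (1 - v) * (((cabs (1 - v) ^- 2))%:C)%C.
  rewrite -[LHS](mulfK n2) h2 -mulrA; congr (_ * _).
  rewrite invc_norm mulrC; congr (_ * _).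
  by rewrite normC_cabs fmorphV rmorphXn.
rewrite mulrCA -rmorphM ReM /= mulr0 subr0.
have -> : complex.Re ((1 + v) * conjc (1 - v)) = 1 - cabs v ^+ 2.
  by rewrite cabs_sqr; case: (v) => x y /=; ring.
rewrite [RHS]invfM [LHS]mulrA; congr (_ * _).
have : 1 - cabs v ^+ 2 != 0 by rewrite subr_eq0 gt_eqF.
by move=> n; field.
Qed.

(** From 1 - |v| <= |1 - v| follows 1 - |v|^2 <= 2 |1 - v|. Hence the kernel 2 |z| / |1 - v|^3 is at
    most 4 times the positive function of [kernel_re], whose integral is given by [kernel_mom]. *)
Lemma kernel_bound u : cabs u < 1 ->
  (Iabs D (fun p => psum (kc u) (zz p)) <= (4 * A0 R / (1 - cabs u ^+ 2))%:E)%E.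
Proof.
move=> u1; have t0 : 0 <= cabs u ^+ 2 by rewrite sqr_ge0.
have t1 : cabs u ^+ 2 < 1 by rewrite expr_lt1 ?cabs_ge0.
have mD := measurable_disk (1 : R); have fD := area_disk_lty (1 : R).
pose F p := omega (cabs u ^+ 2) p * psum pc (u * zz p).
have hu p : D p -> cabs (u * zz p) <= cabs u.
  by move=> /(cabs_uz u ler01); rewrite mulr1.
have mF : Cmeas D F.
  apply: CmeasM; first exact: Cmeas_omega.
  apply: Cmeas_psum; first exact: growth_pc.
    by apply: CmeasM; [exact: Cmeas_cst|exact: Cmeas_zz].
  by move=> p /hu h; exact: le_lt_trans h u1.
have [M hM] := omega_bounded t0 t1.
have [B [s [B0 s0 s1 hB]]] := psum_series growth_pc (cabs_ge0 u) u1.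
have iF : cintble D F.
  apply: (cintble_bounded (M := M * B)) => // p Dp; rewrite cabsM.
  apply: ler_pM; rewrite ?cabs_ge0//; first exact: hM.
  have [_ /(_ 0%N)] := hB _ (hu p Dp).
  by rewrite seriesEnat/= big_geq// subr0 expr0 mulr1.
have iRe : (\int[@area R]_(p in D) (complex.Re (F p))%:E = (A0 R / (1 - cabs u ^+ 2))%:E)%E.
  have := congr1 (@complex.Re R) (kernel_mom u1); rewrite /= /Rintegral => <-.
  rewrite fineK//; case: iF => i1 _; exact: integrable_fin_num.
have key p : D p -> cabs (psum (kc u) (zz p)) <= 4 * complex.Re (F p).
  move=> Dp; rewrite kernel_re//.
  have z1 : cabs (zz p) < 1 by exact/(zz_disk _ ler01).
  have v1 := le_lt_trans (hu p Dp) u1.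
  have e0 := congr1 (@cabs R) (psum_kc u1 z1).
  rewrite cabsM cabsX [RHS]cabsM (cabs_nat _ 2) in e0.
  have d0 : 0 < cabs (1 - u * zz p).
    rewrite lt_neqAle cabs_ge0 andbT eq_sym; apply/eqP => /cabs0_eq0 /eqP.
    exact/negP/sub1_neq0.
  have d1 : 1 - cabs (u * zz p) <= cabs (1 - u * zz p).
    rewrite lerBlDr -{1}(cabs1 R) -{1}(subrK (u * zz p) 1); exact: cabsD.
  have v0 := cabs_ge0 (u * zz p); have zz0 := cabs_ge0 (zz p).
  have K0 := cabs_ge0 (psum (kc u) (zz p)).
  move: e0; move: (cabs (psum _ _)) (cabs (1 - _)) (cabs (u * _)) (cabs (zz p)) z1 v1 d0 d1 v0 zz0 K0.
  move=> X d v z z1 v1 d0 d1 v0 zz0 X0 e.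
  have n0 : 0 < 1 - v ^+ 2 by rewrite subr_gt0 expr_lt1.
  rewrite ler_pdivlMr ?mulr_gt0 ?exprn_gt0//.
  apply: le_trans (_ : X * (2 * d * d ^+ 2) <= _).
    rewrite ler_wpM2l// ler_wpM2r ?sqr_ge0//; nra.
  have -> : X * (2 * d * d ^+ 2) = 2 * (X * d ^+ 3) by ring.
  by rewrite e; lra.
have m1 : measurable_fun D (fun p => complex.Re (F p)) by case: mF.
have m2 : measurable_fun D (fun p => 4 * complex.Re (F p)).
  by apply: measurable_funM => //; exact: measurable_cst.
have gk := growth_kc (ltW u1).
have mk : Cmeas D (fun p => psum (kc u) (zz p)).
  by apply: Cmeas_psum => //; [exact: Cmeas_zz|move=> p /(zz_disk _ ler01)].
apply: le_trans (Iabs_le mD mk m2 key) _.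
have -> : (4 * A0 R / (1 - cabs u ^+ 2))%:E = (4%:E * (A0 R / (1 - cabs u ^+ 2))%:E)%E.
  by rewrite -EFinM mulrA.
rewrite -iRe -ge0_integralZl//.
- exact/measurable_EFinP.
- move=> p Dp; rewrite lee_fin; have := key p Dp; have := cabs_ge0 (psum (kc u) (zz p)); lra.
Qed.

End Kernel.

(** * Recovering Taylor coefficients from area integrals *)

Section Coefficients.
Variable R : realType.
Local Notation C := (R[i])^o.
Local Notation TR := (measurableTypeR R).
Local Notation T := (TR * TR)%type.
Local Notation zz := (@zz R).
Local Notation D := (@disk R 1).

Lemma coef_extract (E : set T) (phi zeta : T -> C) (c : nat -> C) M r k :
  measurable E -> (area E < +oo)%E -> Cmeas E phi -> Cmeas E zeta ->
  (forall p, E p -> cabs (phi p) <= M) -> (forall p, E p -> cabs (zeta p) <= r) ->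
  0 <= r -> r < 1 -> growth c ->
  (forall j, j != k -> cint E (fun p => phi p * zeta p ^+ j) = 0) ->
  cint E (fun p => phi p * psum c (zeta p)) = c k * cint E (fun p => phi p * zeta p ^+ k).
Proof.
move=> mE fE mphi mz hphi hz r0 r1 gc h0.
exact: (limC_unique (cint_series mE fE mphi mz hphi hz r0 r1 gc) (@coef_limit _ (fun j => cint E (fun p => phi p * zeta p ^+ j)) c k h0)).
Qed.

Lemma zz_le (r : R) p : 0 <= r -> disk r p -> cabs (zz p) <= r.
Proof. by move=> r0 /(zz_disk _ r0) /ltW. Qed.

Lemma CmeasCzz (E : set T) : Cmeas E (fun p => conjc (zz p) : C).
Proof. exact: CmeasC (Cmeas_zz E). Qed.

(** The value s = 1 gives the Bloch weight; s = r is used on the disk of radius sqrt r, on whose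
    boundary the weight vanishes. *)
Definition wt (s : R) (p : T) : C := ((s - (p.1 ^+ 2 + p.2 ^+ 2))%:C)%C.

Lemma Cmeas_wt (E : set T) s : Cmeas E (wt s).
Proof.
apply: Cmeas_real; apply: measurable_funB; first exact: measurable_cst.
by apply: measurable_funTS; exact: measurable_norm2.
Qed.

Lemma wt_le s r p : 0 <= r -> r ^+ 2 <= s -> disk r p -> cabs (wt s p) <= s.
Proof.
move=> r0 rs h; rewrite /wt cabs_real ger0_norm.
  by rewrite lerBlDr lerDl addr_ge0 ?sqr_ge0.
by rewrite subr_ge0; apply: le_trans (ltW h) rs.
Qed.

Lemma cint_wt_mono j k r s : 0 < r -> cint (disk r) (fun p => wt s p * mono j k p) =
  (j == k)%:R * ((A0 R * (s * r ^+ k.*2.+2 / k.+1%:R - r ^+ k.*2.+4 / k.+2%:R))%:C)%C.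
Proof.
move=> r0; have mD := measurable_disk r; have rge := ltW r0.
transitivity (cint (disk r) (fun p => ((s%:C)%C : C) * mono j k p + (-1) * mono j.+1 k.+1 p)).
  apply: eq_cint => p _; rewrite /wt rmorphB mulrBl mulN1r; congr (_ - _).
  have e1 : ((p.1 ^+ 2 + p.2 ^+ 2)%:C)%C = mono 1 1 p by rewrite mono_diag expr1.
  have e2 : mono 1 1 p * mono j k p = mono j.+1 k.+1 p by rewrite /mono !expr1 !exprS mulrACA.
  exact: etrans (congr1 (fun x => x * mono j k p) e1) e2.
have i1 := cintbleZ (s%:C)%C mD (cintble_mono j k rge).
have i2 := cintbleZ (-1) mD (cintble_mono j.+1 k.+1 rge).
rewrite (cintD mD i1 i2) (cintZ _ mD (cintble_mono j k rge)) (cintZ _ mD (cintble_mono j.+1 k.+1 rge)).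
rewrite !cint_mono// eqSS doubleS; case: (j == k); last by rewrite !mul0r !mulr0 addr0.
rewrite !mul1r mulN1r -rmorphM -rmorphB; congr (_%:C)%C.
rewrite mulrBr; congr (_ - _); last exact: esym (mulrA _ _ _).
by rewrite -!mulrA mulrCA.
Qed.

Lemma coef_int (c : nat -> C) r k : growth c -> 0 < r -> r < 1 ->
  cint (disk r) (fun p => (conjc (zz p) : C) ^+ k * psum c (zz p)) =
  c k * ((A0 R * r ^+ k.*2.+2 / k.+1%:R)%:C)%C.
Proof.
move=> gc r0 r1; have rge := ltW r0.
have e j : cint (disk r) (fun p => (conjc (zz p) : C) ^+ k * zz p ^+ j) = cint (disk r) (mono j k).
  by apply: eq_cint => p _; rewrite mulrC.
rewrite (@coef_extract (disk r) (fun p => (conjc (zz p) : C) ^+ k) zz c (r ^+ k) r k).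
- by rewrite (e k) cint_mono// eqxx mul1r.
- exact: measurable_disk.
- exact: area_disk_lty.
- exact: CmeasX (CmeasCzz _).
- exact: Cmeas_zz.
- move=> p Dp; rewrite cabsX cabs_conj lerXn2r ?nnegrE ?cabs_ge0//; exact: zz_le.
- by move=> p; exact: zz_le.
- by [].
- by [].
- by [].
- by move=> j jk; rewrite e mom0.
Qed.

Lemma coef_int_wt (c : nat -> C) r k : growth c -> 0 < r -> r < 1 ->
  cint (disk r) (fun p => (wt 1 p * (conjc (zz p) : C) ^+ k) * psum c (zz p)) =
  c k * ((A0 R * (r ^+ k.*2.+2 / k.+1%:R - r ^+ k.*2.+4 / k.+2%:R))%:C)%C.
Proof.
move=> gc r0 r1; have rge := ltW r0.
have e j : cint (disk r) (fun p => (wt 1 p * (conjc (zz p) : C) ^+ k) * zz p ^+ j) =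
    cint (disk r) (fun p => wt 1 p * mono j k p).
  by apply: eq_cint => p _; rewrite /mono -mulrA; congr (_ * _); rewrite mulrC.
rewrite (@coef_extract (disk r) (fun p => wt 1 p * (conjc (zz p) : C) ^+ k) zz c (1 * r ^+ k) r k).
- by rewrite (e k) cint_wt_mono// eqxx !mul1r.
- exact: measurable_disk.
- exact: area_disk_lty.
- by apply: CmeasM; [exact: Cmeas_wt|exact: CmeasX (CmeasCzz _)].
- exact: Cmeas_zz.
- move=> p Dp; rewrite cabsM; apply: ler_pM; rewrite ?cabs_ge0//.
    by apply: wt_le Dp => //; rewrite exprn_ile1// ltW.
  by rewrite cabsX cabs_conj lerXn2r ?nnegrE ?cabs_ge0//; exact: zz_le.
- by move=> p; exact: zz_le.
- by [].
- by [].
- by [].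
- by move=> j jk; rewrite e cint_wt_mono// (negbTE jk) mul0r.
Qed.

(** Only even powers of |z| have been integrated, so |z|^k is replaced by |z|^(2 floor(k/2)); the
    resulting A0 / (floor(k/2) + 1) is at most 2 A0 / (k + 1). The decay in 1 / (k + 1) is what
    matters. *)
Lemma Iabs_pow (k : nat) : (Iabs D (fun p => zz p ^+ k)%R <= (2 * A0 R / k.+1%:R)%:E)%E.
Proof.
have mD := measurable_disk (1 : R).
have h p : D p -> cabs (zz p ^+ k) <= (p.1 ^+ 2 + p.2 ^+ 2) ^+ k./2.
  move=> Dp; rewrite -(cabs_cpt p.1 p.2) -exprM cabsX.
  apply: ler_wiXn2l; rewrite ?cabs_ge0//; first exact: zz_le ler01 Dp.
  by rewrite mul2n -{2}[k]odd_double_half leq_addl.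
apply: le_trans (Iabs_le mD (CmeasX k (Cmeas_zz D)) (@measurable_norm2X R _ k./2) h) _.
rewrite -JE JkE// expr1n mulr1 lee_fin ler_pdivrMr// mulrAC ler_pdivlMr//.
rewrite -[2 * _]mulrC -mulrA ler_wpM2l ?(ltW (A0_gt0 R))// -natrM ler_nat.
have := odd_double_half k; lia.
Qed.

End Coefficients.

(** * The spaces A^1 and B_0 *)

Section Spaces.
Variable R : realType.
Local Notation C := (R[i])^o.
Local Notation TR := (measurableTypeR R).
Local Notation T := (TR * TR)%type.
Local Notation zz := (@zz R).
Local Notation D := (@disk R 1).
Implicit Types (u v g h c : nat -> C).

Lemma cvgC_sum (F : nat -> nat -> C) (G : nat -> C) m :
  (forall k, F n k @[n --> \oo] --> G k) ->
  (\sum_(0 <= k < m) F n k) @[n --> \oo] --> \sum_(0 <= k < m) G k.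
Proof.
move=> h; elim: m => [|m IH].
  have -> : (fun n => \sum_(0 <= k < 0) F n k) = fun=> 0.
    by apply/funext => n; rewrite big_geq.
  by rewrite big_geq//; exact: cvg_cst.
have -> : (fun n => \sum_(0 <= k < m.+1) F n k) = fun n => (\sum_(0 <= k < m) F n k) + F n m.
  by apply/funext => n; rewrite big_nat_recr.
rewrite big_nat_recr; last by [].
by apply: cvgCD; [exact: IH|exact: h].
Qed.

(** Tannery's theorem: the majorant b makes the tails small uniformly in n, and the finitely many
    remaining terms converge one by one. *)
Lemma psum_tannery (d : nat -> nat -> C) (d0 b : nat -> C) z : growth b -> cabs z < 1 ->
  (forall n k, cabs (d n k) <= cabs (b k)) -> (forall k, d n k @[n --> \oo] --> d0 k) ->
  psum (d n) z @[n --> \oo] --> psum d0 z.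
Proof.
move=> gb z1 hb hd.
have hb0 k : cabs (d0 k) <= cabs (b k).
  by apply: (cvg_le_cabs (hd k)); apply: nearW => n.
have gd n : growth (d n) by apply: (growth_le (K := 1) gb) => k; rewrite mul1r.
have gd0 : growth d0 by apply: (growth_le (K := 1) gb) => k; rewrite mul1r.
have [B [t [t0 t1 hB]]] := growth_geom gb (cabs_ge0 z) z1.
have tail (c : nat -> C) m : (forall k, cabs (c k) <= cabs (b k)) ->
    cabs (psum c z - series (fun k => c k * z ^+ k) m) <= B / (1 - t) * t ^+ m.
  move=> hc; have gc : growth c by apply: (growth_le (K := 1) gb) => k; rewrite mul1r.
  have [l [sl hl]] : exists l, series (fun k => c k * z ^+ k) @ \oo --> l /\
      forall n, cabs (l - series (fun k => c k * z ^+ k) n) <= B / (1 - t) * t ^+ n.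
    apply: seriesC_abs => n m' nm; rewrite mulrAC -mulrA.
    have B0 : 0 <= B.
      by apply: le_trans (_ : cabs (b 0%N) <= _); rewrite ?cabs_ge0//; have := hB 0%N; rewrite !expr0 !mulr1.
    apply: le_trans (_ : B * \sum_(n <= k < m') t ^+ k <= _); last first.
      by rewrite ler_wpM2l// geometric_tail.
    rewrite mulr_sumr; apply: ler_sum => k _; rewrite cabsM cabsX.
    by apply: le_trans (hB k); rewrite ler_wpM2r// exprn_ge0// cabs_ge0.
  by rewrite (psum_eq sl).
apply/cvgC_lt => e e0.
have : (fun m => B / (1 - t) * t ^+ m) @ \oo --> 0.
  rewrite -[X in _ --> X](mulr0 (B / (1 - t))).
  by apply: cvgM; [exact: cvg_cst|apply: cvg_expr; rewrite ger0_norm].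
move=> /cvgrPdist_lt /(_ (e / 3)); rewrite divr_gt0// => /(_ isT) [m _ /(_ m (leqnn m))].
rewrite /= sub0r normrN => /(le_lt_trans (ler_norm _)) hm.
have hs : series (fun k => d n k * z ^+ k) m @[n --> \oo] --> series (fun k => d0 k * z ^+ k) m.
  have -> : (fun n => series (fun k => d n k * z ^+ k) m) =
      fun n => \sum_(0 <= k < m) d n k * z ^+ k.
    by apply/funext => n; rewrite seriesEnat.
  rewrite seriesEnat /=; apply: (cvgC_sum (F := fun n k => d n k * z ^+ k) (G := fun k => d0 k * z ^+ k)).
  by move=> k; apply: cvgCM; [exact: hd|exact: cvg_cst].
move/cvgC_lt: hs => /(_ (e / 3)); rewrite divr_gt0// => /(_ isT).
apply: filterS => n hn.
have e3 : psum (d n) z - psum d0 z = (psum (d n) z - series (fun k => d n k * z ^+ k) m) +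
  (series (fun k => d n k * z ^+ k) m - series (fun k => d0 k * z ^+ k) m) -
  (psum d0 z - series (fun k => d0 k * z ^+ k) m) by ring.
rewrite e3; apply: le_lt_trans (cabsB _ _) _.
apply: (@le_lt_trans _ _ (B / (1 - t) * t ^+ m + e / 3 + B / (1 - t) * t ^+ m)); last by lra.
apply: lerD; last exact: tail.
by apply: le_trans (cabsD _ _) _; apply: lerD; [exact: tail|exact: ltW].
Qed.

Lemma cauchyC (u : nat -> C) (e : nat -> R) : e @ \oo --> 0 ->
  (forall m p, (m <= p)%N -> cabs (u p - u m) <= e m) -> exists l : C, u @ \oo --> l.
Proof.
move=> e0 h.
have cv (f : nat -> R) : (forall m p, `|f p - f m| <= cabs (u p - u m)) -> cvgn f.
  move=> hf; apply/cauchy_cvgP/cauchy_exP => eps eps0.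
  have /cvgrPdist_lt /(_ _ eps0) [N _ hN] := e0.
  exists (f N); exists N => // p /= Np; rewrite /ball /= distrC.
  apply: le_lt_trans (hf N p) (le_lt_trans (h N p Np) _).
  by have := hN N (leqnn N); rewrite /= sub0r normrN => /(le_lt_trans (ler_norm _)).
have /cvg_ex[l hl] : cvgn (fun n => complex.Re (u n)).
  apply: cv => m p; apply: le_trans (Re_le_cabs _); rewrite -[complex.Re (u p) - _]/(complex.Re (u p) + - complex.Re (u m)).
  by case: (u p) (u m) => ? ? [].
have /cvg_ex[l' hl'] : cvgn (fun n => complex.Im (u n)).
  apply: cv => m p; apply: le_trans (Im_le_cabs _).
  by case: (u p) (u m) => ? ? [].
exists (cpt l l'); have -> : u = fun n => cpt (complex.Re (u n)) (complex.Im (u n)).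
  by apply/funext => n; case: (u n).
exact: cvg_cpt.
Qed.

Definition mon (m : nat) : nat -> C := fun k => (k == m)%:R.

Lemma growth_mon m : growth (mon m).
Proof.
by apply: (growth_bounded (B := 1)) => k; rewrite /mon; case: (k == m); rewrite ?cabs1 ?cabs0.
Qed.

Lemma psum_mon m z : psum (mon m) z = z ^+ m.
Proof.
have h : forall k, k != m -> mon m k * z ^+ k = 0.
  by move=> k km; rewrite /mon (negbTE km) mul0r.
apply: psum_eq; have := @coef_limit R (fun k => mon m k * z ^+ k) (fun=> 1) m h.
rewrite /mon eqxx !mul1r; under eq_fun do under eq_bigr do rewrite mul1r.
by rewrite seriesEnat.
Qed.

Definition onD u (p : T) : C := psum u (zz p).

Lemma A1_intE u : A1_int u = Iabs D (onD u). Proof. by []. Qed.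

Lemma Cmeas_onD u : growth u -> Cmeas D (onD u).
Proof.
move=> gu; apply: Cmeas_psum => //; first exact: Cmeas_zz.
by move=> p /(zz_disk _ ler01).
Qed.

Lemma A1_growth u : A1 u -> growth u. Proof. by move=> [/hol_growth]. Qed.

Lemma A1_norm u : A1 u -> A1_int u = (pi * A1norm u)%:E.
Proof.
move=> [_ h]; rewrite /A1norm mulrC divfK ?gt_eqF ?pi_gt0// fineK// ge0_fin_numE//.
exact: Iabs_ge0.
Qed.

Lemma A1norm_ge0 u : 0 <= A1norm u.
Proof. by rewrite divr_ge0 ?pi_ge0// fine_ge0//; exact: Iabs_ge0. Qed.

Lemma A1_le u M : growth u -> (Iabs D (onD u) <= (pi * M)%:E)%E -> A1 u /\ A1norm u <= M.
Proof.
move=> gu h; have h1 : A1 u.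
  by split; [exact/hol_growth|exact: le_lt_trans h (ltry _)].
split => //; move: h; rewrite -A1_intE (A1_norm h1) lee_fin.
by rewrite ler_pM2l// pi_gt0.
Qed.

Lemma A1_lin u v (al be : C) : A1 u -> A1 v ->
  A1 (fun k => al * u k + be * v k) /\
  A1norm (fun k => al * u k + be * v k) <= cabs al * A1norm u + cabs be * A1norm v.
Proof.
move=> hu hv; have gu := A1_growth hu; have gv := A1_growth hv.
apply: A1_le; first exact: growth_lin.
have mD := measurable_disk (1 : R).
have m1 := Cmeas_cabs (Cmeas_onD gu); have m2 := Cmeas_cabs (Cmeas_onD gv).
have m3 : measurable_fun D (fun p => cabs al * cabs (onD u p) + cabs be * cabs (onD v p)).
  by apply: measurable_funD; apply: measurable_funM => //; exact: measurable_cst.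
have key p : D p -> cabs (onD (fun k => al * u k + be * v k) p) <=
    cabs al * cabs (onD u p) + cabs be * cabs (onD v p).
  move=> /(zz_disk _ ler01) z1; rewrite /onD psum_lin// -!cabsM; exact: cabsD.
apply: le_trans (Iabs_le mD (Cmeas_onD (growth_lin al be gu gv)) m3 key) _.
under eq_integral do rewrite EFinD !EFinM.
rewrite ge0_integralD//=; last 4 first.
- by move=> p _; rewrite mule_ge0 ?lee_fin ?cabs_ge0.
- by apply/measurable_EFinP; apply: measurable_funM => //; exact: measurable_cst.
- by move=> p _; rewrite mule_ge0 ?lee_fin ?cabs_ge0.
- by apply/measurable_EFinP; apply: measurable_funM => //; exact: measurable_cst.
rewrite !ge0_integralZl ?lee_fin ?cabs_ge0//; last 4 first.
- exact/measurable_EFinP.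
- by move=> p _; rewrite lee_fin cabs_ge0.
- exact/measurable_EFinP.
- by move=> p _; rewrite lee_fin cabs_ge0.
rewrite -/(Iabs D (onD u)) -/(Iabs D (onD v)) -!A1_intE (A1_norm hu) (A1_norm hv).
rewrite -!EFinM -EFinD lee_fin mulrDr.
by rewrite (mulrCA pi (cabs al)) (mulrCA pi (cabs be)) lexx.
Qed.

End Spaces.

(** * Dilations, completeness and approximation in A^1 *)

Section Dilation.
Variable R : realType.
Local Notation C := (R[i])^o.
Local Notation TR := (measurableTypeR R).
Local Notation T := (TR * TR)%type.
Local Notation zz := (@zz R).
Local Notation D := (@disk R 1).
Implicit Types (u v g h c : nat -> C).

Definition dil (rho : R) u : nat -> C := fun k => u k * (rho%:C)%C ^+ k.

Lemma psum_dilE rho u z : psum (dil rho u) z = psum u ((rho%:C)%C * z).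
Proof. exact: psum_dil. Qed.

Lemma growth_dil rho u : 0 <= rho -> rho <= 1 -> growth u -> growth (dil rho u).
Proof. by move=> r0 r1; apply: growth_geo; rewrite cabs_real ger0_norm. Qed.

Lemma cabs_dil rho (z : C) : 0 <= rho -> cabs ((rho%:C)%C * z) = rho * cabs z.
Proof. by move=> r0; rewrite cabsM cabs_real ger0_norm. Qed.

Lemma psum_le r u : growth u -> 0 <= r -> r < 1 ->
  exists2 M, 0 <= M & forall z : C, cabs z <= r -> cabs (psum u z) <= M.
Proof.
move=> gu r0 r1; have [B [t [B0 t0 t1 h]]] := psum_series gu r0 r1.
exists B => // z zr; have [_ /(_ 0%N)] := h _ zr.
by rewrite seriesEnat/= big_geq// subr0 expr0 mulr1.
Qed.

Lemma psum_dil_le rho u : growth u -> 0 <= rho -> rho < 1 ->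
  exists2 M, 0 <= M & forall z : C, cabs z < 1 -> cabs (psum (dil rho u) z) <= M.
Proof.
move=> gu r0 r1; have [M M0 h] := psum_le gu r0 r1; exists M => // z z1.
by rewrite psum_dilE; apply: h; rewrite cabs_dil// ler_piMr// ltW.
Qed.

Lemma expr_sub1_le (rho : R) k : 0 <= rho -> rho <= 1 -> 1 - rho ^+ k <= k%:R * (1 - rho).
Proof.
move=> r0 r1; elim: k => [|k IH]; first by rewrite expr0 subrr mul0r.
have -> : 1 - rho ^+ k.+1 = (1 - rho ^+ k) * rho + (1 - rho) by rewrite exprSr; ring.
rewrite -natr1 [leRHS]mulrDl mul1r lerD2r; apply: le_trans _ IH.
by rewrite ler_piMr// subr_ge0 exprn_ile1.
Qed.

Lemma cabs_dist3 (x y a b : C) : cabs (x - y) <= cabs (x - b) + cabs (b - a) + cabs (y - a).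
Proof.
have -> : x - y = (x - b) + (b - a) - (y - a) by ring.
by apply: le_trans (cabsB _ _) _; rewrite lerD2r cabsD.
Qed.

(** Three thirds of eta: two uniform tails beyond a fixed index m, and a polynomial part whose k-th
    term moves by at most |u_k| k (1 - rho). *)
Lemma unif_dil u s eta : growth u -> 0 <= s -> s < 1 -> 0 < eta ->
  exists2 r0, 0 <= r0 < 1 & forall rho, r0 <= rho -> rho < 1 -> forall z : C, cabs z <= s ->
    cabs (psum u ((rho%:C)%C * z) - psum u z) <= eta.
Proof.
move=> gu s0 s1 eta0; have e3 : eta / 3 + eta / 3 + eta / 3 = eta by field.
have [B [t [B0 t0 t1 h]]] := psum_series gu s0 s1.
have : (fun m => B * t ^+ m) @ \oo --> 0.
  rewrite -[X in _ --> X](mulr0 B).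
  by apply: cvgM; [exact: cvg_cst|apply: cvg_expr; rewrite ger0_norm].
move=> /cvgrPdist_lt /(_ (eta / 3)); rewrite divr_gt0// => /(_ isT) [m _ /(_ m (leqnn m))].
rewrite /= sub0r normrN => /(le_lt_trans (ler_norm _)) hm.
pose K := \sum_(0 <= k < m) cabs (u k) * k%:R.
have K0 : 0 <= K by apply: sumr_ge0 => k _; rewrite mulr_ge0 ?cabs_ge0.
(* For rho >= [r0] the polynomial part moves by at most K (1 - rho) <= eta / 3; K + 1 avoids a
   division by zero, and the maximum with 0 keeps rho nonnegative. *)
pose r0 := Num.max 0 (1 - eta / (3 * (K + 1))).
have d0 : 0 < eta / (3 * (K + 1)) by rewrite divr_gt0// mulr_gt0// ltr_wpDl.
exists r0; first by rewrite /r0 le_max lexx /= gt_max ltr01 /= ltrBlDr ltrDl.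
move=> rho rr r1 z zs.
have rho0 : 0 <= rho by apply: le_trans rr; rewrite le_max lexx.
have rz : cabs ((rho%:C)%C * z) <= s.
  by rewrite cabs_dil//; apply: le_trans zs; rewrite ler_piMl ?cabs_ge0// ltW.
have [_ /(_ m) h1] := h _ zs; have [_ /(_ m) h2] := h _ rz.
have h3 : cabs (series (fun k => u k * ((rho%:C)%C * z) ^+ k) m - series (fun k => u k * z ^+ k) m) <= eta / 3.
  rewrite !seriesEnat/= -sumrB; apply: le_trans (cabs_sum _ _ _) _.
  apply: (@le_trans _ _ (K * (1 - rho))).
    rewrite /K mulr_suml; apply: ler_sum => k _.
    have -> : u k * ((rho%:C)%C * z) ^+ k - u k * z ^+ k = u k * z ^+ k * (((rho ^+ k - 1)%:C)%C).
      by rewrite rmorphB rmorphXn rmorph1 exprMn; ring.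
    rewrite !cabsM cabs_real -mulrA distrC ger0_norm; last by rewrite subr_ge0 exprn_ile1// ltW.
    rewrite -mulrA ler_wpM2l ?cabs_ge0// cabsX.
    apply: le_trans (expr_sub1_le k rho0 (ltW r1)).
    by rewrite ler_piMl ?subr_ge0 ?exprn_ile1 ?cabs_ge0//; [rewrite ltW|apply: le_trans zs (ltW s1)].
  have : 1 - eta / (3 * (K + 1)) <= rho by apply: le_trans rr; rewrite le_max lexx orbT.
  rewrite lerBlDr -lerBlDl => hr.
  apply: (@le_trans _ _ (K * (eta / (3 * (K + 1))))); first by rewrite ler_wpM2l.
  have K1 : 0 < K + 1 by rewrite ltr_wpDl.
  have -> : K * (eta / (3 * (K + 1))) = (eta / 3) * (K / (K + 1)).
    by field; rewrite gt_eqF.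
  by rewrite ler_piMr ?divr_ge0 ?(ltW eta0)// ler_pdivrMr// mul1r lerDl.
set a := series _ _ in h1 h3; set b := series _ _ in h2 h3.
apply: le_trans (cabs_dist3 _ _ a b) _.
rewrite -[X in _ <= X]e3.
apply: lerD; last by apply: le_trans h1 _; exact: ltW.
apply: lerD; last exact: h3.
by apply: le_trans h2 _; exact: ltW.
Qed.

Lemma Iabs_sub (E : set T) u (c : T -> C) : measurable E -> E `<=` D -> growth u ->
  Cmeas E c -> (forall p, E p -> cabs (c p) <= 1) ->
  (Iabs E (fun p => c p * psum u (zz p))%R <= A1_int u)%E.
Proof.
move=> mE ED gu mc hc; have mD := measurable_disk (1 : R).
have mu := Cmeas_onD gu.
have mu' : Cmeas E (fun p => psum u (zz p)) := Cmeas_S mD ED mu.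
apply: (@le_trans _ _ (\int[@area R]_(p in E) (cabs (onD u p))%:E)%E).
  apply: Iabs_le => //; first exact: CmeasM.
    exact: (Cmeas_cabs mu').
  by move=> p Ep; rewrite cabsM ler_piMl ?cabs_ge0// hc.
rewrite A1_intE /Iabs; apply: ge0_subset_integral => //.
- by apply/measurable_EFinP; exact: Cmeas_cabs.
- by move=> p _; rewrite lee_fin cabs_ge0.
Qed.

(** Integrating conj(z)^k u over a disk of radius r < 1 isolates u_k, and r then tends to 1. The
    bound grows linearly in k, exactly the rate at which the norm of z^k decays. *)
Lemma A1_coef u k : A1 u -> cabs (u k) * A0 R <= 2 * k.+1%:R * (pi * A1norm u).
Proof.
move=> hu; have gu := A1_growth hu.
apply: (@le_lim1 R k.*2.+2) => r r0 r1.
have rge := ltW r0.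
have mr : Cmeas (disk r) (fun p => (conjc (zz p) : C) ^+ k) by exact: (CmeasX k (@CmeasCzz R (disk r))).
have r1' : disk r `<=` D by apply: disk_sub => //; exact: ltW.
have hc p : disk r p -> cabs ((conjc (zz p) : C) ^+ k) <= 1.
  move=> Dp; rewrite cabsX cabs_conj exprn_ile1 ?cabs_ge0//.
  by apply: le_trans (zz_le rge Dp) (ltW r1).
have hI := Iabs_sub (measurable_disk r) r1' gu mr hc.
rewrite (A1_norm hu) in hI.
have mF : Cmeas (disk r) (fun p => (conjc (zz p) : C) ^+ k * psum u (zz p)).
  by apply: CmeasM => //; exact: Cmeas_S (measurable_disk 1) r1' (Cmeas_onD gu).
have := cint_le (measurable_disk r) mF hI.
rewrite (coef_int k gu r0 r1) cabsM cabs_real ger0_norm; last first.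
  apply: divr_ge0 => //; apply: mulr_ge0; [exact: ltW (A0_gt0 R)|exact: exprn_ge0].
rewrite mulrA ler_pdivrMr//.
have -> : r ^+ k.*2.+2 * (cabs (u k) * A0 R) = cabs (u k) * (A0 R * r ^+ k.*2.+2) by rewrite mulrC mulrA.
by rewrite (mulrAC 2).
Qed.

Lemma A1_mon k : A1 (mon R k) /\ A1norm (mon R k) <= 2 * A0 R / k.+1%:R / pi.
Proof.
apply: A1_le; first exact: growth_mon.
rewrite [pi * _]mulrC divfK ?gt_eqF ?pi_gt0//.
have -> : onD (mon R k) = fun p => zz p ^+ k by apply/funext => p; exact: psum_mon.
exact: Iabs_pow.
Qed.

Lemma psum_subE u v z : growth u -> growth v -> cabs z < 1 ->
  psum (fun k => u k - v k) z = psum u z - psum v z.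
Proof.
move=> gu gv z1; have := psum_lin 1 (-1) gu gv z1; rewrite mul1r mulN1r => <-.
by congr (psum _ z); apply/funext => k; rewrite mul1r mulN1r.
Qed.

Lemma A1_lin_sub u v : A1 u -> A1 v -> A1 (fun k => u k - v k).
Proof.
move=> hu hv; have [h _] := A1_lin 1 (-1) hu hv.
have -> : (fun k => u k - v k) = fun k => 1 * u k + (-1) * v k => //.
by apply/funext => k; rewrite mul1r mulN1r.
Qed.

(** By [A1_coef] the coefficients are Cauchy; let w be their limit. Coefficient bounds linear in k
    give pointwise convergence on the disk, and Fatou's lemma carries the norm estimates to w. *)
Lemma A1_complete (v : nat -> nat -> C) (e : nat -> R) : (forall m, A1 (v m)) -> e @ \oo --> 0 ->
  (forall m p, (m <= p)%N -> A1norm (fun k => v p k - v m k) <= e m) ->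
  exists w, A1 w /\ forall m, A1norm (fun k => w k - v m k) <= e m.
Proof.
move=> hv e0 he.
have e_ge0 m : 0 <= e m by apply: le_trans (he m m (leqnn m)); exact: A1norm_ge0.
pose K := 2 * pi / A0 R.
have K0 : 0 < K by rewrite divr_gt0 ?A0_gt0// mulr_gt0 ?pi_gt0.
have hk m p k : (m <= p)%N -> cabs (v p k - v m k) <= K * k.+1%:R * e m.
  move=> mp; have := A1_coef k (A1_lin_sub (hv p) (hv m)).
  rewrite -ler_pdivlMr ?A0_gt0// => /le_trans; apply.
  apply: (@le_trans _ _ (2 * k.+1%:R * (pi * e m) / A0 R)).
    rewrite ler_wpM2r ?invr_ge0 ?(ltW (A0_gt0 R))// ler_wpM2l// ler_wpM2l ?pi_ge0//; exact: he.
  have -> : 2 * k.+1%:R * (pi * e m) / A0 R = K * k.+1%:R * e m by rewrite /K; ring.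
  exact: lexx.
have /choice [w hw] k : exists l : C, v p k @[p --> \oo] --> l.
  apply: (cauchyC (e := fun m => K * k.+1%:R * e m)); last by move=> m p; exact: hk.
  by rewrite -[X in _ --> X](mulr0 (K * k.+1%:R)); apply: cvgM => //; exact: cvg_cst.
have hwk m k : cabs (w k - v m k) <= K * k.+1%:R * e m.
  apply: (cvg_le_cabs (f := fun p => v p k - v m k) (F := \oo)).
    by apply: cvgCD; [exact: hw|exact: cvg_cst].
  by exists m => // p /= mp; exact: hk.
have nn m k : 0 <= K * k.+1%:R * e m by apply: mulr_ge0 => //; apply: mulr_ge0 => //; exact: ltW.
have gb m : growth (fun k => (K * k.+1%:R * e m)%:C%C : C).
  apply: (growth_poly (c := fun=> 1) (K := K * e m)); first exact: growth_one.
  by move=> k; rewrite cabs_real cabs1 mulr1 ger0_norm// mulrAC.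
have gwv m : growth (fun k => w k - v m k).
  apply: (growth_le (K := 1) (gb m)) => k.
  by rewrite mul1r cabs_real ger0_norm.
have main m : A1 (fun k => w k - v m k) /\ A1norm (fun k => w k - v m k) <= e m.
  apply: A1_le; first exact: gwv.
  apply: (fatou_le (h := fun n p => cabs (onD (fun k => v (n + m)%N k - v m k) p))).
  - exact: measurable_disk.
  - move=> n; apply: Cmeas_cabs; apply: Cmeas_onD.
    exact: A1_growth (A1_lin_sub (hv _) (hv m)).
  - by move=> n p _; exact: cabs_ge0.
  - move=> p /(zz_disk _ ler01) z1; apply: cvg_cabs.
    apply: (psum_tannery (gb m) z1).
      move=> n k; rewrite (cabs_real (K * k.+1%:R * e m)) ger0_norm//.
      by apply: hk; exact: leq_addl.
    move=> k; apply: (cvgCD (f := fun n => v (n + m)%N k) (g := fun=> - v m k)); last exact: cvg_cst.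
    by rewrite (cvg_shiftn m (fun p => v p k)); exact: hw.
  - move=> n; have := A1_norm (A1_lin_sub (hv (n + m)%N) (hv m)); rewrite A1_intE /Iabs => ->.
    by rewrite lee_fin ler_wpM2l ?pi_ge0// he// leq_addl.
exists w; split; last by move=> m; case: (main m).
have [h _] := A1_lin 1 1 (main 0%N).1 (hv 0%N).
have -> : w = fun k => 1 * (w k - v 0%N k) + 1 * v 0%N k => //.
by apply/funext => k; rewrite !mul1r subrK.
Qed.

(** The part of |u| outside the disk of radius s, written as a function on the whole unit disk so
    that all integrals share one domain. *)
Definition tail u (s : R) (p : T) : R := cabs (onD u p) * (1 - \1_(disk s) p).

Lemma measurable_tail u s : growth u -> measurable_fun D (tail u s).
Proof.
move=> gu; apply: measurable_funM; first exact: Cmeas_cabs (Cmeas_onD gu).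
apply: measurable_funB; first exact: measurable_cst.
by apply: measurable_indic; exact: measurable_disk.
Qed.

Lemma tail_ge0 u s p : 0 <= tail u s p.
Proof.
by rewrite mulr_ge0 ?cabs_ge0// subr_ge0 indicE; case: (_ \in _).
Qed.

Lemma tail_le u s p : tail u s p <= cabs (onD u p).
Proof.
rewrite /tail ler_piMr ?cabs_ge0// lerBlDr lerDl indicE; exact: ler0n.
Qed.

(** Dominated convergence along radii tending to 1, with |u| itself as the dominating function. *)
Lemma tail_small u eps : A1 u -> 0 < eps -> exists2 s, 0 < s < 1 &
  (\int[@area R]_(p in D) (tail u s p)%:E <= eps%:E)%E.
Proof.
move=> hu eps0; have gu := A1_growth hu; have mD := measurable_disk (1 : R).
pose s n : R := 1 - n.+2%:R^-1.
have sn n : 0 < s n < 1.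
  rewrite /s subr_gt0 invf_lt1// ltr1n /= ltrBlDr ltrDl invr_gt0 ltr0n //.
have h0 : cint D (fun p => ((tail u (s n) p)%:C)%C : C) @[n --> \oo] --> cint D (fun=> (0 : C)).
  apply: (cint_dominated (g := fun p => cabs (onD u p))) => //.
  - by move=> n; apply: Cmeas_real; exact: measurable_tail.
  - move=> p /(zz_disk _ ler01) z1; apply/cvgC_lt => e e0; near=> n.
    rewrite /tail indicE mem_set ?subrr ?mulr0 ?subr0 ?cabs_real ?normr0//.
    have /andP[s0 _] := sn n; apply/(zz_disk _ (ltW s0)).
    rewrite /s ltrBrDr -ltrBrDl; near: n.
    have d0 : 0 < 1 - cabs (zz p) by rewrite subr_gt0.
    have := @near_infty_natSinv_lt R (PosNum d0); apply: filterS => n /= hn.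
    by apply: le_lt_trans hn; rewrite lef_pV2 ?posrE// ler_nat.
  - by move=> n p _; rewrite cabs_real ger0_norm ?tail_ge0// tail_le.
  - exact: Cmeas_cabs (Cmeas_onD gu).
  - by case: hu.
have h1 : complex.Re (cint D (fun p => ((tail u (s n) p)%:C)%C : C)) @[n --> \oo] -->
    complex.Re (cint D (fun=> (0 : C))) by exact: cvg_Re.
rewrite cint0 in h1.
move/cvgrPdist_lt: h1 => /(_ _ eps0) [N _ /(_ N (leqnn N))] /=.
rewrite sub0r normrN => /(le_lt_trans (ler_norm _)) h.
exists (s N) => //; move: h; rewrite /Rintegral /= => h.
have fin : (\int[@area R]_(p in D) (tail u (s N) p)%:E < +oo)%E.
  case: hu => _; apply: le_lt_trans; apply: ge0_le_integral => //.
  - by move=> p _; rewrite lee_fin tail_ge0.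
  - by apply/measurable_EFinP; exact: measurable_tail.
  - by apply/measurable_EFinP; exact: Cmeas_cabs (Cmeas_onD gu).
  - by move=> p _; rewrite lee_fin tail_le.
rewrite -[leLHS]fineK ?lee_fin ?ltW// ge0_fin_numE//.
by apply: integral_ge0 => p _; rewrite lee_fin tail_ge0.
Unshelve. all: by end_near. Qed.

Lemma tail_scale u rho s (p : T) : 0 < rho ->
  tail (dil rho u) s p = tail u (rho * s) (rho * p.1, rho * p.2).
Proof.
move=> r0; have e1 : zz (rho * p.1, rho * p.2) = (rho%:C)%C * zz p.
  by rewrite /zz /cpt /=; apply/eqP; rewrite eq_complex /=; apply/andP; split; apply/eqP; ring.
have e2 : \1_(disk (rho * s)) (rho * p.1, rho * p.2) = \1_(disk s) p :> R.
  have E : disk (rho * s) (rho * p.1, rho * p.2) <-> disk s p.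
    by rewrite /disk /= !exprMn -mulrDr ltr_pM2l ?exprn_gt0.
  rewrite !indicE; congr (_%:R); congr nat_of_bool.
  by apply/idP/idP; rewrite !inE => /E.
by rewrite /tail /onD e1 psum_dilE e2.
Qed.

(** Substituting rho z for z turns the tail of the dilation beyond s into that of u beyond rho s, so
    a tail estimate for u alone serves both. *)
Lemma tail_dil u rho s : growth u -> 0 < rho -> rho < 1 ->
  (\int[@area R]_(p in D) (tail (dil rho u) s p)%:E <=
   (rho^-1 ^+ 2)%:E * \int[@area R]_(p in D) (tail u (rho * s) p)%:E)%E.
Proof.
move=> gu r0 r1.
have rD : disk rho `<=` D by apply: disk_sub; exact: ltW.
have mt : measurable_fun (disk rho) (tail u (rho * s)).
  apply: measurable_funS (measurable_tail (rho * s) gu) => //; exact: measurable_disk.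
have := @scale_int R rho rho (tail u (rho * s)) r0 mt (fun p _ => tail_ge0 _ _ _).
rewrite divff ?gt_eqF// => e.
rewrite (eq_integral (fun p : T => (tail u (rho * s) (rho * p.1, rho * p.2)%R)%:E)); last first.
  by move=> p _; rewrite tail_scale.
rewrite e lee_pmul2l ?lte_fin ?exprn_gt0 ?invr_gt0//.
apply: ge0_subset_integral => //.
- exact: measurable_disk.
- exact: measurable_disk.
- by apply/measurable_EFinP; exact: measurable_tail.
- by move=> p _; rewrite lee_fin tail_ge0.
Qed.

(** Inside the disk of radius s the dilation is uniformly close to u; outside, the difference is
    bounded by the tails of u and of its dilation. *)
Lemma A1_dil_approx u eps : A1 u -> 0 < eps -> exists rho, [/\ 0 <= rho, rho < 1 &
  A1norm (fun k => u k - dil rho u k) <= eps].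
Proof.
move=> hu eps0; have gu := A1_growth hu; have mD := measurable_disk (1 : R).
have p0 := pi_gt0 R; have a0 := A0_gt0 R.
(* The integral of the difference is at most 6 d: one d for the inner disk, one for the tail of u,
   and 4 d for the tail of the dilation, as rho^-2 <= 4. *)
pose d := pi * eps / 6.
have d0 : 0 < d by rewrite /d divr_gt0// mulr_gt0.
have [s1 /andP[s10 s11] hs1] := tail_small hu d0.
have [s s1s /andP[s0 sl1]] := between s11.
pose eta := d / A0 R.
have eta0 : 0 < eta by rewrite divr_gt0.
have [r0 /andP[r00 r01] hr] := unif_dil gu (ltW s0) sl1 eta0.
(* The three lower bounds on rho serve, in turn, uniform closeness on |z| <= s, the inequality s1 <=
   rho s that makes the dilated tail small, and rho^-2 <= 4. *)
pose rho := Num.max (Num.max r0 (s1 / s)) (1 / 2).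
have rr0 : r0 <= rho by rewrite /rho !le_max lexx.
have rs : s1 <= rho * s by rewrite -ler_pdivrMr// /rho !le_max lexx orbT.
have r2 : 1 / 2 <= rho by rewrite /rho le_max lexx orbT.
have rho0 : 0 < rho by apply: lt_le_trans r2.
have rho1 : rho < 1 
  by rewrite /rho !gt_max r01 /=; apply/andP; split; [rewrite ltr_pdivrMr// mul1r|lra].
exists rho; split => //; first exact: ltW.
have gd := growth_dil (ltW rho0) (ltW rho1) gu.
have gs : growth (fun k => u k - dil rho u k).
  have := growth_lin 1 (-1) gu gd; congr growth; apply/funext => k; by rewrite mul1r mulN1r.
have tail_mono v a b p : 0 <= a -> a <= b -> tail v b p <= tail v a p.
  move=> ha ab; rewrite /tail ler_wpM2l ?cabs_ge0// lerD2l lerN2 !indicE.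
  case: (boolP (p \in disk a)) => [|_]; last exact: ler0n.
  by rewrite inE => /(disk_sub ha ab) h; rewrite mem_set.
have key p : D p -> cabs (onD (fun k => u k - dil rho u k) p) <=
    eta + (tail u s1 p + tail (dil rho u) s p).
  move=> Dp; have z1 : cabs (zz p) < 1 by exact/(zz_disk _ ler01).
  rewrite {1}/onD psum_subE// psum_dilE.
  have [ps|ps] := pselect (disk s p).
    rewrite cabsC; apply: le_trans (hr _ rr0 rho1 _ (zz_le (ltW s0) ps)) _.
    by rewrite lerDl addr_ge0// tail_ge0.
  apply: le_trans (cabsB _ _) _.
  apply: (@le_trans _ _ (tail u s p + tail (dil rho u) s p)).
    by rewrite /tail indicE memNset// subr0 !mulr1 /onD psum_dilE.
  apply: (@le_trans _ _ (tail u s1 p + tail (dil rho u) s p)); last by rewrite lerDr ltW.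
  by rewrite lerD2r tail_mono// ltW.
have mt1 := measurable_tail s1 gu; have mt2 := measurable_tail s gd.
apply: (A1_le _ _).2 => //.
apply: le_trans (Iabs_le mD (Cmeas_onD gs) _ key) _.
  by apply: measurable_funD; [exact: measurable_cst|exact: measurable_funD].
under eq_integral do rewrite !EFinD.
rewrite ge0_integralD//=; last 3 first.
- by move=> p _; rewrite lee_fin ltW.
- by move=> p _; rewrite adde_ge0 ?lee_fin ?tail_ge0.
- by apply: emeasurable_funD; exact/measurable_EFinP.
rewrite ge0_integralD//=; last 4 first.
- by move=> p _; rewrite lee_fin tail_ge0.
- exact/measurable_EFinP.
- by move=> p _; rewrite lee_fin tail_ge0.
- exact/measurable_EFinP.
have ea : (\int[@area R]_(_ in D) eta%:E = (eta * A0 R)%:E)%E.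
  rewrite integral_cst//; exact: etrans (congr1 (fun x => (eta%:E * x)%E) (A0E R)) (esym (EFinM _ _)).
rewrite ea.
have h2 : (\int[@area R]_(p in D) (tail (dil rho u) s p)%:E <= (4 * d)%:E)%E.
  apply: le_trans (tail_dil s gu rho0 rho1) _.
  apply: (@le_trans _ _ (4%:E * d%:E)%E); last by rewrite -EFinM.
  apply: lee_pmul.
  - by rewrite lee_fin exprn_ge0// invr_ge0 ltW.
  - by apply: integral_ge0 => p _; rewrite lee_fin tail_ge0.
  - rewrite lee_fin; have : rho^-1 <= 2 by rewrite -[2]invrK lef_pV2 ?posrE//; lra.
    by move=> h; rewrite (_ : 4 = 2 ^+ 2); [rewrite lerXn2r ?nnegrE// invr_ge0 ltW|ring].
  apply: le_trans hs1; apply: ge0_le_integral => //.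
  - by move=> p _; rewrite lee_fin tail_ge0.
  - by apply/measurable_EFinP; exact: measurable_tail.
  - by apply/measurable_EFinP.
  - by move=> p _; rewrite lee_fin tail_mono// ltW.
apply: (@le_trans _ _ ((eta * A0 R)%:E + (d%:E + (4 * d)%:E))%E).
  by apply: leeD => //; exact: leeD.
rewrite -!EFinD lee_fin /eta divfK ?gt_eqF// /d.
have -> : pi * eps / 6 + (pi * eps / 6 + 4 * (pi * eps / 6)) = pi * eps by field.
exact: lexx.
Qed.

End Dilation.

(** * The Bloch and little Bloch spaces *)

Section BlochSpace.
Variable R : realType.
Local Notation C := (R[i])^o.
Local Notation TR := (measurableTypeR R).
Local Notation T := (TR * TR)%type.
Local Notation zz := (@zz R).
Local Notation D := (@disk R 1).
Implicit Types (u v g h c : nat -> C).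

Definition bl u (z : C) : R := (1 - cabs z ^+ 2) * cabs (psum (deriv_coef u) z).

Lemma bl_ge0 u z : cabs z < 1 -> 0 <= bl u z.
Proof. by move=> z1; rewrite mulr_ge0 ?cabs_ge0// subr_ge0 exprn_ile1 ?cabs_ge0// ltW. Qed.

Lemma Bloch_growth u : Bloch u -> growth u. Proof. by move=> [/hol_growth]. Qed.

Lemma Bloch_bound u z : Bloch u -> cabs z < 1 -> bl u z + cabs (u 0%N) <= Blochnorm u.
Proof.
move=> [hu fu] z1; rewrite /Blochnorm psum0 addrC lerD2l.
have le : ((bl u z)%:E <= bloch_sup u)%E by apply: ereal_sup_ubound; exists z.
rewrite -lee_fin fineK// ge0_fin_numE//; apply: le_trans le.
by rewrite lee_fin bl_ge0.
Qed.

Lemma Blochnorm_le u M : growth u -> (forall z, cabs z < 1 -> bl u z <= M) ->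
  Bloch u /\ Blochnorm u <= cabs (u 0%N) + M.
Proof.
move=> gu h; have le : (bloch_sup u <= M%:E)%E.
  by apply: ge_ereal_sup => _ [z z1 <-]; rewrite lee_fin; exact: h.
have hb : Bloch u by split; [exact/hol_growth|exact: le_lt_trans le (ltry _)].
have z1 : cabs (0 : C) < 1 by rewrite cabs0.
split => //; rewrite /Blochnorm psum0 lerD2l -lee_fin fineK//.
rewrite ge0_fin_numE; first by case: hb.
apply: le_trans (_ : ((bl u 0)%:E <= _)%E); first by rewrite lee_fin bl_ge0.
by apply: ereal_sup_ubound; exists 0.
Qed.

Lemma Blochnorm_ge0 u : Bloch u -> 0 <= Blochnorm u.
Proof.
move=> hu; have z1 : cabs (0 : C) < 1 by rewrite cabs0.
by apply: le_trans (Bloch_bound hu z1); rewrite addr_ge0 ?bl_ge0 ?cabs_ge0.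
Qed.

Lemma Bloch_coef0 u : Bloch u -> cabs (u 0%N) <= Blochnorm u.
Proof.
move=> hu; have z1 : cabs (0 : C) < 1 by rewrite cabs0.
by apply: le_trans (Bloch_bound hu z1); rewrite lerDr bl_ge0.
Qed.

Lemma Bloch_bl u z : Bloch u -> cabs z < 1 -> bl u z <= Blochnorm u.
Proof. by move=> hu z1; apply: le_trans (Bloch_bound hu z1); rewrite lerDl cabs_ge0. Qed.

Lemma bl_lin u v (al be : C) z : growth u -> growth v -> cabs z < 1 ->
  bl (fun k => al * u k + be * v k) z <= cabs al * bl u z + cabs be * bl v z.
Proof.
move=> gu gv z1; rewrite /bl.
have -> : deriv_coef (fun k => al * u k + be * v k) =
    fun k => al * deriv_coef u k + be * deriv_coef v k.
  by apply/funext => k; rewrite /deriv_coef; ring.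
rewrite (psum_lin al be (growth_deriv gu) (growth_deriv gv) z1).
rewrite mulrCA (mulrCA (cabs be)) -mulrDr ler_wpM2l//.
  by rewrite subr_ge0 exprn_ile1 ?cabs_ge0// ltW.
by rewrite -!cabsM cabsD.
Qed.

Lemma Bloch_lin u v (al be : C) : Bloch u -> Bloch v ->
  Bloch (fun k => al * u k + be * v k) /\
  Blochnorm (fun k => al * u k + be * v k) <= cabs al * Blochnorm u + cabs be * Blochnorm v.
Proof.
move=> hu hv; have gu := Bloch_growth hu; have gv := Bloch_growth hv.
have gw := growth_lin al be gu gv.
pose M := cabs al * (Blochnorm u - cabs (u 0%N)) + cabs be * (Blochnorm v - cabs (v 0%N)).
have [] := @Blochnorm_le (fun k => al * u k + be * v k) M gw.
  move=> z z1; apply: le_trans (bl_lin al be gu gv z1) _.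
  by apply: lerD; rewrite ler_wpM2l ?cabs_ge0// lerBrDr; exact: Bloch_bound.
move=> h1 h2; split => //; apply: le_trans h2 _.
apply: (@le_trans _ _ (cabs al * cabs (u 0%N) + cabs be * cabs (v 0%N) + M)).
  by rewrite lerD2r -!cabsM cabsD.
have -> : cabs al * cabs (u 0%N) + cabs be * cabs (v 0%N) + M =
  cabs al * Blochnorm u + cabs be * Blochnorm v by rewrite /M; ring.
exact: lexx.
Qed.

(** Integrate (1 - |z|^2) conj(z)^k u'. The weight bounds the integrand by the Bloch norm times
    |z|^k, whose integral is O(1 / (k + 1)), while orthogonality produces the coefficient times A0 /
    ((k + 1)(k + 2)) in the limit r = 1. *)
Lemma Bloch_deriv_coef u k : Bloch u -> cabs (deriv_coef u k) <= 4 * k.+2%:R * Blochnorm u.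
Proof.
move=> hu; have gu := growth_deriv (Bloch_growth hu).
have a0 := A0_gt0 R; have N0 := Blochnorm_ge0 hu.
have key : cabs (deriv_coef u k) * A0 R / (k.+1%:R * k.+2%:R) <=
    2 * (Blochnorm u * (2 * A0 R / k.+1%:R)).
  apply: (@le_lim1 R k.*2.+2) => r r0 r1; have rge := ltW r0.
  have mD := measurable_disk r.
  have r1' : disk r `<=` D by apply: disk_sub => //; exact: ltW.
  have mF : Cmeas (disk r) (fun p => (wt 1 p * (conjc (zz p) : C) ^+ k) * psum (deriv_coef u) (zz p)).
    apply: CmeasM; first by apply: CmeasM; [exact: Cmeas_wt|exact: (CmeasX k (@CmeasCzz R (disk r)))].
    exact: Cmeas_S (measurable_disk 1) r1' (Cmeas_onD gu).
  have mP : measurable_fun D (fun p => Blochnorm u * cabs (zz p ^+ k)).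
    apply: measurable_funM; first exact: measurable_cst.
    exact: Cmeas_cabs (CmeasX k (Cmeas_zz D)).
  have mP' : measurable_fun (disk r) (fun p => Blochnorm u * cabs (zz p ^+ k)).
    apply: measurable_funS mP => //; exact: measurable_disk.
  have hF p : disk r p -> cabs ((wt 1 p * (conjc (zz p) : C) ^+ k) * psum (deriv_coef u) (zz p)) <=
      Blochnorm u * cabs (zz p ^+ k).
    move=> Dp; have z1 : cabs (zz p) < 1 by apply/(zz_disk _ ler01); exact: r1'.
    rewrite cabsM [cabs (wt 1 p * _)]cabsM mulrAC !cabsX cabs_conj ler_wpM2r ?exprn_ge0 ?cabs_ge0//.
    apply: le_trans (Bloch_bl hu z1); rewrite /bl /wt cabs_real -(cabs_cpt p.1 p.2) ger0_norm//.
    by rewrite subr_ge0 exprn_ile1 ?cabs_ge0// ltW.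
  have hI : (Iabs (disk r) (fun p => (wt 1 p * (conjc (zz p) : C) ^+ k) * psum (deriv_coef u) (zz p))%R
      <= (Blochnorm u * (2 * A0 R / k.+1%:R))%:E)%E.
    apply: le_trans (Iabs_le mD mF mP' hF) _.
    apply: (@le_trans _ _ (\int[@area R]_(p in D) (Blochnorm u * cabs (zz p ^+ k))%:E)%E).
      apply: ge0_subset_integral => //.
      - exact: measurable_disk.
      - exact/measurable_EFinP.
      - by move=> p _; rewrite lee_fin mulr_ge0 ?cabs_ge0.
    under eq_integral do rewrite EFinM.
    rewrite ge0_integralZl//=; last 3 first.
    - exact: measurable_disk.
    - by apply/measurable_EFinP; exact: Cmeas_cabs (CmeasX k (Cmeas_zz D)).
    - by move=> p _; rewrite lee_fin cabs_ge0.
    by rewrite EFinM; apply: lee_wpmul2l; [rewrite lee_fin|exact: Iabs_pow].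
  have := cint_le mD mF hI; rewrite (coef_int_wt k gu r0 r1) cabsM cabs_real => h.
  apply: le_trans h.
  have -> : r ^+ k.*2.+2 * (cabs (deriv_coef u k) * A0 R / (k.+1%:R * k.+2%:R)) =
    cabs (deriv_coef u k) * (A0 R * (r ^+ k.*2.+2 / (k.+1%:R * k.+2%:R))).
    by move: (cabs _) (r ^+ _) (A0 R) (k.+1%:R * k.+2%:R) => x y z q; ring.
  rewrite ler_wpM2l ?cabs_ge0//; apply: le_trans (ler_norm _).
  rewrite ler_wpM2l ?(ltW a0)//.
  have -> : r ^+ k.*2.+2 / (k.+1%:R * k.+2%:R) = r ^+ k.*2.+2 / k.+1%:R - r ^+ k.*2.+2 / k.+2%:R.
    rewrite -mulrBr; congr (_ * _); rewrite -[k.+2%:R]natr1.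
    by have := ltr0Sn R k; move: (k.+1%:R) => n n0; field; rewrite !gt_eqF// ltr_wpDr// ltW.
  rewrite lerD2l lerN2 ler_wpM2r ?invr_ge0//.
  by apply: ler_wiXn2l; rewrite ?ltW// ltnW.
move: key; rewrite ler_pdivrMr ?mulr_gt0 ?ltr0n//.
have -> : 2 * (Blochnorm u * (2 * A0 R / k.+1%:R)) * (k.+1%:R * k.+2%:R) =
  4 * k.+2%:R * Blochnorm u * A0 R.
  have := ltr0Sn R k; move: (k.+1%:R) (k.+2%:R) => n m n0; field; by rewrite gt_eqF.
by rewrite ler_pM2r.
Qed.

(** The linear growth of the coefficients of u' cancels against the factor k + 1 of differentiation;
    8 comes from 4 (k + 2) <= 8 (k + 1). *)
Lemma Bloch_coef u k : Bloch u -> cabs (u k) <= 8 * Blochnorm u.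
Proof.
move=> hu; have N0 := Blochnorm_ge0 hu.
case: k => [|k]; first by apply: le_trans (Bloch_coef0 hu) _; rewrite ler_peMl// ler1n.
have := Bloch_deriv_coef k hu; rewrite /deriv_coef cabsM cabs_nat => h.
rewrite -(@ler_pM2l _ k.+1%:R) ?ltr0n//; apply: le_trans h _.
by rewrite [leRHS]mulrA ler_wpM2r// -!natrM ler_nat; lia.
Qed.

(** If u' is bounded by M, the weighted derivative is at most M (1 - |z|^2), which tends to 0 at the
    boundary. Monomials and dilations enter B_0 this way. *)
Lemma Bloch_bdd u M : growth u -> (forall z, cabs z < 1 -> cabs (psum (deriv_coef u) z) <= M) ->
  Bloch0 u.
Proof.
move=> gu h; have M0 : 0 <= M.
  by apply: le_trans (h 0 _); rewrite ?cabs0 ?cabs_ge0.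
have le z : cabs z < 1 -> bl u z <= (1 - cabs z ^+ 2) * M.
  move=> z1; rewrite /bl ler_wpM2l ?h// subr_ge0 exprn_ile1 ?cabs_ge0// ltW//.
split.
  apply: (Blochnorm_le (M := M) gu _).1 => z z1; apply: le_trans (le z z1) _.
  by rewrite ler_piMl// lerBlDr lerDl sqr_ge0.
move=> eps eps0; exists (1 - eps / (2 * (M + 1))).
have d0 : 0 < eps / (2 * (M + 1)) by rewrite divr_gt0// mulr_gt0// ltr_wpDl.
split; first by rewrite ltrBlDr ltrDl.
move=> z zr z1; apply: le_lt_trans (le z z1) _.
have z0 := cabs_ge0 z.
have h1 : 1 - cabs z ^+ 2 <= 2 * (1 - cabs z) by nra.
have h2 : 1 - cabs z < eps / (2 * (M + 1)) by rewrite ltrBlDr addrC -ltrBlDr.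
have h3 : 2 * (1 - cabs z) * (M + 1) < eps.
  have M1 : 0 < 2 * (M + 1) by rewrite mulr_gt0// ltr_wpDl.
  by rewrite mulrAC -ltr_pdivlMl// mulrC.
apply: le_lt_trans h3; apply: ler_pM => //; first by rewrite subr_ge0 exprn_ile1// ltW.
by rewrite lerDl.
Qed.

Lemma deriv_mon k : deriv_coef (mon R k.+1) = fun j => k.+1%:R * mon R k j.
Proof.
apply/funext => j; rewrite /deriv_coef /mon eqSS.
by case: eqVneq => [->//|_]; rewrite !mulr0.
Qed.

Lemma deriv_mon0 : deriv_coef (mon R 0) = fun=> 0.
Proof. by apply/funext => j; rewrite /deriv_coef /mon /= mulr0. Qed.

Lemma psum_zero (z : C) : psum (fun=> 0) z = 0.
Proof.
apply: psum_eq; rewrite (_ : series _ = fun=> 0); first exact: cvg_cst.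
by apply/funext => n; rewrite seriesEnat/= big1// => k _; rewrite mul0r.
Qed.

Lemma psum_scale (c : C) u z : growth u -> cabs z < 1 ->
  psum (fun k => c * u k) z = c * psum u z.
Proof.
move=> gu z1; have := psum_lin c 0 gu gu z1; rewrite mul0r addr0 => <-.
by congr (psum _ z); apply/funext => k; rewrite mul0r addr0.
Qed.

Lemma psum_deriv_mon k z : cabs z < 1 ->
  psum (deriv_coef (mon R k.+1)) z = k.+1%:R * z ^+ k.
Proof. by move=> z1; rewrite deriv_mon (psum_scale _ (growth_mon k) z1) psum_mon. Qed.

(** With x = |z|, (k + 1) x^k is at most 1 + x + ... + x^k <= 1 / (1 - x), so (1 - x^2)(k + 1) x^k
    <= 1 + x <= 2. The bound is uniform in k, to match the bounded coefficients of Bloch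
    functions. *)
Lemma Bloch_mon k : Bloch0 (mon R k) /\ Blochnorm (mon R k) <= 3.
Proof.
case: k => [|k].
  split.
    apply: (Bloch_bdd (M := 0)); first exact: growth_mon.
    by move=> z z1; rewrite deriv_mon0 psum_zero cabs0.
  have [] := @Blochnorm_le (mon R 0) 0 (growth_mon 0).
    by move=> z z1; rewrite /bl deriv_mon0 psum_zero cabs0 mulr0.
  have -> : mon R 0 0 = 1 by [].
  by move=> _ /le_trans; apply; rewrite addr0 cabs1 ler1n.
split.
  apply: (Bloch_bdd (M := k.+1%:R)); first exact: growth_mon.
  move=> z z1; rewrite psum_deriv_mon// cabsM cabs_nat cabsX.
  by rewrite ler_piMr// exprn_ile1 ?cabs_ge0// ltW.
have [] := @Blochnorm_le (mon R k.+1) 2 (growth_mon k.+1).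
  move=> z z1; rewrite /bl psum_deriv_mon// cabsM cabs_nat cabsX.
  have z0 := cabs_ge0 z; move: (cabs z) z0 z1 => x x0 x1.
  have s : k.+1%:R * x ^+ k <= \sum_(0 <= i < k.+1) x ^+ i.
    rewrite mulr_natl -[X in _ *+ X]subn0 -sumr_const_nat big_nat [leRHS]big_nat.
    by apply: ler_sum => i /andP[_ ik]; apply: ler_wiXn2l => //; exact: ltW.
  have := geometric_tail 0 k.+1 x0 x1; rewrite expr0 ler_pdivlMr ?subr_gt0// => h.
  have y0 : 0 <= k.+1%:R * x ^+ k by rewrite mulr_ge0// exprn_ge0.
  move: (k.+1%:R * x ^+ k) (\sum_(0 <= i < k.+1) x ^+ i) s h y0 => y S s h y0.
  have w1 : (1 - x) * y <= 1.
    by apply: le_trans h; rewrite mulrC ler_wpM2r// subr_ge0 ltW.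
  have -> : (1 - x ^+ 2) * y = (1 + x) * ((1 - x) * y) by ring.
  have w0 : 0 <= (1 - x) * y by rewrite mulr_ge0// subr_ge0 ltW.
  move: ((1 - x) * y) w0 w1 => w w0 w1; nra.
have -> : mon R k.+1 0 = 0 by [].
by move=> _ /le_trans; apply; rewrite cabs0 add0r ler_nat.
Qed.

Lemma Bloch0_growth u : Bloch0 u -> growth u.
Proof. by move=> [/Bloch_growth]. Qed.

Lemma Bloch0_lin u v (al be : C) : Bloch0 u -> Bloch0 v ->
  Bloch0 (fun k => al * u k + be * v k).
Proof.
move=> [hu hu'] [hv hv']; split; first exact: (Bloch_lin al be hu hv).1.
move=> eps eps0; have gu := Bloch_growth hu; have gv := Bloch_growth hv.
pose K := cabs al + cabs be + 1.
have K0 : 0 < K by rewrite ltr_wpDl// addr_ge0 ?cabs_ge0.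
have d0 : 0 < eps / K by rewrite divr_gt0.
have [r [r1 hr]] := hu' _ d0; have [s [s1 hs]] := hv' _ d0.
exists (Num.max r s); split; first by rewrite gt_max r1.
move=> z; rewrite gt_max => /andP[rz sz] z1.
apply: le_lt_trans (bl_lin al be gu gv z1) _.
have h1 := ltW (hr z rz z1); have h2 := ltW (hs z sz z1).
apply: (@le_lt_trans _ _ (cabs al * (eps / K) + cabs be * (eps / K))).
  by apply: lerD; rewrite ler_wpM2l ?cabs_ge0.
rewrite -mulrDl mulrA ltr_pdivrMr// mulrC ltr_pM2l//.
by rewrite /K ltrDl.
Qed.

Lemma deriv_dil rho u : deriv_coef (dil rho u) = fun k => (rho%:C)%C * dil rho (deriv_coef u) k.
Proof. by apply/funext => k; rewrite /deriv_coef /dil exprS; ring. Qed.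

Lemma psum_deriv_dil rho u z : growth u -> 0 <= rho -> rho <= 1 -> cabs z < 1 ->
  psum (deriv_coef (dil rho u)) z = (rho%:C)%C * psum (deriv_coef u) ((rho%:C)%C * z).
Proof.
move=> gu r0 r1 z1; rewrite deriv_dil (psum_scale _ (growth_dil r0 r1 (growth_deriv gu)) z1).
by rewrite psum_dilE.
Qed.

Lemma Bloch0_dil rho u : growth u -> 0 <= rho -> rho < 1 -> Bloch0 (dil rho u).
Proof.
move=> gu r0 r1; have [M M0 hM] := psum_dil_le (growth_deriv gu) r0 r1.
apply: (Bloch_bdd (M := M)); first exact: growth_dil r0 (ltW r1) gu.
move=> z z1; rewrite (psum_deriv_dil gu r0 (ltW r1) z1) cabsM cabs_real ger0_norm// -psum_dilE.
by apply: le_trans (hM z z1); rewrite ler_piMl ?cabs_ge0// ltW.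
Qed.

Lemma deriv_sub u v : deriv_coef (fun k => u k - v k) = fun k => deriv_coef u k - deriv_coef v k.
Proof. by apply/funext => k; rewrite /deriv_coef mulrBr. Qed.

Lemma Bloch0_lin_sub u v : Bloch0 u -> Bloch0 v -> Bloch0 (fun k => u k - v k).
Proof.
move=> hu hv; have h := Bloch0_lin 1 (-1) hu hv.
have -> : (fun k => u k - v k) = fun k => 1 * u k + (-1) * v k by apply/funext => k; rewrite mul1r mulN1r.
exact: h.
Qed.

Lemma dil_split (x y : C) (r : R) :
  x - (r%:C)%C * y = ((1 - r)%:C)%C * x - (r%:C)%C * (y - x).
Proof. by rewrite rmorphB rmorph1; ring. Qed.

(** The little-o condition governs the boundary region: for |z| > s both z and rho z lie where the
    weighted derivative is below eps / 4. On |z| <= s, [dil_split] separates the error (1 - rho) u'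
    from the uniform error of dilating u'. *)
Lemma Bloch0_dil_approx u eps : Bloch0 u -> 0 < eps -> exists rho, [/\ 0 <= rho, rho < 1 &
  Blochnorm (fun k => u k - dil rho u k) <= eps].
Proof.
move=> hu eps0; have gu := Bloch0_growth hu; have gdu := growth_deriv gu.
have d0 : 0 < eps / 4 by rewrite divr_gt0.
have e2 : eps / 4 + eps / 4 <= eps by lra.
have [s1 [s11 hs1]] := hu.2 _ d0.
have [s s1s /andP[s0 sl1]] := between s11.
have [r0 /andP[r00 r01] hr] := unif_dil gdu (ltW s0) sl1 d0.
have [M M0 hM] := psum_le gdu (ltW s0) sl1.
pose t := 1 - eps / (4 * (M + 1)).
have dt : 0 < eps / (4 * (M + 1)) by rewrite divr_gt0// mulr_gt0// ltr_wpDl.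
pose rho := Num.max (Num.max r0 t) (Num.max (1 / 2) (s1 / s)).
have rr0 : r0 <= rho by rewrite /rho !le_max lexx.
have rt : t <= rho by rewrite /rho !le_max lexx orbT.
have rho2 : 0 < rho by apply: (@lt_le_trans _ _ (1 / 2)) => //; rewrite /rho !le_max lexx !orbT.
have rho0 := ltW rho2.
have rs : s1 <= rho * s by rewrite -ler_pdivrMr// /rho !le_max lexx !orbT.
have rho1 : rho < 1.
  rewrite /rho !gt_max r01 /=; apply/andP; split; first by rewrite /t ltrBlDr ltrDl.
  by apply/andP; split; [lra|rewrite ltr_pdivrMr// mul1r].
clearbody rho; exists rho; split => //.
have hd := Bloch0_dil gu rho0 rho1.
have gs := Bloch0_growth (Bloch0_lin_sub hu hd).
have [] := @Blochnorm_le (fun k => u k - dil rho u k) eps gs; last first.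
  by move=> _ /le_trans; apply; rewrite /dil expr0 mulr1 subrr cabs0 add0r.
move=> z z1; rewrite /bl deriv_sub psum_subE//; last first.
  exact: growth_deriv (growth_dil rho0 (ltW rho1) gu).
rewrite psum_deriv_dil//; last exact: ltW.
have w0 : 0 <= 1 - cabs z ^+ 2 by rewrite subr_ge0 exprn_ile1 ?cabs_ge0// ltW.
have w1 : 1 - cabs z ^+ 2 <= 1 by rewrite lerBlDr lerDl sqr_ge0.
have [zs|zs] := leP (cabs z) s.
  apply: (@le_trans _ _ (1 * (eps / 4 + eps / 4))); last by rewrite mul1r.
  apply: ler_pM; rewrite ?cabs_ge0//.
  have -> : psum (deriv_coef u) z - (rho%:C)%C * psum (deriv_coef u) ((rho%:C)%C * z) =
     ((1 - rho)%:C)%C * psum (deriv_coef u) z -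
     (rho%:C)%C * (psum (deriv_coef u) ((rho%:C)%C * z) - psum (deriv_coef u) z).
    exact: dil_split.
  apply: le_trans (cabsB _ _) _; rewrite !cabsM !cabs_real !ger0_norm ?subr_ge0 ?(ltW rho1)//.
  apply: lerD.
    apply: (@le_trans _ _ (eps / (4 * (M + 1)) * (M + 1))).
      apply: ler_pM; rewrite ?cabs_ge0 ?subr_ge0 ?(ltW rho1)//.
        by rewrite lerBlDr -lerBlDl.
      by apply: le_trans (hM z zs) _; rewrite lerDl.
    have M1 : 0 < M + 1 by rewrite ltr_wpDl.
    have -> : eps / (4 * (M + 1)) * (M + 1) = eps / 4 by field; rewrite gt_eqF.
    exact: lexx.
  apply: le_trans (hr rho rr0 rho1 z zs); rewrite ler_piMl ?cabs_ge0//; exact: ltW.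
have hrz : cabs ((rho%:C)%C * z) = rho * cabs z by exact: cabs_dil.
have rz1 : cabs ((rho%:C)%C * z) < 1.
  by rewrite hrz; apply: le_lt_trans z1; rewrite ler_piMl ?cabs_ge0// ltW.
have s1z : s1 < cabs z by exact: lt_trans s1s zs.
have s1rz : s1 < cabs ((rho%:C)%C * z).
  by rewrite hrz; apply: le_lt_trans rs _; rewrite ltr_pM2l.
have h1 := hs1 z s1z z1; have h2 := hs1 _ s1rz rz1.
apply: le_trans _ e2; apply: le_trans _ (ltW (ltrD h1 h2)).
apply: (@le_trans _ _ ((1 - cabs z ^+ 2) * (cabs (psum (deriv_coef u) z) + cabs (psum (deriv_coef u) ((rho%:C)%C * z))))).
  rewrite ler_wpM2l//; apply: le_trans (cabsB _ _) _; rewrite lerD2l cabsM cabs_real ger0_norm//.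
  by rewrite ler_piMl ?cabs_ge0// ltW.
rewrite mulrDr lerD2l ler_wpM2r ?cabs_ge0// lerD2l lerN2 hrz exprMn ler_piMl ?sqr_ge0//.
by rewrite exprn_ile1// ltW.
Qed.

(** Coefficients converge by [Bloch_coef], and the norm estimates pass to the limit pointwise. The
    boundary condition survives since the weighted derivatives converge uniformly, with eps split in
    two. *)
Lemma Bloch0_complete (v : nat -> nat -> C) (e : nat -> R) : (forall m, Bloch0 (v m)) ->
  e @ \oo --> 0 ->
  (forall m p, (m <= p)%N -> Blochnorm (fun k => v p k - v m k) <= e m) ->
  exists w, Bloch0 w /\ forall m, Blochnorm (fun k => w k - v m k) <= e m.
Proof.
move=> hv e0 he.
have hvs p m := Bloch0_lin_sub (hv p) (hv m).
have e_ge0 m : 0 <= e m by apply: le_trans (he m m (leqnn m)); exact: Blochnorm_ge0 (hvs m m).1.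
have hk m p k : (m <= p)%N -> cabs (v p k - v m k) <= 8 * e m.
  move=> mp; apply: le_trans (Bloch_coef k (hvs p m).1) _.
  by rewrite ler_wpM2l// he.
have /choice [w hw] k : exists l : C, v p k @[p --> \oo] --> l.
  apply: (cauchyC (e := fun m => 8 * e m)); last by move=> m p; exact: hk.
  by rewrite -[X in _ --> X](mulr0 8); apply: cvgM => //; exact: cvg_cst.
have cvm m k : v (n + m)%N k - v m k @[n --> \oo] --> w k - v m k.
  apply: (cvgCD (f := fun n => v (n + m)%N k) (g := fun=> - v m k)); last exact: cvg_cst.
  by rewrite (cvg_shiftn m (fun p => v p k)); exact: hw.
have hwk m k : cabs (w k - v m k) <= 8 * e m.
  apply: (cvg_le_cabs (cvm m k)); apply: nearW => n.
  by apply: hk; exact: leq_addl.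
have gwv m : growth (fun k => w k - v m k) by exact: growth_bounded (hwk m).
have gb m : growth (fun k => ((8 * e m * k.+1%:R)%:C)%C : C).
  apply: (growth_poly (c := fun=> 1) (K := 8 * e m)); first exact: growth_one.
  by move=> k; rewrite cabs_real cabs1 mulr1 ger0_norm// mulr_ge0// mulr_ge0.
(* The value at 0 and the weighted derivative are kept in one inequality; bounding each by [e m]
   would only give [2 * e m] for the norm of the limit. *)
have hbl m z : cabs z < 1 -> bl (fun k => w k - v m k) z <= e m - cabs (w 0%N - v m 0%N).
  move=> z1; rewrite /bl lerBrDr addrC.
  have c1 : psum (deriv_coef (fun k => v (n + m)%N k - v m k)) z @[n --> \oo] -->
      psum (deriv_coef (fun k => w k - v m k)) z.
    apply: (psum_tannery (gb m) z1).
      move=> n k; rewrite /deriv_coef cabsM cabs_nat (cabs_real (8 * e m * k.+1%:R)) ger0_norm.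
        by rewrite mulrC ler_wpM2r// hk// leq_addl.
      by rewrite mulr_ge0// mulr_ge0.
    by move=> k; apply: cvgCM; [exact: cvg_cst|exact: cvm].
  have c2 : cabs (v (n + m)%N 0%N - v m 0%N) + (1 - cabs z ^+ 2) *
      cabs (psum (deriv_coef (fun k => v (n + m)%N k - v m k)) z) @[n --> \oo] -->
      cabs (w 0%N - v m 0%N) + (1 - cabs z ^+ 2) * cabs (psum (deriv_coef (fun k => w k - v m k)) z).
    apply: cvgD; first by apply: cvg_cabs; exact: cvm.
    by apply: cvgM; [exact: cvg_cst|apply: cvg_cabs; exact: c1].
  rewrite -(cvg_lim _ c2)//; apply: limr_le; first by apply/cvg_ex; eexists; exact: c2.
  apply: nearW => n; apply: le_trans (he m (n + m)%N (leq_addl _ _)).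
  by rewrite addrC; exact: Bloch_bound (hvs _ _).1 z1.
have main m := Blochnorm_le (gwv m) (hbl m).
have main2 m : Blochnorm (fun k => w k - v m k) <= e m.
  by apply: le_trans (main m).2 _; rewrite addrC subrK.
exists w; split=> //.
have we m : w = fun k => 1 * (w k - v m k) + 1 * v m k.
  by apply/funext => k; rewrite !mul1r subrK.
split; first by rewrite (we 0%N); exact: (Bloch_lin 1 1 (main 0%N).1 (hv 0%N).1).1.
move=> eps eps0.
have d0 : 0 < eps / 2 by rewrite divr_gt0.
have /cvgrPdist_lt /(_ _ d0) [m _ /(_ m (leqnn m))] := e0.
rewrite /= sub0r normrN => /(le_lt_trans (ler_norm _)) em.
have [r [r1 hr]] := (hv m).2 _ d0.
exists r; split => // z rz z1.
have h1 := Bloch_bl (main m).1 z1; have h2 := hr z rz z1.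
rewrite (we m); apply: le_lt_trans (bl_lin 1 1 (gwv m) (Bloch0_growth (hv m)) z1) _.
rewrite cabs1 !mul1r; rewrite -/(bl (v m) z) in h2.
have h3 := main2 m.
have : bl (fun k => w k - v m k) z <= e m by exact: le_trans h1 h3.
move: (bl (fun k => w k - v m k) z) (bl (v m) z) h2 => x y h2 h4; clear -em h2 h4.
by rewrite [ltRHS](splitr eps); apply: ltrD => //; exact: le_lt_trans em.
Qed.

End BlochSpace.
(** * The duality pairing *)

Section Pairing.
Variable R : realType.
Local Notation C := (R[i])^o.
Local Notation TR := (measurableTypeR R).
Local Notation T := (TR * TR)%type.
Local Notation zz := (@zz R).
Local Notation D := (@disk R 1).
Implicit Types (u v g h c : nat -> C).

Definition pair_at g h (r : R) : C := ((pi^-1)%:C)%C *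
  cint (disk r) (fun p => psum g (zz p) * psum h (conjc (zz p))).

Lemma pairingE g h : pairing g h = lim (pair_at g h @ (1 : R)^'-). Proof. by []. Qed.

Definition pterm g h (r : R) k : C := g k * (h k * ((A0 R * r ^+ k.*2.+2 / k.+1%:R)%:C)%C).

Lemma growth_le_at g r : growth g -> 0 < r -> r < 1 ->
  exists M, forall p, disk r p -> cabs (psum g (conjc (zz p) : C)) <= M.
Proof.
move=> gg r0 r1; have [M M0 h] := psum_le gg (ltW r0) r1; exists M => p Dp.
by apply: h; rewrite cabs_conj; exact: zz_le (ltW r0) Dp.
Qed.

Lemma cint_mulC (E : set T) (F G : T -> C) : cint E (fun p => F p * G p) = cint E (fun p => G p * F p).
Proof. by apply: eq_cint => p _; exact: mulrC. Qed.

(** Both functions are expanded, one after the other, and only the diagonal moments survive. The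
    pairing on a disk thus depends on the products g_k h_k alone. *)
Lemma pair_series g h r : growth g -> growth h -> 0 < r -> r < 1 ->
  series (pterm g h r) @ \oo --> cint (disk r) (fun p => psum g (zz p) * psum h (conjc (zz p))).
Proof.
move=> gg gh r0 r1; have rge := ltW r0.
have mD := measurable_disk r; have fD := area_disk_lty r.
have [M hM] := growth_le_at gh r0 r1.
have mc : Cmeas (disk r) (fun p => conjc (zz p) : C) := @CmeasCzz R (disk r).
have hc p : disk r p -> cabs (conjc (zz p) : C) <= r by move=> Dp; rewrite cabs_conj; exact: zz_le.
have mh : Cmeas (disk r) (fun p => psum h (conjc (zz p) : C)).
  by apply: (Cmeas_psum gh mc) => p Dp; apply: le_lt_trans (hc p Dp) r1.
have h1 := cint_series mD fD mh (Cmeas_zz (disk r)) hM (fun p => @zz_le R r p rge) rge r1 gg.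
rewrite (cint_mulC (disk r) (fun p => psum h (conjc (zz p))) (fun p => psum g (zz p))) in h1.
have e k : cint (disk r) (fun p => psum h (conjc (zz p)) * zz p ^+ k) =
    h k * ((A0 R * r ^+ k.*2.+2 / k.+1%:R)%:C)%C.
  rewrite (cint_mulC (disk r) (fun p => psum h (conjc (zz p))) (fun p => zz p ^+ k)).
  have h0 j : j != k -> cint (disk r) (fun p => zz p ^+ k * (conjc (zz p) : C) ^+ j) = 0.
    by move=> jk; apply: (mom0 rge); rewrite eq_sym.
  have hb p : disk r p -> cabs (zz p ^+ k) <= r ^+ k.
    by move=> Dp; rewrite cabsX lerXn2r ?nnegrE ?cabs_ge0//; exact: zz_le.
  have h2 := coef_extract mD fD (CmeasX k (Cmeas_zz (disk r))) mc hb hc rge r1 gh h0.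
  apply: etrans h2 _; congr (_ * _).
  by apply: etrans (cint_mono k k r0) _; rewrite eqxx mul1r.
have -> : series (pterm g h r) = fun n => \sum_(0 <= k < n) g k * cint (disk r) (fun p => psum h (conjc (zz p)) * zz p ^+ k).
  by apply/funext => n; rewrite seriesEnat /=; apply: eq_bigr => k _; rewrite e.
exact: h1.
Qed.

(** The coefficients of z h'(z) + 2 h(z). The factor k + 2 undoes the weight 1 - |z|^2, whose k-th
    moment is A0 / ((k + 1)(k + 2)) instead of A0 / (k + 1). *)
Definition wc h k : C := (k + 2)%:R * h k.

Lemma growth_wc h : growth h -> growth (wc h).
Proof.
move=> gh; apply: (growth_poly (K := 2) gh) => k.
rewrite cabsM cabs_nat ler_wpM2r ?cabs_ge0// -natrM ler_nat; lia.
Qed.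

(* Replacing h by sum (k + 2) h_k z^k costs one factor (1 - |z|^2)^-1, which the
   weight r - |z|^2 compensates: the integrand becomes dominated by |g|. *)
Lemma pair_int_weighted g h r : growth g -> growth h -> 0 < r -> r < 1 ->
  cint (disk r) (fun p => psum g (zz p) * psum h (conjc (zz p))) =
  cint (disk (Num.sqrt r)) (fun p => (wt r p * psum (wc h) ((r%:C)%C * conjc (zz p))) * psum g (zz p)).
Proof.
move=> gg gh r0 r1; apply: (limC_unique (pair_series gg gh r0 r1)).
(* On the disk of radius sqrt r the weight r - |z|^2 has k-th moment A0 r^(k+2) / ((k + 1)(k + 2)).
   The dilation by r contributes r^k and [wc] contributes k + 2, which gives exactly A0 r^(2k+2) /
   (k + 1). *)
set s := Num.sqrt r.
have s0 : 0 < s by rewrite sqrtr_gt0.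
have sr : s ^+ 2 = r by rewrite sqr_sqrtr// ltW.
have s1 : s < 1 by rewrite -(@expr_lt1 _ 2)// ?ltW// sr.
have sge := ltW s0; have gw := growth_wc gh.
have mD := measurable_disk s; have fD := area_disk_lty s.
have mc : Cmeas (disk s) (fun p => (r%:C)%C * (conjc (zz p) : C)).
  by apply: CmeasM; [exact: Cmeas_cst|exact: (@CmeasCzz R (disk s))].
have hc p : disk s p -> cabs ((r%:C)%C * (conjc (zz p) : C)) <= s.
  move=> Dp; rewrite (cabs_dil _ (ltW r0)) cabs_conj; apply: le_trans (zz_le sge Dp).
  by rewrite ler_piMl ?cabs_ge0// ltW.
have [M M0 hM] := psum_le gw sge s1.
have mw : Cmeas (disk s) (fun p => psum (wc h) ((r%:C)%C * (conjc (zz p) : C))).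
  by apply: (Cmeas_psum gw mc) => p Dp; apply: le_lt_trans (hc p Dp) s1.
have mphi : Cmeas (disk s) (fun p => wt r p * psum (wc h) ((r%:C)%C * (conjc (zz p) : C))).
  by apply: CmeasM => //; exact: Cmeas_wt.
have wb p : disk s p -> cabs (wt r p) <= r by apply: wt_le => //; rewrite sr.
have hphi p : disk s p -> cabs (wt r p * psum (wc h) ((r%:C)%C * (conjc (zz p) : C))) <= r * M.
  by move=> Dp; rewrite cabsM; apply: ler_pM; rewrite ?cabs_ge0 ?wb//; apply: hM; exact: hc.
have h1 := cint_series mD fD mphi (Cmeas_zz (disk s)) hphi (fun p => @zz_le R s p sge) sge s1 gg.
have e k : cint (disk s) (fun p => (wt r p * psum (wc h) ((r%:C)%C * (conjc (zz p) : C))) * zz p ^+ k) =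
    h k * ((A0 R * r ^+ k.*2.+2 / k.+1%:R)%:C)%C.
  transitivity (cint (disk s) (fun p => (wt r p * zz p ^+ k) * psum (wc h) ((r%:C)%C * (conjc (zz p) : C)))).
    by apply: eq_cint => p _; exact: mulrAC.
  have ej j : cint (disk s) (fun p => (wt r p * zz p ^+ k) * ((r%:C)%C * (conjc (zz p) : C)) ^+ j) =
      ((r ^+ j)%:C)%C * cint (disk s) (fun p => wt r p * mono k j p).
    have ib : cintble (disk s) (fun p => wt r p * mono k j p).
      apply: (cintble_bounded (M := r * s ^+ (k + j))) => //.
        by apply: CmeasM; [exact: Cmeas_wt|exact: Cmeas_mono].
      move=> p Dp; rewrite cabsM; apply: ler_pM; rewrite ?cabs_ge0 ?wb//; exact: mono_le.
    apply: etrans _ (cintZ _ mD ib); apply: eq_cint => p _.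
    by rewrite exprMn rmorphXn /mono !mulrA; congr (_ * _); rewrite mulrC mulrA.
  have h0 j : j != k -> cint (disk s) (fun p => (wt r p * zz p ^+ k) * ((r%:C)%C * (conjc (zz p) : C)) ^+ j) = 0.
    by move=> jk; rewrite ej (cint_wt_mono _ _ _ s0) eq_sym (negbTE jk) mul0r mulr0.
  have hb p : disk s p -> cabs (wt r p * zz p ^+ k) <= r * s ^+ k.
    move=> Dp; rewrite cabsM cabsX; apply: ler_pM; rewrite ?cabs_ge0 ?exprn_ge0 ?cabs_ge0 ?wb//.
    by rewrite lerXn2r ?nnegrE ?cabs_ge0//; exact: zz_le.
  have mb : Cmeas (disk s) (fun p => wt r p * zz p ^+ k).
    by apply: CmeasM; [exact: Cmeas_wt|exact: CmeasX (Cmeas_zz (disk s))].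
  have h2 := coef_extract mD fD mb mc hb hc sge s1 gw h0.
  apply: etrans h2 _; rewrite ej (cint_wt_mono _ _ _ s0) eqxx mul1r /wc.
  rewrite (mulrC (k + 2)%:R) -[LHS]mulrA; congr (_ * _).
  have -> : ((k + 2)%:R : C) = ((k.+2%:R : R)%:C)%C by rewrite addn2 rmorph_nat.
  rewrite -!rmorphM; congr (_%:C)%C.
  have -> : s ^+ k.*2.+2 = r ^+ k.+1 by rewrite -sr -exprM mul2n doubleS.
  have -> : s ^+ k.*2.+4 = r ^+ k.+2 by rewrite -sr -exprM mul2n !doubleS.
  have -> : r ^+ k.*2.+2 = r ^+ k * (r ^+ k.+2) by rewrite -exprD; congr (_ ^+ _); lia.
  have -> : r * r ^+ k.+1 = r ^+ k.+2 by rewrite -exprS.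
  rewrite -[k.+2%:R]natr1; have := ltr0Sn R k.
  move: (k.+1%:R) (r ^+ k) (r ^+ k.+2) => n X Y n0; field.
  by rewrite !gt_eqF// ltr_wpDr// ltW.
have -> : series (pterm g h r) = fun n => \sum_(0 <= k < n) g k *
    cint (disk s) (fun p => (wt r p * psum (wc h) ((r%:C)%C * (conjc (zz p) : C))) * zz p ^+ k).
  by apply/funext => n; rewrite seriesEnat /=; apply: eq_bigr => k _; rewrite e.
exact: h1.
Qed.

(** 33 = 1 + 2 * 16: the term z h' costs one Bloch norm, and each h costs 16, from |h| <= 8 N / (1 -
    |v|) with N the Bloch norm and 1 - |v|^2 <= 2 (1 - |v|). *)
Lemma Bloch_wc_bound h (v : C) : Bloch h -> cabs v < 1 ->
  (1 - cabs v ^+ 2) * cabs (psum (wc h) v) <= 33 * Blochnorm h.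
Proof.
move=> hh v1; have gh := Bloch_growth hh; have N0 := Blochnorm_ge0 hh.
have gk : growth (fun k => k%:R * h k).
  apply: (growth_poly (K := 1) gh) => k; rewrite cabsM cabs_nat mul1r.
  by rewrite ler_wpM2r ?cabs_ge0// ler_nat.
have -> : psum (wc h) v = v * psum (deriv_coef h) v + 2 * psum h v.
  rewrite -(psum_deriv gh v1) -[psum (fun k => k%:R * h k) v]mul1r -(psum_lin 1 2 gk gh v1).
  by congr (psum _ v); apply/funext => k; rewrite /wc natrD; ring.
have c := psum_bounded (fun k => Bloch_coef k hh) v1.
have d := Bloch_bl hh v1; rewrite /bl in d.
have v0 := cabs_ge0 v.
have w0 : 0 <= 1 - cabs v ^+ 2 by rewrite subr_ge0 exprn_ile1// ltW.
apply: le_trans (_ : (1 - cabs v ^+ 2) * cabs (psum (deriv_coef h) v) +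
   2 * ((1 - cabs v ^+ 2) * cabs (psum h v)) <= _).
  rewrite mulrCA -mulrDr ler_wpM2l//; apply: le_trans (cabsD _ _) _.
  rewrite !cabsM (cabs_nat _ 2) lerD2r ler_piMl ?cabs_ge0// ltW//.
have e : (1 - cabs v ^+ 2) * cabs (psum h v) <= 16 * Blochnorm h.
  move: c; rewrite ler_pdivlMr ?subr_gt0// => c.
  have -> : 1 - cabs v ^+ 2 = (1 - cabs v) * (1 + cabs v) by ring.
  rewrite mulrAC (mulrC _ (1 + _)).
  have x0 : 0 <= (1 - cabs v) * cabs (psum h v) by rewrite mulr_ge0 ?cabs_ge0// subr_ge0 ltW.
  rewrite mulrC in c; move: ((1 - cabs v) * cabs (psum h v)) x0 c => X X0 c.
  move: (cabs v) v0 v1 => x x0 x1; move: (Blochnorm h) N0 c => N N0 c; nra.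
by move: (_ * cabs (psum (deriv_coef h) v)) (_ * cabs (psum h v)) (Blochnorm h) d e => X Y N d e; lra.
Qed.

(** The truncated weight is smaller than the Bloch weight at the dilated point, r - |z|^2 <= 1 - r^2
    |z|^2, so the bound is uniform in r. *)
Lemma weight_bound h r p : Bloch h -> 0 <= r -> r <= 1 -> disk (Num.sqrt r) p -> D p ->
  cabs (wt r p * psum (wc h) ((r%:C)%C * (conjc (zz p) : C))) <= 33 * Blochnorm h.
Proof.
move=> hh r0 r1 Dp D1; rewrite cabsM.
have z1 : cabs (zz p) < 1 by exact/(zz_disk _ ler01).
have e : cabs ((r%:C)%C * (conjc (zz p) : C)) = r * cabs (zz p) by rewrite cabs_dil// cabs_conj.
have rz1 : cabs ((r%:C)%C * (conjc (zz p) : C)) < 1.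
  by rewrite e; apply: le_lt_trans z1; rewrite ler_piMl ?cabs_ge0.
apply: le_trans (Bloch_wc_bound hh rz1); rewrite ler_wpM2r ?cabs_ge0// e /wt cabs_real -(cabs_cpt p.1 p.2).
rewrite ger0_norm; last first.
  rewrite subr_ge0; apply: ltW; rewrite (cabs_cpt p.1 p.2); move: Dp.
  by rewrite /disk /= sqr_sqrtr.
rewrite -/(zz p) exprMn; have x0 := sqr_ge0 (cabs (zz p)).
have r2 : 0 <= 1 - r ^+ 2 by rewrite subr_ge0 exprn_ile1.
have := mulr_ge0 x0 r2; move: (cabs (zz p) ^+ 2) (r ^+ 2) => x s; rewrite mulrBr mulr1 => h1.
lra.
Qed.

Lemma cvg_realC (f : nat -> R) (l : R) : f @ \oo --> l -> (((f n)%:C)%C : C) @[n --> \oo] --> ((l%:C)%C : C).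
Proof. by move=> h; apply: (cvg_cpt (g := fun=> 0)) => //; exact: cvg_cst. Qed.

Lemma cvgCX (f : nat -> C) (l : C) k : f @ \oo --> l -> (f n ^+ k) @[n --> \oo] --> l ^+ k.
Proof.
move=> h; elim: k => [|k IH]; first exact: cvg_cst.
have -> : (fun n => f n ^+ k.+1) = fun n => f n * f n ^+ k by apply/funext => n; rewrite exprS.
by rewrite exprS; exact: cvgCM.
Qed.

Lemma psum_dil_cvg c (r : nat -> R) (z : C) : growth c -> cabs z < 1 -> (forall n, 0 <= r n <= 1) ->
  r @ \oo --> (1 : R) -> psum c (((r n)%:C)%C * z) @[n --> \oo] --> psum c z.
Proof.
move=> gc z1 hr r1.
have -> : (fun n => psum c (((r n)%:C)%C * z)) = fun n => psum (dil (r n) c) z.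
  by apply/funext => n; rewrite psum_dilE.
apply: (psum_tannery gc z1).
  move=> n k; have /andP[a b] := hr n; rewrite /dil cabsM cabsX cabs_real ger0_norm//.
  by rewrite ler_piMr ?cabs_ge0// exprn_ile1.
move=> k; rewrite /dil -[X in _ --> X]mulr1.
apply: cvgCM; first exact: cvg_cst.
rewrite -[X in _ --> X](expr1n _ k); apply: cvgCX.
exact: (cvg_realC r1).
Qed.

Lemma cint_indic (E : set T) (F : T -> C) : E `<=` D ->
  cint D (fun p => ((\1_E p)%:C)%C * F p) = cint E F.
Proof.
move=> ED; have h (f : T -> R) : Rintegral (@area R) D (fun p => \1_E p * f p) = Rintegral (@area R) E f.
  rewrite -[in RHS](setIidr ED) Rintegral_mkcondr; apply: eq_Rintegral => p _.
  by rewrite /patch indicE; case: (p \in E); rewrite ?mul1r ?mul0r.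
rewrite /cint -(h (fun p => complex.Re (F p))) -(h (fun p => complex.Im (F p))).
congr cpt; apply: eq_Rintegral => p _.
  by rewrite ReM /= mul0r subr0.
by rewrite ImM /= mul0r addr0.
Qed.

End Pairing.

(** * Existence, bounds and algebra of the limit pairing *)

Section PairingLimit.
Variable R : realType.
Local Notation C := (R[i])^o.
Local Notation TR := (measurableTypeR R).
Local Notation T := (TR * TR)%type.
Local Notation zz := (@zz R).
Local Notation D := (@disk R 1).
Implicit Types (u v g h c : nat -> C).

Lemma cvg_at_left1 (f : R -> C) (l : C) :
  (forall u : R^nat, (forall n, u n < 1) -> u @ \oo --> (1 : R) -> f (u n) @[n --> \oo] --> l) ->
  f x @[x --> (1 : R)^'-] --> l.
Proof.
move=> h.
have hr : complex.Re (f x) @[x --> (1 : R)^'-] --> complex.Re l.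
  by apply/cvg_at_leftP => u [u1 uc]; have h1 : complex.Re (f (u n)) @[n --> \oo] --> complex.Re l by (apply: cvg_Re; exact: h).
have hi : complex.Im (f x) @[x --> (1 : R)^'-] --> complex.Im l.
  by apply/cvg_at_leftP => u [u1 uc]; have h1 : complex.Im (f (u n)) @[n --> \oo] --> complex.Im l by (apply: cvg_Im; exact: h).
apply/cvgC_lt => e e0; have e2 : 0 < e / 2 by rewrite divr_gt0.
move/cvgrPdist_lt: hr => /(_ _ e2) hr; move/cvgrPdist_lt: hi => /(_ _ e2) hi.
near=> x; apply: le_lt_trans (cabs_le_ReIm _) _; rewrite [ltRHS](splitr e).
have e1 : complex.Re (f x - l) = complex.Re (f x) - complex.Re l by case: (f x) (l) => ? ? [].
have e3 : complex.Im (f x - l) = complex.Im (f x) - complex.Im l by case: (f x) (l) => ? ? [].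
rewrite e1 e3; apply: ltrD; rewrite distrC.
  by near: x; exact: hr.
by near: x; exact: hi.
Unshelve. all: by end_near. Qed.

(** The pairing as one absolutely convergent integral over the whole disk, which supplies both the
    existence of the limit and its bound. *)
Definition lim_pair g h : C := ((pi^-1)%:C)%C *
  cint D (fun p => (wt 1 p * psum (wc h) (conjc (zz p))) * onD g p).

Lemma disk_sqrt_sub (r : R) : r <= 1 -> disk (Num.sqrt r) `<=` D.
Proof. by move=> r1; apply: disk_sub; rewrite ?sqrtr_ge0// -(sqrtr1 R) ler_wsqrtr. Qed.

(** In the weighted form the integrands, extended by 0 to the unit disk, are dominated by a constant
    times |g|, so dominated convergence applies. *)
Lemma pair_at_cvg (g h : nat -> C) (r : nat -> R) : A1 g -> Bloch h ->
  (forall n, 0 < r n < 1) -> r @ \oo --> (1 : R) -> pair_at g h (r n) @[n --> \oo] --> lim_pair g h.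
Proof.
move=> hg hh hr r1; have gg := A1_growth hg; have gh := Bloch_growth hh.
have gw := growth_wc gh; have mD := measurable_disk (1 : R).
have N0 := Blochnorm_ge0 hh.
pose H n (p : T) : C := ((\1_(disk (Num.sqrt (r n))) p)%:C)%C *
  ((wt (r n) p * psum (wc h) (((r n)%:C)%C * conjc (zz p))) * onD g p).
have hc p (t : R) : 0 <= t <= 1 -> D p -> cabs ((t%:C)%C * (conjc (zz p) : C)) < 1.
  move=> /andP[t0 t1] /(zz_disk _ ler01) z1; rewrite cabs_dil// cabs_conj.
  by apply: le_lt_trans z1; rewrite ler_piMl ?cabs_ge0.
have hr' n : 0 <= r n <= 1 by have /andP[a b] := hr n; rewrite !ltW.
have c1 : cint D (H n) @[n --> \oo] --> cint D (fun p => (wt 1 p * psum (wc h) (conjc (zz p))) * onD g p).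
  apply: (cint_dominated (g := fun p => (33 * Blochnorm h) * cabs (onD g p))) => //.
  - move=> n; apply: CmeasM.
      apply: Cmeas_real; apply: measurable_indic; exact: measurable_disk.
    apply: CmeasM (Cmeas_onD gg); apply: CmeasM; first exact: Cmeas_wt.
    apply: (Cmeas_psum gw); last by move=> p Dp; exact: hc.
    by apply: CmeasM; [exact: Cmeas_cst|exact: CmeasCzz].
  - move=> p Dp; have z1 : cabs (zz p) < 1 by exact/(zz_disk _ ler01).
    rewrite -[X in _ --> X]mul1r; apply: cvgCM.
      apply: (cvg_realC (l := 1)); apply: cvg_near_cst.
      have lt : p.1 ^+ 2 + p.2 ^+ 2 < 1 by move: Dp; rewrite /disk /= expr1n.
      have := r1; move/cvgr_gt => /(_ _ lt); apply: filterS => n hn.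
      rewrite indicE mem_set// /disk /= sqr_sqrtr//; by have /andP[] := hr' n.
    apply: cvgCM; last exact: cvg_cst.
    apply: cvgCM; last first.
      by apply: (psum_dil_cvg gw) => //; rewrite cabs_conj.
    apply: cvg_realC; apply: cvgB => //; exact: cvg_cst.
  - move=> n p Dp; rewrite /H cabsM cabs_real indicE.
    case: (boolP (p \in _)) => [/set_mem Dn|_].
      rewrite normr1 mul1r cabsM ler_wpM2r ?cabs_ge0//.
      by have /andP[a b] := hr' n; exact: weight_bound.
    by rewrite normr0 mul0r mulr_ge0 ?cabs_ge0// mulr_ge0.
  - by apply: measurable_funM; [exact: measurable_cst|exact: Cmeas_cabs (Cmeas_onD gg)].
  under eq_integral do rewrite EFinM.
  rewrite ge0_integralZl ?lee_fin ?mulr_ge0//.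
  - rewrite -/(Iabs D (onD g)) -A1_intE (A1_norm hg) -EFinM; exact: ltry.
  - by apply/measurable_EFinP; exact: Cmeas_cabs (Cmeas_onD gg).
  - by move=> p _; rewrite lee_fin cabs_ge0.
have e n : pair_at g h (r n) = ((pi^-1)%:C)%C * cint D (H n).
  have /andP[a b] := hr n; rewrite /pair_at; congr (_ * _).
  apply: etrans (pair_int_weighted gg gh a b) _.
  by apply: esym; apply: cint_indic; exact: disk_sqrt_sub (ltW b).
have -> : (fun n => pair_at g h (r n)) = fun n => ((pi^-1)%:C)%C * cint D (H n) by apply/funext.
by apply: cvgCM; [exact: cvg_cst|exact: c1].
Qed.

Lemma pairing_cvg g h : A1 g -> Bloch h -> pair_at g h @ (1 : R)^'- --> lim_pair g h.
Proof.
move=> hg hh; apply: cvg_at_left1 => u u1 uc.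
(* A sequence tending to 1 may start with nonpositive terms; the maximum with 1/2 changes only
   finitely many of them. *)
pose r n := Num.max (u n) (1 / 2).
have rc : r @ \oo --> (1 : R).
  have lt : (1 / 2 : R) < 1 by lra.
  apply: (cvg_trans _ uc); apply: near_eq_cvg.
  have := uc; move/cvgr_gt => /(_ _ lt); apply: filterS => n hn.
  by rewrite /r max_l// ltW.
have hr n : 0 < r n < 1.
  rewrite /r gt_max lt_max u1 /=; apply/andP; split; [apply/orP; right|]; lra.
have c := pair_at_cvg hg hh hr rc.
apply: cvg_trans c; apply: near_eq_cvg.
have lt : (1 / 2 : R) < 1 by lra.
have := uc; move/cvgr_gt => /(_ _ lt); apply: filterS => n hn.
by rewrite /r max_l// ltW.
Qed.

Lemma pairing_lim g h : A1 g -> Bloch h -> pairing g h = lim_pair g h.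
Proof. by move=> hg hh; rewrite pairingE; exact: limC (pairing_cvg hg hh). Qed.

(** 66 = 2 * 33, the 2 being the loss in [cint_le]. *)
Lemma pairing_le g h : A1 g -> Bloch h -> cabs (pairing g h) <= 66 * A1norm g * Blochnorm h.
Proof.
move=> hg hh; rewrite (pairing_lim hg hh) /lim_pair cabsM cabs_real.
have gg := A1_growth hg; have gh := Bloch_growth hh; have gw := growth_wc gh.
have mD := measurable_disk (1 : R); have N0 := Blochnorm_ge0 hh.
have m1 : Cmeas D (fun p => (wt 1 p * psum (wc h) (conjc (zz p) : C)) * onD g p).
  apply: CmeasM (Cmeas_onD gg); apply: CmeasM; first exact: Cmeas_wt.
  apply: (Cmeas_psum gw); first exact: CmeasCzz.
  by move=> p Dp; rewrite cabs_conj; exact/(zz_disk _ ler01).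
have b : (Iabs D (fun p => (wt 1 p * psum (wc h) (conjc (zz p) : C)) * onD g p)%R <=
    (33 * Blochnorm h * (pi * A1norm g))%:E)%E.
  have m2 : measurable_fun D (fun p => (33 * Blochnorm h) * cabs (onD g p)).
    by apply: measurable_funM; [exact: measurable_cst|exact: Cmeas_cabs (Cmeas_onD gg)].
  apply: le_trans (Iabs_le mD m1 m2 _) _.
    move=> p Dp; rewrite cabsM ler_wpM2r ?cabs_ge0//.
    have Dp' : disk (Num.sqrt 1) p by rewrite sqrtr1.
    have := weight_bound hh ler01 (lexx 1) Dp' Dp.
    by rewrite rmorph1 mul1r.
  under eq_integral do rewrite EFinM.
  rewrite ge0_integralZl ?lee_fin ?mulr_ge0//.
  - by rewrite -/(Iabs D (onD g)) -A1_intE (A1_norm hg) -EFinM.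
  - by apply/measurable_EFinP; exact: Cmeas_cabs (Cmeas_onD gg).
  - by move=> p _; rewrite lee_fin cabs_ge0.
have := cint_le mD m1 b; have p0 := pi_gt0 R.
rewrite ger0_norm ?invr_ge0 ?pi_ge0// => h1; rewrite ler_pdivrMl//.
apply: le_trans h1 _; move: (pi) (A1norm g) (Blochnorm h) => x y z; lra.
Qed.

Definition pair_int g h (r : R) : C :=
  cint (disk r) (fun p => psum g (zz p) * psum h (conjc (zz p))).

(** Once the limit is known to exist, it is evaluated along this one sequence of radii; the shift by
    2 keeps every radius strictly between 0 and 1. *)
Definition rad n : R := 1 - n.+2%:R^-1.

Lemma rad_lt n : 0 < rad n < 1.
Proof.
rewrite /rad subr_gt0 invf_lt1 ?ltr1n//= ltrBlDr ltrDl invr_gt0 ltr0n //.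
Qed.

Lemma cvg_rad : rad @ \oo --> (1 : R).
Proof.
rewrite -[X in _ --> X](subr0 1); apply: cvgB; first exact: cvg_cst.
by rewrite (cvg_shiftS (fun n => n.+1%:R^-1 : R)); exact: cvg_harmonic.
Qed.

Lemma pairing_rad g h : A1 g -> Bloch h ->
  (((pi^-1)%:C)%C * pair_int g h (rad n)) @[n --> \oo] --> pairing g h.
Proof. by move=> hg hh; rewrite (pairing_lim hg hh); exact: pair_at_cvg hg hh rad_lt cvg_rad. Qed.

Lemma cvgC_lin (f g : nat -> C) (al be l m : C) : f @ \oo --> l -> g @ \oo --> m ->
  (al * f n + be * g n) @[n --> \oo] --> al * l + be * m.
Proof.
move=> h1 h2; exact: (cvgCD (cvgCM (cvg_cst al) h1) (cvgCM (cvg_cst be) h2)).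
Qed.

Lemma series_lin (s t : nat -> C) (al be l m : C) : series s @ \oo --> l -> series t @ \oo --> m ->
  series (fun k => al * s k + be * t k) @ \oo --> al * l + be * m.
Proof.
move=> h1 h2.
have -> : series (fun k => al * s k + be * t k) = fun n => al * series s n + be * series t n.
  by apply/funext => n; rewrite !seriesEnat/= !mulr_sumr -big_split.
exact: (cvgC_lin (al := al) (be := be) h1 h2).
Qed.

Lemma pair_int_lin g1 g2 g h1 h2 h r (al be : C) : growth g1 -> growth g2 -> growth g ->
  growth h1 -> growth h2 -> growth h -> 0 < r < 1 ->
  (forall k, g k * h k = al * (g1 k * h1 k) + be * (g2 k * h2 k)) ->
  pair_int g h r = al * pair_int g1 h1 r + be * pair_int g2 h2 r.
Proof.
move=> gg1 gg2 gg gh1 gh2 gh /andP[r0 r1] e.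
have c := series_lin (al := al) (be := be) (pair_series gg1 gh1 r0 r1) (pair_series gg2 gh2 r0 r1).
apply: (limC_unique (pair_series gg gh r0 r1)).
have -> : series (pterm g h r) = series (fun k => al * pterm g1 h1 r k + be * pterm g2 h2 r k).
  congr series; apply/funext => k; rewrite /pterm mulrA e.
  by move: (_%:C)%C => X; rewrite mulrDl !mulrA.
exact: c.
Qed.

(** Stated on the products g_k h_k, so that linearity in each argument and the transposition of
    multipliers are instances of one fact. *)
Lemma pairing_lin g1 g2 g h1 h2 h (al be : C) : A1 g1 -> A1 g2 -> A1 g ->
  Bloch h1 -> Bloch h2 -> Bloch h ->
  (forall k, g k * h k = al * (g1 k * h1 k) + be * (g2 k * h2 k)) ->
  pairing g h = al * pairing g1 h1 + be * pairing g2 h2.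
Proof.
move=> hg1 hg2 hg hh1 hh2 hh e; apply: (limC_unique (pairing_rad hg hh)).
have -> : (fun n => ((pi^-1)%:C)%C * pair_int g h (rad n)) =
    fun n => al * (((pi^-1)%:C)%C * pair_int g1 h1 (rad n)) + be * (((pi^-1)%:C)%C * pair_int g2 h2 (rad n)).
  apply/funext => n; rewrite (pair_int_lin (A1_growth hg1) (A1_growth hg2) (A1_growth hg)
    (Bloch_growth hh1) (Bloch_growth hh2) (Bloch_growth hh) (rad_lt n) e).
  by move: (pair_int g1 _ _) (pair_int g2 _ _) (_%:C)%C => x y z; ring.
exact: (cvgC_lin (al := al) (be := be) (pairing_rad hg1 hh1) (pairing_rad hg2 hh2)).
Qed.

Lemma pairing_linl g1 g2 h (al be : C) : A1 g1 -> A1 g2 -> Bloch h ->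
  pairing (fun k => al * g1 k + be * g2 k) h = al * pairing g1 h + be * pairing g2 h.
Proof.
move=> h1 h2 hh; apply: (pairing_lin h1 h2 (A1_lin al be h1 h2).1 hh hh hh).
by move=> k; rewrite mulrDl !mulrA.
Qed.

Lemma pairing_linr g h1 h2 (al be : C) : A1 g -> Bloch h1 -> Bloch h2 ->
  pairing g (fun k => al * h1 k + be * h2 k) = al * pairing g h1 + be * pairing g h2.
Proof.
move=> hg h1' h2'; apply: (pairing_lin hg hg hg h1' h2' (Bloch_lin al be h1' h2').1).
by move=> k; rewrite mulrDr !mulrA (mulrC (g k)) (mulrC (g k) be).
Qed.

Lemma pairing_eq g1 g h1 h : A1 g1 -> A1 g -> Bloch h1 -> Bloch h ->
  (forall k, g k * h k = g1 k * h1 k) -> pairing g h = pairing g1 h1.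
Proof.
move=> hg1 hg hh1 hh e.
have := pairing_lin (al := 1) (be := 0) hg1 hg1 hg hh1 hh1 hh.
by rewrite mul1r mul0r addr0; apply => k; rewrite mul1r mul0r addr0.
Qed.

Lemma real_pterm (x s : R) k : ((x * (s * s ^+ k) / k.+1%:R)%:C)%C =
  (x%:C)%C * ((s%:C)%C * (s%:C)%C ^+ k) * (k.+1%:R)^-1 :> C.
Proof.
have e1 : ((k.+1%:R^-1 : R)%:C)%C = (k.+1%:R)^-1 :> C.
  by apply: etrans (fmorphV (real_complex R) _) _; congr (_^-1); exact: rmorph_nat.
have e2 : ((s ^+ k)%:C)%C = (s%:C)%C ^+ k :> C := rmorphXn (real_complex R) k s.
have rM (y z : R) : ((y * z)%:C)%C = (y%:C)%C * (z%:C)%C :> C := rmorphM (real_complex R) y z.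
by rewrite -e1 -e2 -!rM.
Qed.

(** The geometric factor t^k lets the series of products converge beyond the unit disk; the pairing
    on the disk of radius r is such a series at r^2, and continuity gives its value as r tends to
    1. *)
Lemma pairing_sum g h (b : nat -> C) (t : R) (L : C) : A1 g -> Bloch h -> growth b -> 0 < t -> t < 1 ->
  (forall k, cabs (g k * h k) <= cabs (b k) * t ^+ k) ->
  series (fun k => g k * h k / k.+1%:R) @ \oo --> L ->
  pairing g h = ((A0 R / pi)%:C)%C * L.
Proof.
move=> hg hh gb t0 t1 hb hL.
(* Rescaling by t^-k keeps the radius of convergence at 1 and moves the point of evaluation to t <
   1, where the facts on [psum] apply. *)
pose c k : C := g k * h k / k.+1%:R * ((t^-1)%:C)%C ^+ k.
have kC k : (k.+1%:R : C) != 0 by rewrite pnatr_eq0.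
have tE k : ((t^-1)%:C)%C ^+ k * (t%:C)%C ^+ k = (1 : C).
  by rewrite -exprMn -rmorphM mulVf ?gt_eqF// rmorph1 expr1n.
have gc : growth c.
  apply: (growth_le (K := 1) gb) => k; rewrite mul1r /c cabsM cabsX cabs_real ger0_norm ?invr_ge0 ?(ltW t0)//.
  rewrite exprVn ler_pdivrMr ?exprn_gt0//; apply: le_trans (hb k).
  rewrite cabsM cabsV cabs_nat ler_piMr ?cabs_ge0// invf_le1 ?ler1n//.
have ct k : c k * (t%:C)%C ^+ k = g k * h k / k.+1%:R by rewrite /c -mulrA tE mulr1.
have tC : cabs (t%:C : C)%C < 1 by rewrite cabs_real ger0_norm// ltW.
have cL : psum c (t%:C)%C = L.
  apply: psum_eq; have -> : (fun k => c k * (t%:C)%C ^+ k) = fun k => g k * h k / k.+1%:R by apply/funext.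
  exact: hL.
pose r2 n := rad n ^+ 2.
have hr2 n : 0 <= r2 n <= 1.
  by have /andP[a a'] := rad_lt n; rewrite sqr_ge0 exprn_ile1// ltW.
have cr2 : r2 @ \oo --> (1 : R).
  by rewrite -[X in _ --> X](mulr1 1); apply: cvgM; exact: cvg_rad.
have e n : pair_int g h (rad n) = ((A0 R)%:C)%C * (((r2 n)%:C)%C * psum c (((r2 n)%:C)%C * (t%:C)%C)).
  have /andP[a a'] := rad_lt n; have /andP[q q'] := hr2 n.
  apply: (limC_unique (pair_series (A1_growth hg) (Bloch_growth hh) a a')).
  have w1 : cabs (((r2 n)%:C)%C * (t%:C : C)%C) < 1.
    by rewrite cabs_dil//; apply: le_lt_trans tC; rewrite ler_piMl ?cabs_ge0.
  have cc := psum_cvg gc w1.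
  have -> : series (pterm g h (rad n)) = fun m => ((A0 R)%:C)%C * (((r2 n)%:C)%C *
      series (fun k => c k * (((r2 n)%:C)%C * (t%:C)%C) ^+ k) m).
    apply/funext => m; rewrite !seriesEnat /= !mulr_sumr; apply: eq_bigr => k _.
    have eX : rad n ^+ k.*2.+2 = r2 n * r2 n ^+ k.
      by rewrite -exprS /r2 -exprM mul2n doubleS.
    have eY : c k * (((r2 n)%:C)%C * (t%:C)%C) ^+ k = ((r2 n)%:C)%C ^+ k * (g k * h k / k.+1%:R).
      by rewrite exprMn mulrCA ct.
    rewrite /pterm eX eY.
    have eZ : ((A0 R * (r2 n * r2 n ^+ k) / k.+1%:R)%:C)%C =
        ((A0 R)%:C)%C * (((r2 n)%:C)%C * ((r2 n)%:C)%C ^+ k) * (k.+1%:R)^-1 :> C.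
      exact: real_pterm.
    rewrite eZ; move: (((r2 n)%:C)%C : C) (((A0 R)%:C)%C : C) (k.+1%:R^-1 : C) => y w v.
    move: (y ^+ k) (g k) (h k) => z x x'; ring.
  apply: cvgCM; first exact: cvg_cst.
  by apply: cvgCM; [exact: cvg_cst|exact: cc].
apply: (limC_unique (pairing_rad hg hh)).
have -> : (fun n => ((pi^-1)%:C)%C * pair_int g h (rad n)) =
   fun n => ((A0 R / pi)%:C)%C * (((r2 n)%:C)%C * psum c (((r2 n)%:C)%C * (t%:C)%C)).
  apply/funext => n; rewrite e mulrA; congr (_ * _); rewrite -rmorphM; congr (_%:C)%C.
  exact: mulrC.
apply: cvgCM; first exact: cvg_cst.
rewrite -[X in _ --> X]mul1r -cL; apply: cvgCM; last exact: psum_dil_cvg.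
exact: (cvg_realC cr2).
Qed.

End PairingLimit.

(** * Each norm is controlled by the pairing *)

Section Duality.
Variable R : realType.
Local Notation C := (R[i])^o.
Local Notation TR := (measurableTypeR R).
Local Notation T := (TR * TR)%type.
Local Notation zz := (@zz R).
Local Notation D := (@disk R 1).
Implicit Types (u v g h c f : nat -> C).

Lemma A1_kc (w : C) : cabs w < 1 -> A1 (kc w) /\ A1norm (kc w) <= 4 * A0 R / (1 - cabs w ^+ 2) / pi.
Proof.
move=> w1; apply: A1_le; first exact: growth_kc (ltW w1).
apply: le_trans (kernel_bound w1) _; rewrite lee_fin (mulrC pi) divfK//.
by rewrite gt_eqF ?pi_gt0.
Qed.

Lemma kc_div (w : C) f k : kc w k * f k / k.+1%:R = k%:R * f k * w ^+ k.-1.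
Proof.
have n0 : (k.+1%:R : C) != 0 by rewrite pnatr_eq0.
rewrite /kc natrM; move: (w ^+ _) (f k) (k%:R) (k.+1%:R) n0 => x y m n n0.
by field.
Qed.

(** The coefficient k (k + 1) w^(k-1) of the kernel, divided by the k + 1 of the pairing, leaves k
    w^(k-1): the series of f'(w). *)
Lemma pairing_kc (w : C) f : cabs w < 1 -> Bloch f ->
  pairing (kc w) f = ((A0 R / pi)%:C)%C * psum (deriv_coef f) w.
Proof.
move=> w1 hf; have gf := Bloch_growth hf; have w0 := cabs_ge0 w.
have [t wt0 /andP[t0 t1]] := between w1.
(* The radius t lies strictly between |w| and 1; the factor t^-1 in b compensates the exponent k - 1
   of w. *)
apply: (pairing_sum (b := fun k => ((8 * Blochnorm f * t^-1)%:C)%C * (k * k.+1)%:R) (A1_kc w1).1 hf _ t0 t1).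
- apply: (growth_poly (c := fun k => (k + 1)%:R) (K := 8 * Blochnorm f * t^-1)); first exact: growth_nat.
  move=> k; rewrite cabsM cabs_real !cabs_nat ger0_norm ?mulr_ge0 ?invr_ge0 ?(ltW t0) ?Blochnorm_ge0//.
  rewrite -[leRHS]mulrA ler_wpM2l ?mulr_ge0 ?invr_ge0 ?(ltW t0) ?Blochnorm_ge0//.
  by rewrite -natrM ler_nat; nia.
- move=> k; rewrite /kc !cabsM !cabs_nat cabs_real cabsX ger0_norm ?mulr_ge0 ?invr_ge0 ?(ltW t0) ?Blochnorm_ge0//.
  have N0 := Blochnorm_ge0 hf; have hk := Bloch_coef k hf.
  case: k hk => [|k] hk; first by rewrite mul0n !mul0r mulr0 mul0r.
  rewrite exprS /=.
  have -> : 8 * Blochnorm f / t * (k.+1 * k.+2)%:R * (t * t ^+ k) = (k.+1 * k.+2)%:R * t ^+ k * (8 * Blochnorm f).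
    by move: (t ^+ k) ((k.+1 * k.+2)%:R) => X Y; field; rewrite gt_eqF.
  apply: ler_pM => //; rewrite ?cabs_ge0 ?mulr_ge0 ?exprn_ge0//.
  by rewrite ler_wpM2l// lerXn2r ?nnegrE ?(ltW t0) ?(ltW wt0).
have -> : (fun k => kc w k * f k / k.+1%:R) = fun k => k%:R * f k * w ^+ k.-1.
  by apply/funext => k; exact: kc_div.
have c := psum_cvg (growth_deriv gf) w1.
rewrite -(cvg_shiftS (series (fun k => k%:R * f k * w ^+ k.-1))).
have -> : (fun n => series (fun k => k%:R * f k * w ^+ k.-1) n.+1) = series (fun k => deriv_coef f k * w ^+ k).
  apply/funext => n; rewrite !seriesEnat /= big_nat_recl// mul0r mul0r add0r.
  by apply: eq_bigr => k _.
exact: c.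
Qed.

Lemma pairing_mon k f : Bloch f -> pairing (mon R k) f = ((A0 R / pi)%:C)%C * (f k / k.+1%:R).
Proof.
move=> hf; have gf := Bloch_growth hf; have N0 := Blochnorm_ge0 hf.
have t0 : (0 : R) < 1 / 2 by lra.
have t1 : (1 / 2 : R) < 1 by lra.
(* Only index k is nonzero, so any t would do; with t = 1/2 the factor 2^k restores the bound at
   that index. *)
apply: (pairing_sum (b := fun j => ((8 * Blochnorm f * 2 ^+ k)%:C)%C) (A1_mon R k).1 hf _ t0 t1).
- by apply: (growth_bounded (B := 8 * Blochnorm f * 2 ^+ k)) => j; rewrite cabs_real ger0_norm// mulr_ge0 ?mulr_ge0// exprn_ge0.
- move=> j; rewrite cabs_real ger0_norm; last by rewrite mulr_ge0 ?mulr_ge0// exprn_ge0.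
  rewrite /mon; case: eqVneq => [->|jk]; last first.
    by rewrite mul0r cabs0 !mulr_ge0// ?exprn_ge0.
  rewrite mul1r -[leRHS]mulrA -exprMn mul1r mulfV// expr1n mulr1; exact: Bloch_coef.
have h j : j != k -> mon R k j = 0 by rewrite /mon => /negbTE ->.
have := @coef_limit R (fun j => mon R k j) (fun j => f j / j.+1%:R) k h.
rewrite {2}/mon eqxx mulr1.
have -> : series (fun j => mon R k j * f j / j.+1%:R) = fun n => \sum_(0 <= j < n) f j / j.+1%:R * mon R k j.
  apply/funext => n; rewrite seriesEnat /=; apply: eq_bigr => j _.
  by rewrite -mulrA mulrC.
by [].
Qed.

(** 6 = 2 + 4. The kernels vanish at 0 and see only f'; the value f(0) is caught by pairing with the
    constant function 1, at cost 2. The 4 is that of [kernel_bound]. *)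
Lemma Blochnorm_le_pairing f K : 0 <= K -> Bloch f -> (forall g, A1 g -> cabs (pairing g f) <= K * A1norm g) ->
  Blochnorm f <= 6 * K.
Proof.
move=> K0 hf h; have gf := Bloch_growth hf.
have a0 := A0_gt0 R; have p0 := pi_gt0 R.
have q0 : 0 < A0 R / pi by rewrite divr_gt0.
have h0 : cabs (f 0%N) <= 2 * K.
  have [m1 m2] := A1_mon R 0.
  have := le_trans (h _ m1) (ler_wpM2l K0 m2).
  rewrite pairing_mon// cabsM cabs_real gtr0_norm// !divr1 => h1.
  rewrite -(ler_pM2l q0); apply: le_trans h1 _.
  have -> : K * (2 * A0 R / pi) = A0 R / pi * (2 * K) by ring.
  exact: lexx.
have [] := @Blochnorm_le R f (4 * K) gf.
  move=> z z1; have [m1 m2] := A1_kc z1.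
  have w0 : 0 < 1 - cabs z ^+ 2 by rewrite subr_gt0 expr_lt1 ?cabs_ge0.
  have := le_trans (h _ m1) (ler_wpM2l K0 m2).
  rewrite (pairing_kc z1 hf) cabsM cabs_real gtr0_norm// /bl.
  move: (1 - _) (cabs (psum _ _)) w0 => w X w0 h1.
  rewrite mulrC -ler_pdivlMr// -(ler_pM2l q0); apply: le_trans h1 _.
  have -> : K * (4 * A0 R / w / pi) = A0 R / pi * (4 * K / w) by ring.
  exact: lexx.
move=> _ /le_trans; apply; lra.
Qed.

(** For each r < 1 the test function has Bloch norm at most 12 A0, whatever r is, and pairs with g
    to A0 / pi times the integral of |g| over the disk of radius r; then r tends to 1. *)
Lemma A1norm_le_pairing g K : 0 <= K -> A1 g -> (forall f, Bloch0 f -> cabs (pairing g f) <= K * Blochnorm f) ->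
  A1norm g <= 12 * K.
Proof.
move=> K0 hg h; have gg := A1_growth hg; have a0 := A0_gt0 R; have p0 := pi_gt0 R.
have mD := measurable_disk (1 : R).
pose w (p : T) : C := psum g (zz p).
(* The unimodular function conj g / |g|, equal to 0 at the zeros of g. The inverse is written as a
   real power because measurability of powers is at hand. *)
pose phi (p : T) : C := (((cabs (w p)) `^ (-1))%:C)%C * (conjc (w p) : C).
have phiw p : phi p * w p = ((cabs (w p))%:C)%C.
  rewrite /phi -mulrA (mulrC (conjc (w p) : C)) /cabs.
  have e2 : w p * (conjc (w p) : C) = ((cabs (w p) ^+ 2)%:C)%C.
    case: (w p) => x y; rewrite cabs_cpt; apply/eqP; rewrite eq_complex /=.
    by apply/andP; split; apply/eqP; ring.
  rewrite e2 powR_inv1 ?cabs_ge0// -/(cabs (w p)).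
  have := cabs_ge0 (w p); move: (cabs (w p)) => x x0.
  apply: etrans (esym (rmorphM (real_complex R) _ _)) _; congr (_%:C)%C.
  have [->|x1] := eqVneq x 0; first by rewrite expr0n mulr0.
  by rewrite expr2 mulrA mulVf// mul1r.
have phi1 p : cabs (phi p) <= 1.
  rewrite /phi cabsM cabs_real cabs_conj powR_inv1 ?cabs_ge0// ger0_norm ?invr_ge0 ?cabs_ge0//.
  have [->|x1] := eqVneq (cabs (w p)) 0; first by rewrite mulr0.
  by rewrite mulVf.
have mphi r : 0 < r -> r < 1 -> Cmeas (disk r) phi.
  move=> r0 r1; have sub : disk r `<=` D by apply: disk_sub; exact: ltW.
  have mw : Cmeas (disk r) w by apply: (Cmeas_S mD sub); exact: Cmeas_onD.
  apply: CmeasM; last exact: CmeasC.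
  apply: (@Cmeas_real _ _ (fun p => cabs (w p) `^ (-1))).
  exact: (measurableT_comp (@measurable_powR R (-1)) (Cmeas_cabs mw)).
have key r : 0 < r -> r < 1 -> (Iabs (disk r) w <= (12 * pi * K)%:E)%E.
  move=> r0 r1; have rge := ltW r0.
  have sub : disk r `<=` D by apply: disk_sub; exact: ltW.
  have mDr := measurable_disk r; have fD := area_disk_lty r.
  have mp := mphi r r0 r1.
  have hzz p : disk r p -> cabs (zz p) <= r by exact: zz_le.
  have hphi p : disk r p -> cabs (phi p) <= 1 by move=> _; exact: phi1.
  pose m k := cint (disk r) (fun p => phi p * zz p ^+ k).
  pose V := fine (area (disk r)).
  have hm k : cabs (m k) <= 2 * (r ^+ k * V).
    apply: cint_le => //; first by apply: CmeasM => //; apply: CmeasX; exact: Cmeas_zz.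
    apply: Iabs_bounded => //; first by apply: CmeasM => //; apply: CmeasX; exact: Cmeas_zz.
    move=> p Dp; rewrite cabsM cabsX -[leRHS]mul1r; apply: ler_pM; rewrite ?exprn_ge0 ?cabs_ge0 ?phi1//.
    by rewrite lerXn2r ?nnegrE ?cabs_ge0//; exact: hzz.
  (* The projection of phi restricted to the disk: k + 1 is the coefficient of the Bergman kernel
     and cancels the 1 / (k + 1) of the pairing. The pairing evaluates f at conj z, so the moments
     need no conjugation. *)
  pose f k : C := k.+1%:R * m k.
  have hfk k : cabs (f k) <= 2 * V * k.+1%:R * r ^+ k.
    rewrite cabsM cabs_nat [leRHS]mulrAC mulrC ler_wpM2r//.
    by apply: le_trans (hm k) _; rewrite mulrA mulrAC.
  have V0 : 0 <= V by rewrite fine_ge0// measure_ge0.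
  pose c1 k : C := f k * ((r^-1)%:C)%C ^+ k.
  have fdil : f = dil r c1.
    apply/funext => k; rewrite /dil /c1 -mulrA -exprMn.
    have -> : ((r^-1)%:C)%C * (r%:C)%C = 1 :> C.
      by apply: etrans (esym (rmorphM (real_complex R) _ _)) _; rewrite mulVf ?gt_eqF.
    by rewrite expr1n mulr1.
  have gc1 : growth c1.
    apply: (growth_poly (c := fun=> 1) (K := 2 * V)); first exact: growth_one.
    move=> k; rewrite cabs1 mulr1 /c1 cabsM cabsX cabs_real ger0_norm ?invr_ge0//.
    by rewrite exprVn ler_pdivrMr ?exprn_gt0.
  (* The cutoff at r < 1 makes the coefficients O(k r^k), so f is a dilation of a function on the
     disk and lies in B_0. *)
  have f0 : Bloch0 f by rewrite fdil; exact: Bloch0_dil.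
  have hf := f0.1; have gf := Bloch_growth hf.
  have fbl z : cabs z < 1 -> bl f z <= 8 * A0 R.
    move=> z1; rewrite /bl.
    have gk := growth_kc (ltW z1).
    (* Differentiating the projection under the integral sign produces the kernel [kc z], so its A^1
       bound becomes the Bloch bound: 8 A0, which is 2 * 4 A0. *)
    have e : psum (deriv_coef f) z = cint (disk r) (fun p => phi p * psum (kc z) (zz p)).
      have c := cint_series mDr fD mp (Cmeas_zz (disk r)) hphi hzz rge r1 gk.
      apply: psum_eq; move: c; rewrite -cvg_shiftS.
      have -> : (fun n => \sum_(0 <= k < n.+1) kc z k * cint (disk r) (fun p => phi p * zz p ^+ k)) =
         series (fun k => deriv_coef f k * z ^+ k).
        apply/funext => n; rewrite seriesEnat /= big_nat_recl// {1}/kc mul0n !mul0r add0r.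
        apply: eq_bigr => k _; rewrite -/(m k.+1) /kc /deriv_coef /f /= natrM.
        by move: (z ^+ k) (m k.+1) => X Y; ring.
      by [].
    have sb : (Iabs (disk r) (fun p => phi p * psum (kc z) (zz p))%R <= (4 * A0 R / (1 - cabs z ^+ 2))%:E)%E.
      exact: le_trans (Iabs_sub mDr sub gk mp hphi) (kernel_bound z1).
    have mz : Cmeas (disk r) (fun p => phi p * psum (kc z) (zz p)).
      by apply: CmeasM mp _; apply: (Cmeas_S mD sub); exact: Cmeas_onD.
    have := cint_le mDr mz sb; rewrite -e.
    have w0 : 0 < 1 - cabs z ^+ 2 by rewrite subr_gt0 expr_lt1 ?cabs_ge0.
    rewrite mulrA ler_pdivlMr// mulrC; move: (A0 R) => x; lra.
  have f00 : cabs (f 0%N) <= 4 * A0 R.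
    rewrite /f mul1r /m.
    have -> : cint (disk r) (fun p => phi p * zz p ^+ 0) = cint (disk r) (fun p => phi p * psum (mon R 0) (zz p)).
      by apply: eq_cint => p _; rewrite psum_mon.
    have [m1 m2] := A1_mon R 0.
    have m3 : Cmeas (disk r) (fun p => phi p * psum (mon R 0) (zz p)).
      by apply: CmeasM mp _; apply: (Cmeas_S mD sub); exact: Cmeas_onD (growth_mon (R:=R) 0).
    have sb := Iabs_sub mDr sub (growth_mon (R:=R) 0) mp hphi.
    rewrite (A1_norm m1) in sb.
    apply: le_trans (cint_le mDr m3 sb) _; move: m2.
    rewrite divr1 ler_pdivlMr// mulrC => m2; lra.
  have Nf : Blochnorm f <= 12 * A0 R.
    by apply: le_trans (Blochnorm_le gf fbl).2 _; lra.
  have cL := cint_series mDr fD mp (Cmeas_zz (disk r)) hphi hzz rge r1 gg.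
  have [B [t [t0 t1 hB]]] := growth_geom gg rge r1.
  have [s ts /andP[s0 s1]] := between t1.
  have B0 : 0 <= B.
    by apply: le_trans (_ : cabs (g 0%N) <= _); rewrite ?cabs_ge0//; have := hB 0%N; rewrite !expr0 !mulr1.
  (* The coefficients satisfy |g_k| r^k <= B t^k for some t < 1, and the linear factor from f goes
     into b; the resulting sum is the integral of phi g. *)
  have pf : pairing g f = ((A0 R / pi)%:C)%C * cint (disk r) (fun p => phi p * psum g (zz p)).
    apply: (pairing_sum (b := fun k => ((2 * V * B * k.+1%:R)%:C)%C) hg hf _ s0 s1).
    - apply: (growth_poly (c := fun=> 1) (K := 2 * V * B)); first exact: growth_one.
      by move=> k; rewrite cabs_real cabs1 mulr1 ger0_norm// !mulr_ge0.
    - move=> k; rewrite cabs_real ger0_norm ?mulr_ge0// cabsM.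
      apply: le_trans (ler_wpM2l (cabs_ge0 _) (hfk k)) _.
      have -> : cabs (g k) * (2 * V * k.+1%:R * r ^+ k) = 2 * V * k.+1%:R * (cabs (g k) * r ^+ k) by ring.
      have -> : 2 * V * B * k.+1%:R * s ^+ k = 2 * V * k.+1%:R * (B * s ^+ k) by ring.
      rewrite ler_wpM2l ?mulr_ge0//; apply: le_trans (hB k) _; rewrite ler_wpM2l//.
      by rewrite lerXn2r ?nnegrE ?(ltW s0) ?(ltW ts).
    - have -> : series (fun k => g k * f k / k.+1%:R) = fun n => \sum_(0 <= k < n) g k * m k.
        apply/funext => n; rewrite seriesEnat /=; apply: eq_bigr => k _.
        have n0 : (k.+1%:R : C) != 0 by rewrite pnatr_eq0.
        by rewrite /f; move: (m k) (k.+1%:R) n0 => X Y Y0; field.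
      exact: cL.
  have le1 : cabs (cint (disk r) (fun p => phi p * psum g (zz p))) <= 12 * pi * K.
    have := le_trans (h f f0) (ler_wpM2l K0 Nf).
    rewrite pf cabsM cabs_real gtr0_norm ?divr_gt0//.
    move: (cabs _) => X hX; rewrite -(ler_pM2l (divr_gt0 a0 p0)); apply: le_trans hX _.
    have -> : A0 R / pi * (12 * pi * K) = K * (12 * A0 R) * (pi / pi) by ring.
    by rewrite divff ?gt_eqF// mulr1.
  have fin : Iabs (disk r) w \is a fin_num.
    rewrite ge0_fin_numE ?Iabs_ge0//; apply: (@le_lt_trans _ _ (A1_int g)); last exact: hg.2.
    have c1' : cabs (1 : C) <= 1 by rewrite cabs1.
    have h1 := Iabs_sub mDr sub gg (Cmeas_cst (disk r) 1) (fun p _ => c1').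
    by move: h1; rewrite /Iabs; under eq_integral do rewrite mul1r.
  rewrite -(fineK fin) lee_fin; apply: le_trans le1; apply: le_trans (Re_le_cabs _).
  have -> : complex.Re (cint (disk r) (fun p => phi p * psum g (zz p))) = fine (Iabs (disk r) w).
    rewrite /cint /=; congr fine; apply: eq_integral => p _; congr (_%:E).
    exact: (congr1 (@complex.Re R) (phiw p)).
  exact: ler_norm.
have main : (Iabs D w <= (12 * pi * K)%:E)%E.
  have mw := Cmeas_cabs (Cmeas_onD gg).
  apply: (fatou_le (h := fun n p => \1_(disk (rad R n)) p * cabs (w p))) => //.
  - move=> n; apply: measurable_funM => //; apply: measurable_indic; exact: measurable_disk.
  - by move=> n p _; rewrite mulr_ge0 ?cabs_ge0// indicE ler0n.
  - move=> p Dp; rewrite -[X in _ --> X]mul1r; apply: cvgM; last exact: cvg_cst.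
    have z1 : cabs (zz p) < 1 by exact/(zz_disk _ ler01).
    apply: cvg_near_cst; have := @cvg_rad R; move/cvgr_gt => /(_ _ z1).
    apply: filterS => n hn; rewrite indicE mem_set//; apply/zz_disk => //.
    by apply: le_trans (ltW hn); exact: cabs_ge0.
  move=> n; have /andP[r0 r1] := rad_lt R n.
  have sub : disk (rad R n) `<=` D by apply: disk_sub; exact: ltW.
  apply: le_trans (key _ r0 r1); rewrite /Iabs -[in leRHS](setIidr sub) integral_mkcondr.
  rewrite le_eqVlt; apply/orP; left; apply/eqP; apply: eq_integral => p _.
  by rewrite /patch indicE; case: (p \in disk _); rewrite ?mul1r ?mul0r.
rewrite -A1_intE (A1_norm hg) lee_fin in main.
rewrite -(ler_pM2l p0); apply: le_trans main _.
by rewrite (mulrC 12) -mulrA lexx.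
Qed.

End Duality.
(** * Uniform boundedness and multipliers *)

Section CoefficientSpaces.
Variable R : realType.
Local Notation C := (R[i])^o.
Implicit Types (u v g h c f w : nat -> C).

(** All that the soft part of the argument uses about A^1 and B_0. The key field is [cs_coef_mon]: a
    uniform bound on the norms of the terms u_k z^k. *)
Record coef_space (S : (nat -> C) -> Prop) (N : (nat -> C) -> R) : Prop := CoefSpace {
  cs_lin : forall u v (al be : C), S u -> S v -> S (fun k => al * u k + be * v k) /\
    N (fun k => al * u k + be * v k) <= cabs al * N u + cabs be * N v;
  cs_ge0 : forall u, S u -> 0 <= N u;
  cs_mon : forall k, S (mon R k);
  cs_coef : exists L : nat -> R, forall u k, S u -> cabs (u k) <= L k * N u;
  cs_coef_mon : exists2 K, 0 <= K & forall u k, S u -> cabs (u k) * N (mon R k) <= K * N u;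
  cs_complete : forall (v : nat -> nat -> C) (e : nat -> R), (forall m, S (v m)) -> e @ \oo --> (0 : R) ->
    (forall m p, (m <= p)%N -> N (fun k => v p k - v m k) <= e m) ->
    exists w, S w /\ forall m, N (fun k => w k - v m k) <= e m;
  cs_dil : forall u eps, S u -> 0 < eps -> exists rho, [/\ 0 <= rho, rho < 1 &
    N (fun k => u k - dil rho u k) <= eps] }.

Definition trunc m c : nat -> C := fun k => if (k < m)%N then c k else 0.

Variables (S : (nat -> C) -> Prop) (N : (nat -> C) -> R).
Hypothesis H : coef_space S N.

Lemma cs_sub u v : S u -> S v -> S (fun k => u k - v k) /\ N (fun k => u k - v k) <= N u + N v.
Proof.
move=> hu hv; have := cs_lin H 1 (-1) hu hv.
have -> : (fun k => 1 * u k + (-1) * v k) = fun k => u k - v k by apply/funext => k; rewrite mul1r mulN1r.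
by rewrite cabsN cabs1 !mul1r.
Qed.

Lemma cs_add u v : S u -> S v -> S (fun k => u k + v k) /\ N (fun k => u k + v k) <= N u + N v.
Proof.
move=> hu hv; have := cs_lin H 1 1 hu hv.
have -> : (fun k => 1 * u k + 1 * v k) = fun k => u k + v k by apply/funext => k; rewrite !mul1r.
by rewrite cabs1 !mul1r.
Qed.

Lemma cs_scale (al : C) u : S u -> S (fun k => al * u k) /\ N (fun k => al * u k) <= cabs al * N u.
Proof.
move=> hu; have := cs_lin H al 0 hu hu.
have -> : (fun k => al * u k + 0 * u k) = fun k => al * u k by apply/funext => k; rewrite mul0r addr0.
by rewrite cabs0 mul0r addr0.
Qed.

Lemma cs_zero : S (fun=> 0) /\ N (fun=> 0) = 0.
Proof.
have [] := cs_scale 0 (cs_mon H 0).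
have -> : (fun k => 0 * mon R 0 k) = fun=> 0 by apply/funext => k; rewrite mul0r.
move=> s0; rewrite cabs0 mul0r => n0; split => //.
by apply/eqP; rewrite eq_le n0 (cs_ge0 H).
Qed.

Lemma trunc_diff c m p : (m <= p)%N -> S (fun k => trunc p c k - trunc m c k) /\
  N (fun k => trunc p c k - trunc m c k) <= \sum_(m <= k < p) cabs (c k) * N (mon R k).
Proof.
move=> /subnKC <-; elim: (p - m)%N => [|q [IH1 IH2]].
  rewrite addn0 big_geq//.
  have -> : (fun k => trunc m c k - trunc m c k) = fun=> 0 by apply/funext => k; rewrite subrr.
  by have [s0 ->] := cs_zero.
have [s1 n1] := cs_scale (c (m + q)%N) (cs_mon H (m + q)).
have [s2 n2] := cs_add IH1 s1.
have e : (fun k => trunc (m + q.+1) c k - trunc m c k) =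
    fun k => (trunc (m + q) c k - trunc m c k) + c (m + q)%N * mon R (m + q) k.
  apply/funext => k; rewrite /trunc /mon addnS ltnS leq_eqVlt addrAC; congr (_ - _).
  case: eqVneq => [->|_]; first by rewrite ltnn mulr1 add0r.
  by rewrite mulr0 addr0.
rewrite e; split => //; apply: le_trans n2 _.
by rewrite addnS big_nat_recr ?leq_addr//=; apply: lerD.
Qed.

Lemma trunc_in c m : S (trunc m c) /\ N (trunc m c) <= \sum_(0 <= k < m) cabs (c k) * N (mon R k).
Proof.
have [] := trunc_diff c (leq0n m).
have -> : (fun k => trunc m c k - trunc 0 c k) = trunc m c by apply/funext => k; rewrite /trunc ltn0 subr0.
by [].
Qed.

(** The partial sums are Cauchy, so completeness gives a limit in the space; continuity of the
    coefficients identifies that limit with c. *)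
Lemma abs_summable c (l : R) : series (fun k => cabs (c k) * N (mon R k)) @ \oo --> l ->
  [/\ S c, N c <= l & forall eps, 0 < eps -> exists m, N (fun k => c k - trunc m c k) <= eps].
Proof.
move=> hl; pose s := series (fun k => cabs (c k) * N (mon R k)).
have t0 k : 0 <= cabs (c k) * N (mon R k) by rewrite mulr_ge0 ?cabs_ge0// (cs_ge0 H)//; exact: cs_mon H k.
have sE m p : (m <= p)%N -> \sum_(m <= k < p) cabs (c k) * N (mon R k) = s p - s m.
  by move=> mp; rewrite /s !seriesEnat /= [X in _ = X - _](big_cat_nat (n := m) (p := p))//= addrAC subrr add0r.
have nd : nondecreasing_seq s.
  by move=> m p mp; rewrite -subr_ge0 -sE// sumr_ge0.
have sl p : s p <= l.
  by rewrite -(cvg_lim _ hl)//; apply: nondecreasing_cvgn_le => //; apply/cvg_ex; exists l.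
pose e m := l - s m.
have ce : e @ \oo --> (0 : R).
  by rewrite -(subrr l); apply: cvgB; [exact: cvg_cst|exact: hl].
have he m p : (m <= p)%N -> N (fun k => trunc p c k - trunc m c k) <= e m.
  by move=> mp; apply: le_trans (trunc_diff c mp).2 _; rewrite sE// /e lerD2r.
have [w [Sw hw]] := cs_complete H (fun m => (trunc_in c m).1) ce he.
have [L hL] := cs_coef H.
have wc : w = c.
  apply/funext => k; apply/eqP; rewrite -subr_eq0; apply/eqP; apply: cabs0_eq0.
  apply/eqP; rewrite eq_le cabs_ge0 andbT.
  have Lk0 : 0 <= L k * N (mon R k).
    apply: le_trans (hL _ k (cs_mon H k)); exact: cabs_ge0.
  have cl : (fun m => `|L k| * e m) @ \oo --> (0 : R).
    by rewrite -[X in _ --> X](mulr0 `|L k|); apply: cvgM; [exact: cvg_cst|exact: ce].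
  rewrite -(cvg_lim _ cl)//; apply: limr_ge; first by apply/cvg_ex; exists 0.
  exists k.+1 => // m /= km.
  have -> : w k - c k = w k - trunc m c k by rewrite /trunc km.
  have [Sd _] := cs_sub Sw (trunc_in c m).1.
  apply: le_trans (hL _ k Sd) _.
  apply: le_trans (ler_wpM2r (cs_ge0 H Sd) (ler_norm (L k))) _.
  by rewrite ler_wpM2l.
rewrite wc in Sw hw; split => //.
  have := hw 0%N; rewrite /e /s seriesEnat /= big_geq// subr0.
  have -> : (fun k => c k - trunc 0 c k) = c by apply/funext => k; rewrite /trunc ltn0 subr0.
  by [].
move=> eps eps0; have /cvgrPdist_le /(_ _ eps0) [m _ /(_ m (leqnn m))] := ce.
rewrite /= sub0r normrN => /(le_trans (ler_norm _)) em.
by exists m; apply: le_trans (hw m) em.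
Qed.

(** The assumption concerns only the sizes of the terms c_k z^k, not membership of c in S. This
    allows applying it to c in B with S = B_0. *)
Lemma mult_bounded (a : nat -> C) : cvgn (series (fun k => cabs (a k))) ->
  exists K, forall c B, (forall k, cabs (c k) * N (mon R k) <= B) ->
    S (fun k => a k * c k) /\ N (fun k => a k * c k) <= K * B.
Proof.
move=> ca; exists (limn (series (fun k => cabs (a k)))) => c B hB.
have t0 k : 0 <= N (mon R k) by apply: (cs_ge0 H); exact: cs_mon H k.
have B0 : 0 <= B by apply: le_trans (hB 0%N); rewrite mulr_ge0 ?cabs_ge0.
have le k : cabs (a k * c k) * N (mon R k) <= cabs (a k) * B.
  by rewrite cabsM -mulrA ler_wpM2l ?cabs_ge0.
have cB : series (fun k => cabs (a k) * B) @ \oo --> limn (series (fun k => cabs (a k))) * B.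
  have -> : series (fun k => cabs (a k) * B) = fun n => series (fun k => cabs (a k)) n * B.
    by apply/funext => n; rewrite !seriesEnat /= mulr_suml.
  by apply: cvgM; [exact: ca|exact: cvg_cst].
have cs : cvgn (series (fun k => cabs (a k * c k) * N (mon R k))).
  apply: (series_le_cvg _ _ le); last by apply/cvg_ex; eexists; exact: cB.
    by move=> k; rewrite mulr_ge0 ?cabs_ge0.
  by move=> k; rewrite mulr_ge0 ?cabs_ge0.
have [h1 h2 _] := abs_summable cs; split => //; apply: le_trans h2 _.
rewrite -(cvg_lim _ cB)//; apply: lim_series_le => //.
by apply/cvg_ex; eexists; exact: cB.
Qed.

(** A dilation has terms of norm at most K rho^k times the norm of u, so it is absolutely summable
    and its truncations converge to it in norm. *)
Lemma poly_dense u eps : S u -> 0 < eps -> exists m c, N (fun k => u k - trunc m c k) <= eps.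
Proof.
move=> hu eps0; have e2 : 0 < eps / 2 by rewrite divr_gt0.
have [rho [r0 r1 hr]] := cs_dil H hu e2; have [K K0 hK] := cs_coef_mon H.
have N0 := cs_ge0 H hu.
have cg : cvgn (series (fun k => cabs (((rho%:C)%C : C) ^+ k))).
  have -> : (fun k => cabs (((rho%:C)%C : C) ^+ k)) = geometric 1 rho.
    by apply/funext => k; rewrite cabsX cabs_real ger0_norm// /geometric /= mul1r.
  by apply: is_cvg_geometric_series; rewrite ger0_norm.
have cd : cvgn (series (fun k => cabs (dil rho u k) * N (mon R k))).
  have cK : cvgn (series (fun k => cabs (((rho%:C)%C : C) ^+ k) * (K * N u))).
    have -> : series (fun k => cabs (((rho%:C)%C : C) ^+ k) * (K * N u)) =
       fun n => series (fun k => cabs (((rho%:C)%C : C) ^+ k)) n * (K * N u).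
      by apply/funext => n; rewrite !seriesEnat /= mulr_suml.
    by apply: is_cvgM => //; exact: is_cvg_cst.
  apply: (series_le_cvg _ _ _ cK).
  - by move=> k; rewrite mulr_ge0 ?cabs_ge0// (cs_ge0 H)//; exact: cs_mon H k.
  - by move=> k; rewrite mulr_ge0 ?cabs_ge0// mulr_ge0.
  - by move=> k; rewrite /dil cabsM mulrAC mulrC ler_wpM2l ?cabs_ge0// hK.
have [Sd _ hd] := abs_summable cd; have [m hm] := hd _ e2.
exists m, (dil rho u).
have St := (trunc_in (dil rho u) m).1.
have -> : (fun k => u k - trunc m (dil rho u) k) =
   fun k => (u k - dil rho u k) + (dil rho u k - trunc m (dil rho u) k).
  by apply/funext => k; rewrite addrA subrK.
apply: le_trans (cs_add (cs_sub hu Sd).1 (cs_sub Sd St).1).2 _.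
by rewrite [leRHS]splitr; apply: lerD.
Qed.

Lemma cvgR_sum0 (F : nat -> nat -> R) m : (forall k, F n k @[n --> \oo] --> (0 : R)) ->
  (\sum_(0 <= k < m) F n k) @[n --> \oo] --> (0 : R).
Proof.
move=> h; elim: m => [|m IH].
  have -> : (fun n => \sum_(0 <= k < 0) F n k) = fun=> 0 by apply/funext => n; rewrite big_geq.
  exact: cvg_cst.
have -> : (fun n => \sum_(0 <= k < m.+1) F n k) = fun n => \sum_(0 <= k < m) F n k + F n m.
  by apply/funext => n; rewrite big_nat_recr.
by rewrite -[X in _ --> X](addr0 0); apply: cvgD; [exact: IH|exact: h].
Qed.

(** On a fixed polynomial the convergence is a finite sum of coefficient limits; the remainder u
    minus the polynomial costs a factor M + 1, for the multiplier and the identity. *)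
Lemma mult_norm_cvg (a : nat -> nat -> C) M u : 0 <= M ->
  (forall n v, S v -> S (mult_op a n v) /\ N (mult_op a n v) <= M * N v) ->
  (forall k, a n k @[n --> \oo] --> (1 : C)) -> S u -> norm_to N (fun n => mult_op a n u) u.
Proof.
move=> M0 hM ha hu; apply/cvgrPdist_le => eps eps0.
have M1 : 0 < M + 1 by rewrite ltr_wpDl.
have d0 : 0 < eps / 2 / (M + 1) by rewrite !divr_gt0.
have [m [c hc]] := poly_dense hu d0.
have [Sp _] := trunc_in c m; have [Sup _] := cs_sub hu Sp.
have cs : (fun n => \sum_(0 <= k < m) cabs ((a n k - 1) * c k) * N (mon R k)) @ \oo --> (0 : R).
  apply: cvgR_sum0 => q.
  have -> : (fun n => cabs ((a n q - 1) * c q) * N (mon R q)) =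
      fun n => cabs (a n q - 1) * (cabs (c q) * N (mon R q)).
    by apply/funext => n; rewrite cabsM mulrA.
  rewrite -[X in _ --> X](mul0r (cabs (c q) * N (mon R q))); apply: cvgM; last exact: cvg_cst.
  exact/cvgC0P.
have e2 : 0 < eps / 2 by rewrite divr_gt0.
have /cvgrPdist_le /(_ _ e2) := cs; apply: filterS => n /=.
rewrite !sub0r !normrN => /(le_trans (ler_norm _)) hn.
have [Su _] := hM n u hu; have [Sn _] := cs_sub Su hu.
rewrite ger0_norm ?(cs_ge0 H Sn)//.
have [T1 T2] := hM n _ Sup.
have [W1 W2] := trunc_in (fun k => (a n k - 1) * c k) m.
have -> : (fun k => mult_op a n u k - u k) = fun k =>
   (mult_op a n (fun k => u k - trunc m c k) k - (u k - trunc m c k)) + trunc m (fun k => (a n k - 1) * c k) k.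
  apply/funext => k; rewrite /mult_op /trunc; case: ifP => _; last by ring.
  by move: (a n k) (u k) (c k) => x y z; ring.
have [X1 X2] := cs_sub T1 Sup; have [_ Y2] := cs_add X1 W1.
apply: le_trans Y2 _; rewrite (splitr eps); apply: lerD; last exact: le_trans W2 hn.
apply: le_trans X2 _; apply: (@le_trans _ _ ((M + 1) * N (fun k => u k - trunc m c k))).
  by rewrite mulrDl mul1r lerD2r.
by rewrite mulrC -ler_pdivlMr.
Qed.

End CoefficientSpaces.

(** * The uniform boundedness principle *)

Section UniformBoundedness.
Variable R : realType.
Local Notation C := (R[i])^o.
Implicit Types (u v g h c f w : nat -> C).

Lemma blf_bound S (N : (nat -> C) -> R) (F : (nat -> C) -> C) : coef_space S N -> bdd_lin_functional S N F ->
  exists2 M, 0 <= M & forall u, S u -> cabs (F u) <= M * N u.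
Proof.
move=> H [_ [M hM]]; exists `|M|; first exact: normr_ge0.
move=> u hu; apply: le_trans (hM u hu) _; rewrite ler_wpM2r ?ler_norm//; exact: cs_ge0 H u hu.
Qed.

Lemma blf_add S (N : (nat -> C) -> R) (F : (nat -> C) -> C) u v : bdd_lin_functional S N F -> S u -> S v ->
  F (fun k => u k + v k) = F u + F v.
Proof.
move=> [h _] hu hv; have := h u v 1 1 hu hv.
have -> : (fun k => 1 * u k + 1 * v k) = fun k => u k + v k by apply/funext => k; rewrite !mul1r.
by rewrite !mul1r.
Qed.

Lemma blf_sub S (N : (nat -> C) -> R) (F : (nat -> C) -> C) u v : bdd_lin_functional S N F -> S u -> S v ->
  F (fun k => u k - v k) = F u - F v.
Proof.
move=> [h _] hu hv; have := h u v 1 (-1) hu hv.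
have -> : (fun k => 1 * u k + (-1) * v k) = fun k => u k - v k by apply/funext => k; rewrite mul1r mulN1r.
by rewrite mul1r mulN1r.
Qed.

Lemma blf_scale S (N : (nat -> C) -> R) (F : (nat -> C) -> C) (al : C) u : bdd_lin_functional S N F -> S u ->
  F (fun k => al * u k) = al * F u.
Proof.
move=> [h _] hu; have := h u u al 0 hu hu.
have -> : (fun k => al * u k + 0 * u k) = fun k => al * u k by apply/funext => k; rewrite mul0r addr0.
by rewrite mul0r addr0.
Qed.

(** Twice y is the difference of x + y and x - y, so one of their values is at least as large as
    that of y. *)
Lemma half_max (x y : C) r : r < cabs y -> r <= cabs (x + y) \/ r <= cabs (x - y).
Proof.
move=> ry; have [h|h] := leP r (cabs (x + y)); first by left.
right; rewrite leNgt; apply/negP => h'.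
have e : y + y = (x + y) - (x - y) by ring.
have := cabsB (x + y) (x - y); rewrite -e.
have -> : cabs (y + y) = cabs y + cabs y.
  have -> : y + y = 2 * y by ring.
  by rewrite cabsM (cabs_nat _ 2) mulr_natl mulr2n.
by rewrite leNgt => /negP; apply; rewrite ltrD// (lt_trans _ ry).
Qed.

(* Sokal's argument: |F (x + y)| or |F (x - y)| is at least |F y|, so a Cauchy
   sequence with unbounded values is built without Baire category. *)
Lemma uniform_boundedness S (N : (nat -> C) -> R) (I : Type) (P : I -> Prop) (F : I -> (nat -> C) -> C) :
  coef_space S N -> (forall i, P i -> bdd_lin_functional S N (F i)) ->
  (forall u, S u -> exists B, forall i, P i -> cabs (F i u) <= B) ->
  exists2 M, 0 <= M & forall i u, P i -> S u -> cabs (F i u) <= M * N u.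
Proof.
move=> H hF hB; apply: contrapT => hn.
have unb (M : R) : 0 <= M -> exists i y, [/\ P i, S y & M * N y < cabs (F i y)].
  move=> M0; apply: contrapT => hc; apply: hn; exists M => // i u Pi Su.
  by rewrite leNgt; apply/negP => lt; apply: hc; exists i, u.
have step (m : nat) (x : nat -> C) (d : R) : S x -> 0 < d -> exists y i, [/\ S y, P i,
    N (fun k => y k - x k) <= d & m%:R <= cabs (F i y)].
  move=> Sx d0; have [i [y [Pi Sy lt]]] := unb (m%:R / d) (divr_ge0 (ler0n _ m) (ltW d0)).
  have [M M0 hM] := blf_bound H (hF i Pi).
  have Ny : 0 < N y.
    rewrite lt_neqAle (cs_ge0 H Sy) andbT; apply/eqP => e.
    by have := hM y Sy; rewrite -e mulr0 leNgt (le_lt_trans _ lt)// -e mulr0.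
  pose al : C := ((d / N y)%:C)%C.
  have cal : cabs al = d / N y by rewrite cabs_real ger0_norm// divr_ge0// ltW.
  have [Sz hz] := cs_scale H al Sy; rewrite cal divfK ?gt_eqF// in hz.
  have Fz : m%:R < cabs (F i (fun k => al * y k)).
    rewrite (blf_scale al (hF i Pi) Sy) cabsM cal mulrAC ltr_pdivlMr// (mulrC d).
    by rewrite mulrAC ltr_pdivrMr// in lt.
  have [Sp _] := cs_add H Sx Sz; have [Sm _] := cs_sub H Sx Sz.
  have [h|h] := half_max (F i x) Fz.
    exists (fun k => x k + al * y k), i; split => //; last by rewrite (blf_add (hF i Pi) Sx Sz).
    have -> : (fun k => x k + al * y k - x k) = fun k => al * y k by apply/funext => k; ring.
    exact: hz.
  exists (fun k => x k - al * y k), i; split => //; last by rewrite (blf_sub (hF i Pi) Sx Sz).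
  have -> : (fun k => x k - al * y k - x k) = fun k => (- al) * y k by apply/funext => k; ring.
  by have [_] := cs_scale H (- al) Sy; rewrite cabsN cal divfK ?gt_eqF.
pose St := {x : (nat -> C) * R | S x.1 /\ 0 < x.2}.
(* A state is a point x with a radius d for the next move. The new radius is d / (2 (M + 1)), where
   M bounds the functional just made large, so that all later moves together disturb its value only
   boundedly. *)
have stepS (m : nat) (s : St) : {s' : St | exists i, [/\ P i,
    N (fun k => (sval s').1 k - (sval s).1 k) <= (sval s).2, m%:R <= cabs (F i (sval s').1),
    (sval s').2 <= (sval s).2 / 2 &
    forall u, S u -> cabs (F i u) * (sval s').2 <= (sval s).2 * N u]}.
  apply: cid; case: s => -[x d] [/= Sx d0]; have [y [i [Sy Pi h1 h2]]] := step m x d Sx d0.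
  have [M M0 hM] := blf_bound H (hF i Pi).
  have d1 : 0 < d / (2 * (M + 1)) by rewrite divr_gt0// mulr_gt0// ltr_wpDl.
  exists (exist _ (y, d / (2 * (M + 1))) (conj Sy d1)), i => /=; split => //.
    rewrite ler_wpM2l ?(ltW d0)// lef_pV2 ?posrE ?mulr_gt0 ?ltr_wpDl//; lra.
  move=> u Su; have M2 : 0 < 2 * (M + 1) by rewrite mulr_gt0// ltr_wpDl.
  rewrite mulrA ler_pdivrMr// mulrC -mulrA ler_wpM2l ?(ltW d0)//.
  have N0 := cs_ge0 H Su; apply: le_trans (hM u Su) _; rewrite mulrC ler_wpM2l//; lra.
have [Z0 _] := cs_zero H.
pose s0 : St := exist _ ((fun=> 0), 1) (conj Z0 ltr01).
pose st := fix st n : St := if n is m.+1 then sval (stepS m (st m)) else s0.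
pose x n := (sval (st n)).1; pose d n := (sval (st n)).2.
have Sx n : S (x n) by exact: (svalP (st n)).1.
have d0 n : 0 < d n by exact: (svalP (st n)).2.
have hst n : exists i, [/\ P i, N (fun k => x n.+1 k - x n k) <= d n, n%:R <= cabs (F i (x n.+1)),
    d n.+1 <= d n / 2 & forall u, S u -> cabs (F i u) * d n.+1 <= d n * N u].
  exact: (svalP (stepS n (st n))).
have dle n : d n <= (1 / 2) ^+ n.
  elim: n => [|n IH]; first by rewrite expr0.
  have [i [_ _ _ h _]] := hst n; apply: le_trans h _; rewrite exprS.
  by move: IH; move: (_ ^+ n) (d n) => X Y; clear; lra.
(* Halving gives d_n <= 2 d_n - 2 d_(n+1), so the moves telescope. *)
have tele q m : N (fun k => x (m + q)%N k - x m k) <= 2 * d m - 2 * d (m + q)%N.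
  elim: q => [|q IH].
    rewrite addn0 subrr.
    have -> : (fun k => x m k - x m k) = fun=> 0 by apply/funext => k; rewrite subrr.
    by have [_ ->] := cs_zero H.
  have [i [_ h _ h' _]] := hst (m + q)%N.
  have -> : (fun k => x (m + q.+1)%N k - x m k) =
      fun k => (x (m + q).+1 k - x (m + q)%N k) + (x (m + q)%N k - x m k).
    by apply/funext => k; rewrite addrA subrK addnS.
  apply: le_trans (cs_add H (cs_sub H (Sx _) (Sx _)).1 (cs_sub H (Sx _) (Sx _)).1).2 _.
  rewrite addnS; apply: le_trans (lerD h IH) _; lra.
have ce : (fun m => 2 * d m) @ \oo --> (0 : R).
  have c1 : (fun m => (1 / 2 : R) ^+ m) @ \oo --> (0 : R).
    by apply: cvg_expr; rewrite ger0_norm; lra.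
  have c2 : d @ \oo --> (0 : R).
    apply: (squeezeR _ c1); apply: nearW => n; rewrite subr0 (ger0_norm (ltW (d0 n))); exact: dle.
  by rewrite -[X in _ --> X](mulr0 2); apply: cvgM => //; exact: cvg_cst.
have he m p : (m <= p)%N -> N (fun k => x p k - x m k) <= 2 * d m.
  by move=> /subnKC <-; apply: le_trans (tele _ _) _; rewrite lerBlDr lerDl mulr_ge0// ltW.
have [w [Sw hw]] := cs_complete H Sx ce he.
have [B hBw] := hB w Sw.
have [n Bn] : exists n : nat, B + 2 < n%:R 
  by exists (Num.bound `|B + 2|); apply: le_lt_trans (ler_norm _) _; exact: archi_boundP.
have [i [Pi _ h1 _ h3]] := hst n.
have [Sd _] := cs_sub H Sw (Sx n.+1).
(* The limit w is within 2 d_(n+1) of x_(n+1), so the functional chosen at step n changes by at most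
   2 d_n <= 2. Its value at w is then at least n - 2 > B. *)
have k1 := h3 _ Sd; have k2 := hw n.+1.
have k3 : cabs (F i (fun k => w k - x n.+1 k)) <= 2.
  rewrite -(ler_pM2r (d0 n.+1)); apply: le_trans k1 _.
  apply: le_trans (ler_wpM2l (ltW (d0 n)) k2) _.
  rewrite mulrCA ler_wpM2l// ler_piMl ?(ltW (d0 _))//; apply: le_trans (dle n) _.
  by rewrite exprn_ile1//; lra.
have k4 := hBw i Pi.
have := cabsB (F i w) (F i (fun k => w k - x n.+1 k)).
rewrite (blf_sub (hF i Pi) Sw (Sx _)) in k3 *.
have -> : F i w - (F i w - F i (x n.+1)) = F i (x n.+1) by ring.
move=> k5; move: (lt_le_trans Bn h1) => k6.
have : B + 2 < B + 2 by apply: lt_le_trans k6 _; apply: le_trans k5 _; exact: lerD.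
by rewrite ltxx.
Qed.

End UniformBoundedness.

(** * Multipliers on A^1 and B_0, and the pairing condition *)

Section Multipliers.
Variable R : realType.
Local Notation C := (R[i])^o.
Implicit Types (u v g h c f w : nat -> C).

Lemma A1_space : coef_space (@A1 R) (@A1norm R).
Proof.
have a0 := A0_gt0 R; have p0 := pi_gt0 R.
split.
- by move=> u v al be; exact: A1_lin.
- by move=> u _; exact: A1norm_ge0.
- by move=> k; exact: (A1_mon R k).1.
- exists (fun k => 2 * k.+1%:R * pi / A0 R) => u k hu; rewrite mulrAC ler_pdivlMr// -[leRHS]mulrA; exact: A1_coef.
(* The growth 2 (k + 1) pi / A0 of the coefficients meets the decay 2 A0 / ((k + 1) pi) of the norms
   of monomials. *)
- exists 4 => // u k hu; have [_ h] := A1_mon R k; have h' := A1_coef k hu.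
  apply: le_trans (ler_wpM2l (cabs_ge0 _) h) _.
  have n0 : 0 < k.+1%:R :> R by [].
  have -> : cabs (u k) * (2 * A0 R / k.+1%:R / pi) = cabs (u k) * A0 R * (2 / (k.+1%:R * pi)).
    by rewrite invfM; move: (k.+1%:R) => x; ring.
  rewrite mulrA ler_pdivrMr ?mulr_gt0//; apply: le_trans (ler_wpM2r _ h') _ => //.
  by rewrite le_eqVlt; apply/orP; left; apply/eqP; ring.
- exact: A1_complete.
- exact: A1_dil_approx.
Qed.

Lemma Bloch0_space : coef_space (@Bloch0 R) (@Blochnorm R).
Proof.
split.
- by move=> u v al be hu hv; split; [exact: Bloch0_lin|exact: (Bloch_lin al be hu.1 hv.1).2].
- by move=> u hu; exact: Blochnorm_ge0 hu.1.
- by move=> k; exact: (Bloch_mon R k).1.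
- by exists (fun=> 8) => u k hu; exact: Bloch_coef hu.1.
(* 24 = 8 * 3, from bounded coefficients and bounded norms of monomials. *)
- exists 24 => // u k hu; have [_ h] := Bloch_mon R k.
  apply: le_trans (ler_wpM2l (cabs_ge0 _) h) _.
  have := Bloch_coef k hu.1; move: (cabs _) (Blochnorm u) => x y; lra.
- exact: Bloch0_complete.
- exact: Bloch0_dil_approx.
Qed.

Variable a : nat -> nat -> C.
Hypothesis ha : forall n, cvgn (series (fun k => cabs (a n k))).

Lemma mult_A1 n : exists2 K, 0 <= K & forall g, A1 g -> A1 (mult_op a n g) /\ A1norm (mult_op a n g) <= K * A1norm g.
Proof.
have [K0 K00 hK0] := cs_coef_mon A1_space; have [K hK] := mult_bounded A1_space (@ha n).
exists (`|K| * K0); first by rewrite mulr_ge0.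
move=> g hg; have [h1 h2] := hK g (K0 * A1norm g) (fun k => hK0 g k hg).
split => //; apply: le_trans h2 _; rewrite mulrA ler_wpM2r ?A1norm_ge0//.
by rewrite ler_wpM2r ?ler_norm.
Qed.

(** For h in B the terms h_k z^k are bounded in norm, so T_n h is an absolutely convergent series of
    monomials in B_0. *)
Lemma mult_Bloch n h : Bloch h -> Bloch0 (mult_op a n h).
Proof.
move=> hh; have [K hK] := mult_bounded Bloch0_space (@ha n).
apply: (hK h (24 * Blochnorm h) _).1 => k; have [_ m3] := Bloch_mon R k.
apply: le_trans (ler_wpM2l (cabs_ge0 _) m3) _.
have := Bloch_coef k hh; move: (cabs _) (Blochnorm h) => x y; lra.
Qed.

Lemma pairing_mult n g h : A1 g -> Bloch h -> pairing (mult_op a n g) h = pairing g (mult_op a n h).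
Proof.
move=> hg hh; have [K _ hK] := mult_A1 n; have [h1 _] := hK g hg.
apply: (pairing_eq hg h1 (mult_Bloch n hh).1 hh) => k.
by rewrite /mult_op mulrCA mulrA.
Qed.

Lemma blf_pairingl h : Bloch h -> bdd_lin_functional (@A1 R) (@A1norm R) (fun g => pairing g h).
Proof.
move=> hh; split; first by move=> u v al be hu hv; exact: pairing_linl.
exists (66 * Blochnorm h) => u hu; rewrite mulrAC; exact: pairing_le.
Qed.

Lemma blf_pairingr g : A1 g -> bdd_lin_functional (@Bloch0 R) (@Blochnorm R) (pairing g).
Proof.
move=> hg; split; first by move=> u v al be hu hv; exact: pairing_linr hg hu.1 hv.1.
by exists (66 * A1norm g) => u hu; exact: pairing_le hg hu.1.
Qed.

(** The common consequence through which the weak and weak* conditions are fed into the norm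
    statements. *)
Definition pair_conv := forall g f, A1 g -> Bloch0 f -> pairing (mult_op a n g) f @[n --> \oo] --> pairing g f.

(** Test with g = f = z^k: the pairing is a nonzero constant times a_nk. *)
Lemma pair_conv_coef : pair_conv -> forall k, a n k @[n --> \oo] --> (1 : C).
Proof.
move=> h k; have [m1 _] := A1_mon R k; have [b1 _] := Bloch_mon R k.
pose q : C := ((A0 R / pi)%:C)%C / k.+1%:R.
have q0 : q != 0.
  apply/eqP => e; have : cabs q = 0 by rewrite e cabs0.
  have p : 0 < A0 R / pi by rewrite divr_gt0 ?A0_gt0 ?pi_gt0.
  rewrite cabsM cabs_real cabsV cabs_nat (gtr0_norm p); apply/eqP.
  by rewrite gt_eqF// mulr_gt0// invr_gt0 ltr0n.
have := h _ _ m1 b1; rewrite (pairing_mon k b1.1).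
have -> : (fun n => pairing (mult_op a n (mon R k)) (mon R k)) = fun n => q * a n k.
  apply/funext => n; rewrite (pairing_mult n m1 b1.1) (pairing_mon k (mult_Bloch n b1.1).1).
  by rewrite /mult_op /mon eqxx mulr1 /q mulrAC mulrA.
have -> : ((A0 R / pi)%:C)%C * (mon R k k / k.+1%:R) = q by rewrite /mon eqxx mul1r.
move=> c; have e1 : q^-1 * q = 1 by exact: mulVf.
have e2 : (fun n => q^-1 * (q * a n k)) = fun n => a n k.
  by apply/funext => n; exact: mulKf.
have c2 : (fun n => q^-1 * (q * a n k)) @ \oo --> q^-1 * q by exact: (cvgCM (cvg_cst q^-1) c).
by move: c2; rewrite e1 e2; apply.
Qed.

Lemma pair_conv_bound : pair_conv -> exists2 M, 0 <= M & forall n g f, A1 g -> Bloch0 f ->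
  cabs (pairing (mult_op a n g) f) <= M * A1norm g * Blochnorm f.
Proof.
move=> h; have hA n g (hg : A1 g) : A1 (mult_op a n g).
  by have [K _ hK] := mult_A1 n; exact: (hK g hg).1.
have s1 g : A1 g -> exists2 M, 0 <= M & forall n f, Bloch0 f -> cabs (pairing (mult_op a n g) f) <= M * Blochnorm f.
  move=> hg.
  have [||M M0 hM] := uniform_boundedness (P := fun=> True) (F := fun n f => pairing (mult_op a n g) f) Bloch0_space.
  - by move=> n _; exact: blf_pairingr (hA n g hg).
  - move=> f hf; have [B hB] := cvgC_bounded (h g f hg hf); exists B => n _; exact: hB.
  - by exists M => // n f hf; exact: hM.
(* The second application is indexed by n together with f in the unit ball of B_0. Its pointwise
   bounds are those of [s1], which depend on g but not on n or f. *)
have [||M M0 hM] := uniform_boundedness (P := fun i : nat * (nat -> C) => Bloch0 i.2 /\ Blochnorm i.2 <= 1)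
   (F := fun i g => pairing (mult_op a i.1 g) i.2) A1_space.
- move=> [n f] [/= hf f1]; split.
    move=> u v al be hu hv.
    have -> : mult_op a n (fun k => al * u k + be * v k) = fun k => al * mult_op a n u k + be * mult_op a n v k.
      by apply/funext => k; rewrite /mult_op; ring.
    exact: (pairing_linl al be (hA n u hu) (hA n v hv) hf.1).
  have [K K0 hK] := mult_A1 n; exists (66 * K) => u hu.
  have N0 := Blochnorm_ge0 hf.1.
  apply: le_trans (pairing_le (hA n u hu) hf.1) _.
  have x0 : 0 <= 66 * A1norm (mult_op a n u) by rewrite mulr_ge0 ?A1norm_ge0.
  apply: le_trans (ler_wpM2l x0 f1) _; rewrite mulr1 -mulrA ler_wpM2l//; exact: (hK u hu).2.
- move=> g hg; have [M M0 hM] := s1 g hg; exists M => -[n f] [/= hf f1].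
  by apply: le_trans (hM n f hf) _; rewrite ler_piMr.
exists M => // n g f hg hf; have N0 := Blochnorm_ge0 hf.1.
have [e|ne] := eqVneq (Blochnorm f) 0.
  have := pairing_le (hA n g hg) hf.1; rewrite e !mulr0.
  by [].
have Np : 0 < Blochnorm f by rewrite lt_neqAle eq_sym ne.
pose al : C := (((Blochnorm f)^-1)%:C)%C.
have cal : cabs al = (Blochnorm f)^-1 by rewrite cabs_real ger0_norm// invr_ge0.
have [Sf nf] := cs_scale Bloch0_space al hf.
have f1 : Blochnorm (fun k => al * f k) <= 1 by apply: le_trans nf _; rewrite cal mulVf.
have := hM (n, fun k => al * f k) g (conj Sf f1) hg.
rewrite /= (blf_scale al (blf_pairingr (hA n g hg)) hf) cabsM cal.
by rewrite mulrC ler_pdivrMr.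
Qed.

Lemma pair_conv_A1 : pair_conv -> forall g, A1 g -> norm_to (@A1norm R) (fun n => mult_op a n g) g.
Proof.
move=> h g hg; have [M M0 hM] := pair_conv_bound h.
have M12 : 0 <= 12 * M by rewrite mulr_ge0.
apply: (mult_norm_cvg A1_space M12 _ (pair_conv_coef h) hg) => n v hv.
have [K _ hK] := mult_A1 n; have [T1 _] := hK v hv; split => //.
rewrite -mulrA; apply: (A1norm_le_pairing _ T1); first by rewrite mulr_ge0 ?A1norm_ge0.
by move=> f hf; exact: hM.
Qed.

Lemma pair_conv_Bloch0 : pair_conv -> forall f, Bloch0 f -> norm_to (@Blochnorm R) (fun n => mult_op a n f) f.
Proof.
move=> h f hf; have [M M0 hM] := pair_conv_bound h.
have M6 : 0 <= 6 * M by rewrite mulr_ge0.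
apply: (mult_norm_cvg Bloch0_space M6 _ (pair_conv_coef h) hf) => n v hv.
have T1 := mult_Bloch n hv.1; split => //.
rewrite -mulrA; apply: (Blochnorm_le_pairing _ T1.1); first by rewrite mulr_ge0 ?Blochnorm_ge0//; exact: hv.1.
move=> g hg; rewrite -(pairing_mult n hg hv.1) mulrAC; exact: hM.
Qed.

Lemma norm_to_weak S (N : (nat -> C) -> R) (L : (nat -> C) -> C) (u : nat -> nat -> C) f : coef_space S N ->
  bdd_lin_functional S N L -> (forall n, S (u n)) -> S f -> norm_to N u f -> L (u n) @[n --> \oo] --> L f.
Proof.
move=> H hL Su Sf hu; have [M M0 hM] := blf_bound H hL.
apply: (squeezeC (g := fun n => M * N (fun k => u n k - f k))).
  apply: nearW => n; rewrite -(blf_sub hL (Su n) Sf); exact: hM (cs_sub H (Su n) Sf).1.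
by rewrite -[X in _ --> X](mulr0 M); apply: cvgM; [exact: cvg_cst|exact: hu].
Qed.

End Multipliers.

Theorem theorem5p4 (R : realType) (a : nat -> nat -> (R[i])^o) :
  (forall n : nat, cvg (series (fun k => cabs (a n k)) @ \oo)) ->
  [<-> (forall g, A1 g -> weakly_to (@A1 R) (@A1norm R) (fun n => mult_op a n g) g);
       (forall g, A1 g -> norm_to (@A1norm R) (fun n => mult_op a n g) g);
       (forall h, Bloch h -> weakstar_to_Bloch (fun n => mult_op a n h) h);
       (forall f, Bloch0 f -> weakly_to (@Bloch0 R) (@Blochnorm R) (fun n => mult_op a n f) f);
       (forall f, Bloch0 f -> norm_to (@Blochnorm R) (fun n => mult_op a n f) f)].
Proof.
move=> ha.
have hA n g (hg : A1 g) : A1 (mult_op a n g).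
  by have [K _ hK] := mult_A1 ha n; exact: (hK g hg).1.
have hB n f (hf : Bloch0 f) : Bloch0 (mult_op a n f) by exact: (mult_Bloch ha n hf.1).
have swap g f : A1 g -> Bloch f ->
    (fun n => pairing (mult_op a n g) f) = fun n => pairing g (mult_op a n f).
  by move=> hg hf; apply/funext => n; exact: pairing_mult.
(* An arbitrary functional on B_0 is reached only through norm convergence, since [pair_conv]
   concerns functionals given by the pairing. *)
have weakB : pair_conv a -> forall f, Bloch0 f -> weakly_to (@Bloch0 R) (@Blochnorm R) (fun n => mult_op a n f) f.
  move=> h f hf L hL; apply: (norm_to_weak (Bloch0_space R) hL _ hf) => [n|]; first exact: hB.
  exact: pair_conv_Bloch0.
tfae.
(* Pairing with a fixed f in B_0 is one of the bounded functionals on A^1 tested by weak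
   convergence. *)
- move=> h1; apply: (pair_conv_A1 ha) => g f hg hf.
  exact: (h1 g hg _ (blf_pairingl hf.1)).
- move=> h2 h hh g hg; rewrite -(swap g h hg hh).
  exact: (norm_to_weak (A1_space R) (blf_pairingl hh) (fun n => hA n g hg) hg (h2 g hg)).
- move=> h3; apply: weakB => g f hg hf; rewrite (swap g f hg hf.1).
  exact: (h3 f hf.1 g hg).
- move=> h4; apply: (pair_conv_Bloch0 ha) => g f hg hf; rewrite (swap g f hg hf.1).
  exact: (h4 f hf _ (blf_pairingr hg)).
(* Closing the cycle crosses from B_0 back to A^1: norm convergence in B_0 gives [pair_conv], hence
   norm convergence in A^1, hence convergence under any functional. *)
- move=> h5 g hg L hL.
  have h : pair_conv a.
    move=> g' f hg' hf; rewrite (swap g' f hg' hf.1).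
    exact: (norm_to_weak (Bloch0_space R) (blf_pairingr hg') (fun n => hB n f hf) hf (h5 f hf)).
  exact: (norm_to_weak (A1_space R) hL (fun n => hA n g hg) hg (pair_conv_A1 ha h hg)).
Qed.
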